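(* Let $\mathfrak{g}$ be a finite-dimensional simple Lie algebra over $\mathbb{C}$ of type $A_n$, $D_n$ or $E_6$, let $\sigma$ be a non-trivial graph automorphism of its Dynkin diagram, and let $\lambda$ be a minuscule weight of $\mathfrak{g}$. Let $\mathfrak{g}(0)$, $\tilde{W}$, $\mathrm{res}$, $P_\lambda$, the map $\tilde{f}:\tilde{W}\,\mathrm{res}(\lambda)\to\mathcal{F}(P_\lambda)$, its image $\tilde{\mathcal{F}}(P_\lambda)$, and the orders $\le_w,\le_s,\tilde{\unlhd}$ be as defined in the context. Then: (1) The poset $(\tilde{W}\,\mathrm{res}(\lambda),\le_w)$ is isomorphic to the poset $(\tilde{\mathcal{F}}(P_\lambda),\tilde{\unlhd})$ under the map $\tilde{f}:\tilde{W}\,\mathrm{res}(\lambda)\to\tilde{\mathcal{F}}(P_\lambda)$. (2) The poset $(\tilde{W}\,\mathrm{res}(\lambda),\le_s)$ is isomorphic to the poset $(\tilde{\mathcal{F}}(P_\lambda),\subseteq)$ under the map $\tilde{f}:\tilde{W}\,\mathrm{res}(\lambda)\to\tilde{\mathcal{F}}(P_\lambda)$.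
   Context: **Lie algebra notation.** $\mathfrak{g}$ has Cartan matrix $(a_{ij})_{i,j\in I}$, Cartan subalgebra $\mathfrak{h}$, simple coroots $h_i\in\mathfrak{h}$, simple roots $\alpha_i\in\mathfrak{h}^*$, positive roots $\Delta_+$, fundamental weights $\Lambda_i$, Chevalley generators $e_i,f_i$, and Weyl group $W=\langle s_i\mid i\in I\rangle$ with $s_i(\mu)=\mu-\mu(h_i)\alpha_i$. For $\beta\in\Delta_+$, $\beta^\vee$ is its coroot and $s_\beta(\mu)=\mu-\mu(\beta^\vee)\beta$. **Orders on orbits.** For a dominant integral weight $\lambda$ and $\mu,\mu'\in W\lambda$: $\mu\le_s\mu'$ iff there are $\mu=\mu_0,\dots,\mu_k=\mu'$ in $W\lambda$ and $\beta_0,\dots,\beta_{k-1}\in\Delta_+$ with $s_{\beta_i}(\mu_i)=\mu_{i+1}$ and $\mu_i(\beta_i^\vee)>0$ for all $i$; $\mu\le_w\mu'$ iff there are $\mu=\mu_0,\dots,\mu_k=\mu'$ in $W\lambda$ and $j_0,\dots,j_{k-1}\in I$ with $s_{j_i}(\mu_i)=\mu_{i+1}$ and $\mu_i(h_{j_i})>0$ for all $i$ ($k\ge 0$). The same definitions are used for $\mathfrak{g}(0)$ (below), its Weyl group $\tilde W$, its positive roots and simple coroots. **Minuscule.** A (nonzero) dominant integral weight $\lambda$ is minuscule if $(w\lambda)(h_i)\in\{-1,0,1\}$ for all $w\in W$, $i\in I$; such $\lambda$ is a fundamental weight. **Folding.** $J$ is the set of $\langle\sigma\rangle$-orbits on $I$.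 $\sigma$ induces the Lie algebra automorphism with $e_i\mapsto e_{\sigma(i)}$, $f_i\mapsto f_{\sigma(i)}$, $h_i\mapsto h_{\sigma(i)}$, and acts on $\mathfrak{h}^*$ by $(\sigma\mu)(h)=\mu(\sigma^{-1}(h))$. $\mathfrak{g}(0)=\{x\in\mathfrak{g}\mid\sigma(x)=x\}$. An orbit $p\in J$ satisfies the orthogonality condition if $a_{ij}=0$ for all distinct $i,j\in p$. Set $H_p=\sum_{i\in p}h_i$ if $p$ satisfies the orthogonality condition and $H_p=2\sum_{i\in p}h_i$ otherwise. $\mathfrak{g}(0)$ is a simple Lie algebra with Cartan subalgebra $\mathfrak{h}(0)=\mathrm{span}\{H_p\}_{p\in J}$, simple coroots $H_p$, and simple roots $\beta_p=\mathrm{res}(\alpha_i)$ ($i\in p$), where $\mathrm{res}:\mathfrak{h}^*\to\mathfrak{h}(0)^*$ is restriction. $\tilde{W}=\langle\tilde{s}_p\mid p\in J\rangle$, $\tilde{s}_p(\nu)=\nu-\nu(H_p)\beta_p$, is its Weyl group. $\hat{W}=\{w\in W\mid\sigma w\sigma^{-1}=w\}$ (in $GL(\mathfrak{h}^* )$). The map $\mathrm{res}$ restricts to a bijection $\hat{W}\lambda\to\tilde{W}\,\mathrm{res}(\lambda)$. **d-complete posets.** Write $x\to y$ if $x$ is covered by $y$. An order filter of a poset $P$ is an up-closed subset; $\mathcal{F}(P)$ is the set of order filters. For $k\ge3$, $d_k(1)$ is the poset $\{w_k,\dots,w_3,x,y,z_3,\dots,z_k\}$ with $w_k<\cdots<w_3<x,y<z_3<\cdots<z_k$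 and $x,y$ incomparable; $d_k^-(1)=d_k(1)\setminus\{z_k\}$. An interval isomorphic to $d_k(1)$ ($k\ge3$) is a $d_k$-interval; an interval isomorphic to $d_k^-(1)$ ($k\ge4$) is a $d_k^-$-interval; a $d_3^-$-interval is a set $\{w,x,y\}$ with $x\ne y$, $w\to x$, $w\to y$. A finite poset $P$ is d-complete if for all $k\ge3$: (D1) for every $d_k^-$-interval $I'$ there is $z\in P$ with $I'\cup\{z\}$ a $d_k$-interval; (D2) if $I'$ is a $d_k$-interval, every element covered by $\max I'$ lies in $I'$; (D3) there are no two $d_k^-$-intervals $I',I''$ with $I'\setminus\{\min I'\}=I''\setminus\{\min I''\}$ and $\min I'\ne\min I''$. The top tree $T_P$ is the set of $x\in P$ such that every $y\ge x$ is covered by at most one element. $P$ is self-dual if isomorphic to its order dual, and connected if its Hasse diagram is connected. **$P_\lambda$, $\kappa$ and $f$.** For $\lambda=\Lambda_m$ minuscule, $P_\lambda$ is the (known to exist) connected self-dual d-complete poset such that $(W\lambda,\le_s)\cong(\mathcal{F}(P_\lambda),\subseteq)$. The Hasse diagram of $T_{P_\lambda}$, as a graph, is the Dynkin diagram of $\mathfrak{g}$, and $\kappa:P_\lambda\to I$ is the coloring such that $\kappa|_{T_{P_\lambda}}$ is a graph isomorphism onto the Dynkin diagram, the maximum of $P_\lambda$ has color $m$, and $\kappa(w)=\kappa(z)$ for every $d_k$-interval $[w,z]$, $k\ge3$. $f:(W\lambda,\le_s)\to(\mathcal{F}(P_\lambda),\subseteq)$ is the (known to exist) unique order isomorphism such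 that, for $\mu\in W\lambda$ and $i\in I$, $s_i\mu$ covers $\mu$ in $W\lambda$ iff $f(s_i\mu)\setminus f(\mu)$ consists of one element, of color $i$. **$\tilde f$, $\tilde{\mathcal F}(P_\lambda)$ and $\tilde\unlhd$.** $\tilde f:\tilde W\,\mathrm{res}(\lambda)\to\mathcal{F}(P_\lambda)$ is defined by $\tilde f(\mathrm{res}(\mu))=f(\mu)$ for $\mu\in\hat W\lambda$, and $\tilde{\mathcal{F}}(P_\lambda)=\mathrm{Im}(\tilde f)$. Let $\tilde\kappa:P_\lambda\to J$ send $x$ to the $\langle\sigma\rangle$-orbit of $\kappa(x)$. For $p\in J$, $F\in\mathcal{F}(P_\lambda)$, let $\tilde A_p(F)$ be the union of all $F'\in\mathcal{F}(P_\lambda)$ with $F'\setminus F\subseteq\tilde\kappa^{-1}(\{p\})$, let $\tilde R_p(F)$ be the intersection of all $F'\in\mathcal{F}(P_\lambda)$ with $F\setminus F'\subseteq\tilde\kappa^{-1}(\{p\})$, and let $\tilde S_p(F)=(\tilde A_p(F)\setminus F)\cup\tilde R_p(F)$ if this set is an order filter, $\tilde S_p(F)=F$ otherwise. For $F,F'\in\mathcal{F}(P_\lambda)$, $F\,\tilde\unlhd\,F'$ iff there are order filters $F=F_0,\dots,F_n=F'$ of $P_\lambda$ ($n\ge0$) such that for each $i<n$ there is $p_i\in J$ with $\tilde S_{p_i}(F_i)=F_{i+1}\supsetneq F_i$. $\tilde{\mathcal F}(P_\lambda)$ carries the restricted orders. *)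

(* Defs.v *)
From mathcomp Require Import all_boot all_order all_algebra all_fingroup.

Set Implicit Arguments.
Unset Strict Implicit.
Unset Printing Implicit Defensive.

Import Order.TTheory GRing.Theory Num.Theory.
Local Open Scope ring_scope.

Record lie_alg (K : fieldType) := LieAlg {
  lie_carrier :> vectType K;
  lie : lie_carrier -> lie_carrier -> lie_carrier;
  lie_linearl : forall y, linear (fun x => lie x y);
  lie_linearr : forall x, linear (lie x);
  lie_alt : forall x, lie x x = 0;
  lie_jacobi : forall x y z,
    lie x (lie y z) + lie y (lie z x) + lie z (lie x y) = 0
}.

Definition lie_simple (K : fieldType) (g : lie_alg K) : Prop :=
  (exists x y : g, lie x y != 0) /\
  (forall U : {vspace g},
    (forall x y, y \in U -> lie x y \in U) -> U = 0%VS \/ U = fullv).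

Inductive dynkin := TypeA of nat | TypeD of nat | TypeE6.

Definition dynkin_valid (t : dynkin) : bool :=
  match t with
  | TypeA n => (1 <= n)%N
  | TypeD n => (4 <= n)%N
  | TypeE6 => true
  end.

Definition rank (t : dynkin) : nat :=
  match t with TypeA n => n | TypeD n => n | TypeE6 => 6 end.

(* Bourbaki labelling shifted by one, so that nodes are numbered from 0; each
   edge is listed once, from its smaller to its larger endpoint. *)
Definition dynkin_edge (t : dynkin) (i j : nat) : bool :=
  match t with
  | TypeA n => j == i.+1
  | TypeD n => (j == i.+1) && (j < n.-1)%N || (i == n - 3)%N && (j == n.-1)
  | TypeE6 => (i, j) \in [:: (0, 2); (2, 3); (3, 4); (4, 5); (1, 3)]%N
  end.

Definition cartan_mx (t : dynkin) (i j : 'I_(rank t)) : int :=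
  if i == j then 2
  else if dynkin_edge t i j || dynkin_edge t j i then -1 else 0.

Definition diagram_aut n (a : 'I_n -> 'I_n -> int) (s : {perm 'I_n}) : Prop :=
  forall i j, a (s i) (s j) = a i j.

Definition dual (K : fieldType) (g : lie_alg K) (U : {vspace g}) :=
  'Hom(subvs_of U, K^o).

(* [vsproj U x] is [x] seen in [subvs_of U]; only used when [x \in U]. *)
Definition ev (K : fieldType) (g : lie_alg K) (U : {vspace g})
  (mu : dual U) (x : g) : K := mu (vsproj U x).

(* A Lie subalgebra with a Cartan subalgebra, simple coroots and simple roots:
   the definitions below are shared by g and by its fixed subalgebra g(0). *)
Record cartan_datum (K : fieldType) (g : lie_alg K) := CartanDatum {
  cd_index : finType;
  cd_alg : {vspace g};
  cd_cartan : {vspace g};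
  cd_coroot : cd_index -> g;
  cd_root : cd_index -> dual cd_cartan
}.

Definition weight (K : fieldType) (g : lie_alg K) (D : cartan_datum g) :=
  dual (cd_cartan D).

Definition simple_refl (K : fieldType) (g : lie_alg K) (D : cartan_datum g)
    (i : cd_index D) : 'End(weight D) :=
  linfun (fun mu : weight D => mu - ev mu (cd_coroot i) *: cd_root i).

(* The subgroup of GL generated by the simple reflections; as these are
   involutions, closing under products suffices. *)
Inductive weyl (K : fieldType) (g : lie_alg K) (D : cartan_datum g) :
    'End(weight D) -> Prop :=
| weyl_id : weyl \1%VF
| weyl_refl i w : weyl w -> weyl (simple_refl i \o w)%VF.

Definition weyl_orbit (K : fieldType) (g : lie_alg K) (D : cartan_datum g)
    (la mu : weight D) : Prop :=
  exists2 w, weyl w & mu = w la.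

Definition is_root (K : fieldType) (g : lie_alg K) (D : cartan_datum g)
    (b : weight D) : Prop :=
  b != 0 /\
  exists2 x : g, x \in cd_alg D & x != 0 /\
    forall h, h \in cd_cartan D -> lie h x = ev b h *: x.

Definition positive_root (K : fieldType) (g : lie_alg K) (D : cartan_datum g)
    (b : weight D) : Prop :=
  is_root b /\
  exists c : cd_index D -> nat, b = \sum_(i : cd_index D) cd_root i *+ c i.

(* The coroot of [b] in the sense of root systems: the (unique) [v] with
   [b(v) = 2] whose associated reflection preserves the set of roots. *)
Definition is_coroot (K : fieldType) (g : lie_alg K) (D : cartan_datum g)
    (b : weight D) (v : g) : Prop :=
  [/\ v \in cd_cartan D,
      ev b v = 2 &
      forall c : weight D, is_root c -> is_root (c - ev c v *: b)].

Definition chain_in (T : Type) (A : T -> Prop) (step : T -> T -> Prop)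
    (x y : T) : Prop :=
  exists (k : nat) (u : nat -> T),
    [/\ u 0%N = x, u k = y,
        forall i, (i <= k)%N -> A (u i) &
        forall i, (i < k)%N -> step (u i) (u i.+1)].

Definition le_s (K : numFieldType) (g : lie_alg K) (D : cartan_datum g)
    (la mu mu' : weight D) : Prop :=
  chain_in (weyl_orbit la)
    (fun nu nu' => exists b v,
      [/\ positive_root b, is_coroot b v,
          nu - ev nu v *: b = nu' & 0 < ev nu v])
    mu mu'.

Definition le_w (K : numFieldType) (g : lie_alg K) (D : cartan_datum g)
    (la mu mu' : weight D) : Prop :=
  chain_in (weyl_orbit la)
    (fun nu nu' => exists j : cd_index D,
      simple_refl j nu = nu' /\ 0 < ev nu (cd_coroot j))
    mu mu'.

Definition poset_iso (T U : Type)
    (A : T -> Prop) (leT : T -> T -> Prop)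
    (B : U -> Prop) (leU : U -> U -> Prop) (f : T -> U) : Prop :=
  [/\ forall x, A x -> B (f x),
      forall x x', A x -> A x' -> f x = f x' -> x = x',
      forall y, B y -> exists2 x, A x & f x = y &
      forall x x', A x -> A x' -> (leT x x' <-> leU (f x) (f x'))].

Definition covers_in (T : Type) (A : T -> Prop) (leT : T -> T -> Prop)
    (x y : T) : Prop :=
  [/\ A x, A y, leT x y, x <> y &
      forall z, A z -> leT x z -> leT z y -> z = x \/ z = y].

(* The sign convention is [h_i, e_j] = a_ij e_j, i.e. alpha_j(h_i) = a_ij. *)
Record chevalley (K : fieldType) n (a : 'I_n -> 'I_n -> int) (g : lie_alg K) :=
Chevalley {
  ce : 'I_n -> g;
  cf : 'I_n -> g;
  ch : 'I_n -> g;
  ch_free : free [tuple ch i | i < n];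
  ch_ch : forall i j, lie (ch i) (ch j) = 0;
  ch_ce : forall i j, lie (ch i) (ce j) = (a i j)%:~R *: ce j;
  ch_cf : forall i j, lie (ch i) (cf j) = - ((a i j)%:~R *: cf j);
  ce_cf : forall i j, lie (ce i) (cf j) = if i == j then ch i else 0;
  chevalley_gen : forall U : {vspace g},
    (forall i, ce i \in U /\ cf i \in U) ->
    (forall x y, x \in U -> y \in U -> lie x y \in U) -> U = fullv
}.

Definition cartan (K : fieldType) n (a : 'I_n -> 'I_n -> int) (g : lie_alg K)
    (S : chevalley a g) : {vspace g} :=
  <<[tuple ch S i | i < n]>>%VS.

(* The linear form on the Cartan subalgebra mapping h_i to [c i]. *)
Definition form_of (K : fieldType) n (a : 'I_n -> 'I_n -> int) (g : lie_alg K)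
    (S : chevalley a g) (c : 'I_n -> K) : dual (cartan S) :=
  linfun (fun x : subvs_of (cartan S) =>
    (\sum_i c i * coord [tuple ch S i | i < n] i (vsval x)) : K^o).

Definition alpha (K : fieldType) n (a : 'I_n -> 'I_n -> int) (g : lie_alg K)
    (S : chevalley a g) (j : 'I_n) : dual (cartan S) :=
  form_of S (fun i => (a i j)%:~R).

Definition fund_weight (K : fieldType) n (a : 'I_n -> 'I_n -> int)
    (g : lie_alg K) (S : chevalley a g) (m : 'I_n) : dual (cartan S) :=
  form_of S (fun i => (i == m)%:R).

Definition datum (K : fieldType) n (a : 'I_n -> 'I_n -> int) (g : lie_alg K)
    (S : chevalley a g) : cartan_datum g :=
  @CartanDatum K g 'I_n fullv (cartan S) (ch S) (alpha S).

Definition dominant_integral (K : fieldType) (g : lie_alg K)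
    (D : cartan_datum g) (la : weight D) : Prop :=
  forall i : cd_index D, exists k : nat, ev la (cd_coroot i) = k%:R.

Definition minuscule (K : fieldType) (g : lie_alg K) (D : cartan_datum g)
    (la : weight D) : Prop :=
  [/\ la != 0, dominant_integral la &
      forall w (i : cd_index D), weyl w ->
        ev (w la) (cd_coroot i) \in [:: -1; 0; 1]].

Definition lifts_diagram_aut (K : fieldType) n (a : 'I_n -> 'I_n -> int)
    (g : lie_alg K) (S : chevalley a g) (s : {perm 'I_n}) (sg : 'End(g)) :
    Prop :=
  [/\ lker sg = 0%VS,
      forall x y, sg (lie x y) = lie (sg x) (sg y) &
      forall i, [/\ sg (ce S i) = ce S (s i), sg (cf S i) = cf S (s i) &
                    sg (ch S i) = ch S (s i)]].

Definition sigma_orbit n (s : {perm 'I_n}) := {p : {set 'I_n} | p \in porbits s}.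

Definition orbit_of n (s : {perm 'I_n}) (i : 'I_n) : sigma_orbit s :=
  exist _ (porbit s i) (imset_f (porbit s) (erefl true)).

Definition orthogonal_orbit n (a : 'I_n -> 'I_n -> int) (p : {set 'I_n}) : bool :=
  [forall i in p, forall j in p, (i != j) ==> (a i j == 0)].

Definition fold_coroot (K : fieldType) n (a : 'I_n -> 'I_n -> int)
    (g : lie_alg K) (S : chevalley a g) (s : {perm 'I_n})
    (p : sigma_orbit s) : g :=
  let h := \sum_(i in val p) ch S i in
  if orthogonal_orbit a (val p) then h else h *+ 2.

Definition fold_cartan (K : fieldType) n (a : 'I_n -> 'I_n -> int)
    (g : lie_alg K) (S : chevalley a g) (s : {perm 'I_n}) : {vspace g} :=
  <<[seq fold_coroot S p | p : sigma_orbit s]>>%VS.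

(* [fold_cartan] is contained in [cartan], so this is plain restriction. *)
Definition res (K : fieldType) n (a : 'I_n -> 'I_n -> int) (g : lie_alg K)
    (S : chevalley a g) (s : {perm 'I_n}) (mu : dual (cartan S)) :
    dual (fold_cartan S s) :=
  linfun (fun x : subvs_of (fold_cartan S s) => ev mu (vsval x) : K^o).

(* For a diagram automorphism [s], all [alpha i] with [i] in the orbit [p] have
   the same restriction; orbits are nonempty, so the default is not reached. *)
Definition fold_root (K : fieldType) n (a : 'I_n -> 'I_n -> int)
    (g : lie_alg K) (S : chevalley a g) (s : {perm 'I_n})
    (p : sigma_orbit s) : dual (fold_cartan S s) :=
  if [pick i in val p] is Some i then res s (alpha S i) else 0.

Definition fold_datum (K : fieldType) n (a : 'I_n -> 'I_n -> int)
    (g : lie_alg K) (S : chevalley a g) (s : {perm 'I_n}) (sg : 'End(g)) :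
    cartan_datum g :=
  @CartanDatum K g (sigma_orbit s) (fixedSpace sg) (fold_cartan S s)
    (@fold_coroot K n a g S s) (@fold_root K n a g S s).

Definition sigma_dual (K : fieldType) n (a : 'I_n -> 'I_n -> int)
    (g : lie_alg K) (S : chevalley a g) (sg : 'End(g)) :
    'End(dual (cartan S)) :=
  linfun (fun mu : dual (cartan S) =>
    linfun (fun x : subvs_of (cartan S) =>
      ev mu ((sg^-1)%VF (vsval x)) : K^o) : dual (cartan S)).

Definition weyl_fixed (K : fieldType) n (a : 'I_n -> 'I_n -> int)
    (g : lie_alg K) (S : chevalley a g) (sg : 'End(g))
    (w : 'End(weight (datum S))) : Prop :=
  weyl w /\ (sigma_dual S sg \o w \o (sigma_dual S sg)^-1)%VF = w.

Section Poset.
Context {disp : Order.disp_t} {P : finPOrderType disp}.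
Implicit Types (x y z w : P) (I F : {set P}) (k : nat).

Definition cov x y : bool :=
  (x < y)%O && [forall z, ~~ ((x < z)%O && (z < y)%O)].

Definition order_filter F : bool :=
  [forall x, forall y, (x \in F) && (x <= y)%O ==> (y \in F)].

Definition itv_set w z : {set P} := [set x | (w <= x)%O && (x <= z)%O].

Definition is_max I z : Prop := z \in I /\ forall x, x \in I -> (x <= z)%O.
Definition is_min I w : Prop := w \in I /\ forall x, x \in I -> (w <= x)%O.

(* The order of d_k(1) on {0, ..., 2k-3}, enumerated as
   w_k, ..., w_3, x, y, z_3, ..., z_k; d_k^-(1) is its restriction to
   {0, ..., 2k-4}. The elements x and y have numbers k-2 and k-1. *)
Definition dk_le k (i j : nat) : bool :=
  (i == j) || (i < j)%N && ~~ ((i == k.-2) && (j == k.-1)).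

Definition iso_to_ord n (r : rel nat) I : Prop :=
  exists phi : 'I_n -> P,
    [/\ injective phi, phi @: [set: 'I_n] = I &
        forall i j, (phi i <= phi j)%O = r i j].

Definition dk_interval k I : Prop :=
  (exists w z, I = itv_set w z) /\ iso_to_ord (2 * k - 2) (dk_le k) I.

Definition dk_minus_interval k I : Prop :=
  if k == 3 then
    exists w x y, [/\ I = [set w; x; y], x != y, cov w x & cov w y]
  else
    (exists w z, I = itv_set w z) /\ iso_to_ord (2 * k - 3) (dk_le k) I.

Definition d_complete : Prop :=
  forall k, (3 <= k)%N ->
  [/\ forall I, dk_minus_interval k I -> exists z, dk_interval k (z |: I),
      forall I z y, dk_interval k I -> is_max I z -> cov y z -> y \in I &
      forall I1 I2 w1 w2,
        dk_minus_interval k I1 -> dk_minus_interval k I2 ->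
        is_min I1 w1 -> is_min I2 w2 ->
        I1 :\ w1 = I2 :\ w2 -> w1 = w2].

Definition top_tree : {set P} :=
  [set x | [forall y, (x <= y)%O ==> (#|[set z | cov y z]| <= 1)%N]].

Definition self_dual : Prop :=
  exists2 phi : P -> P, bijective phi &
    forall x y, (phi x <= phi y)%O = (y <= x)%O.

Definition connected_poset : Prop :=
  forall x y, connect (fun u v : P => cov u v || cov v u) x y.

(* The top tree is upward closed, hence its own covering relation is the
   restriction of that of the poset. *)
Definition dcomplete_coloring n (a : 'I_n -> 'I_n -> int) (m : 'I_n)
    (kappa : P -> 'I_n) : Prop :=
  [/\ {in top_tree &, injective kappa} /\
        (forall i, exists2 x, x \in top_tree & kappa x = i),
      {in top_tree &, forall x y,
         cov x y || cov y x = (kappa x != kappa y) && (a (kappa x) (kappa y) != 0)},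
      forall z, is_max setT z -> kappa z = m &
      forall k w z, (3 <= k)%N -> dk_interval k (itv_set w z) ->
        kappa w = kappa z].

Definition fold_color n (s : {perm 'I_n}) (kappa : P -> 'I_n) (x : P) :
    sigma_orbit s :=
  orbit_of s (kappa x).

Definition fold_add (J : finType) (ka : P -> J) (p : J) F : {set P} :=
  \bigcup_(F' : {set P} | order_filter F' && (F' :\: F \subset ka @^-1: [set p])) F'.

Definition fold_rem (J : finType) (ka : P -> J) (p : J) F : {set P} :=
  \bigcap_(F' : {set P} | order_filter F' && (F :\: F' \subset ka @^-1: [set p])) F'.

Definition fold_S (J : finType) (ka : P -> J) (p : J) F : {set P} :=
  let G := (fold_add ka p F :\: F) :|: fold_rem ka p F in
  if order_filter G then G else F.

Definition fold_le (J : finType) (ka : P -> J) F F' : Prop :=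
  chain_in order_filter
    (fun G G' => exists p : J, fold_S ka p G = G' /\ G \proper G') F F'.

End Poset.

Definition minuscule_poset (K : numFieldType) (g : lie_alg K)
    (D : cartan_datum g) (la : weight D)
    (disp : Order.disp_t) (P : finPOrderType disp) : Prop :=
  [/\ @connected_poset _ P, @self_dual _ P, @d_complete _ P &
      exists f : weight D -> {set P},
        poset_iso (weyl_orbit la) (le_s la)
          order_filter (fun F F' => F \subset F') f].

Definition colored_iso (K : numFieldType) (g : lie_alg K)
    (D : cartan_datum g) (la : weight D)
    (disp : Order.disp_t) (P : finPOrderType disp)
    (kappa : P -> cd_index D) (f : weight D -> {set P}) : Prop :=
  poset_iso (weyl_orbit la) (le_s la)
    order_filter (fun F F' => F \subset F') f /\
  forall mu (i : cd_index D), weyl_orbit la mu ->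
    (covers_in (weyl_orbit la) (le_s la) mu (simple_refl i mu) <->
     exists2 x, f (simple_refl i mu) :\: f mu = [set x] & kappa x = i).

(* Main.v *)
Require Import Defs.
From Stdlib Require Import Classical.
From HB Require Import structures.
From mathcomp Require Import reals complex.
From mathcomp Require Import all_boot all_order all_algebra all_fingroup.
From mathcomp Require Import ring zify.

Set Implicit Arguments.
Unset Strict Implicit.
Unset Printing Implicit Defensive.
Import Order.TTheory GRing.Theory Num.Theory.
Local Open Scope ring_scope.

(** The weights of the orbit [W la] are written [la - \sum_i d i alpha_i] with
    [d] integral. The weight [la] being minuscule, the Bruhat order on the orbit
    is the pointwise order on [d] ([le_s_wt_ge], [ge_le_s]): if [d <= d'], then
    positivity of the Cartan form yields a simple root that occurs in [d' - d]
    and whose reflection moves one of the two weights towards the other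
    ([orb_descent]). Under [f], the number [d i] counts the elements of colour
    [i] ([card_filt]), so that the filters between which [fold_add] and
    [fold_rem] choose are those of the weights that differ from the given one
    along the orbit [p] only ([filt_color_diff]).

    The reflection of [W~] attached to an orbit [p] lifts to an element of [W]
    that commutes with the automorphism: the product of the [s_i] for [i] in
    [p], or of the [s_i s_j s_i] when [p] consists of pairs of neighbours
    ([fold_refl_fixed]). On weights [w la] with [w] in [W^] the coroots of one
    orbit take values of one sign, because these are the values of [la] and of
    its images under the automorphism at one and the same root
    ([weyl_fixed_coherent]). Therefore the lifted reflection is extremal among
    the moves along [p]: applied to the filter of such a weight, [fold_S] is the
    reflection when this moves the weight up, and adds nothing otherwise
    ([fold_S_up], [fold_S_not_up]). This gives the first isomorphism, step by
    step.

    For the second one, the pointwise order has the lifting properties of a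
    Bruhat order with respect to the lifted reflections ([fold_move_mono],
    [fold_move_lift]), and so does the Bruhat order of the folded orbit
    ([low_mono]). An inclusion of filters thus becomes a chain of reflections by
    induction on the larger weight ([ge_strong]). Conversely, a single step in
    the direction of a positive root of [g(0)] lifts to an inequality, by
    induction on the height of the root ([strong_step_le]): conjugating by a
    simple reflection lowers the height, until the root is a multiple of a
    simple one; the two weights, having equal norms after averaging over the
    orbits, are then exchanged by the simple reflection ([rel_norm_reflect]).

    What is needed on roots is that simple reflections permute them, in [g] and
    in [g(0)], which follows from the representations of [sl2]
    ([is_root_refl]), and that a root of [g(0)] is a combination of simple roots
    with coefficients of one sign, which follows from the triangular
    decomposition of [g] ([fold_root_signed]). *)

(** * Linear algebra *)

Section Subspaces.
Variables (K : fieldType) (V : vectType K).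

(** Lets a linear subspace be given by a proposition, for instance an inductive
    one; a subspace of largest dimension satisfying [Q] exhausts [Q]. *)
Lemma vspace_of_subspace (Q : V -> Prop) :
  Q 0 -> (forall k x y, Q x -> Q y -> Q (k *: x + y)) ->
  exists U : {vspace V}, forall x, x \in U <-> Q x.
Proof.
move=> Q0 QD.
suff ext m : forall U : {vspace V}, (forall x, x \in U -> Q x) ->
    (\dim {:V} - \dim U <= m)%N -> exists U : {vspace V}, forall x, x \in U <-> Q x.
  by apply: (ext _ 0%VS) => [x|]; [rewrite memv0 => /eqP-> | exact: leqnn].
elim: m => [|m IHm] U sUQ le_m; last first.
  have [sQU|/not_all_ex_not[x nx]] := classic (forall x, Q x -> x \in U).
    by exists U => x; split; [exact: sUQ | exact: sQU].
  have [Qx /negP xU] := imply_to_and _ _ nx.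
  apply: (IHm (<[x]> + U)%VS) => [y /memv_addP[_ /vlineP[k ->] [u uU ->]]|].
    exact/QD/sUQ.
  suff: (\dim U < \dim (<[x]> + U))%N.
    by move=> lt_dim; rewrite -ltnS (leq_trans _ le_m) // ltn_sub2l //
       (leq_trans lt_dim) // dimvS // subvf.
  rewrite (ltn_leqif (dimv_leqif_sup (addvSr _ _))).
  by rewrite subv_add subvv andbT -memvE.
exists U => x; split; first exact: sUQ.
move=> _; suff /eqP->: (U == fullv) by rewrite memvf.
by rewrite -(geq_leqif (dimv_leqif_eq (subvf U))) -subn_eq0 -leqn0.
Qed.

(** Eigenvectors for distinct systems of eigenvalues are independent: applying
    [op t - val p t] to the relation removes the summand [p]. *)
Lemma eigen_sum_eq0 (L : eqType) (T : Type) (op : T -> 'End(V))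
    (val : L -> T -> K) (be : T -> K) (l : seq (L * V)) (x : V) :
  (forall p, p \in l -> forall t, op t p.2 = val p.1 t *: p.2) ->
  (forall t, op t x = be t *: x) ->
  x = \sum_(p <- l) p.2 ->
  (forall p, p \in l -> exists t, val p.1 t != be t) -> x = 0.
Proof.
have [k] := ubnP (size l); elim: k l x => // k IHk [|p l] x.
  by move=> _ _ _ ->; rewrite big_nil.
rewrite ltnS => sz_l wl wx def_x neq.
have [t nt] := neq p (mem_head _ _).
have wl' q : q \in l -> forall u, op u q.2 = val q.1 u *: q.2.
  by move=> ql; apply: wl; rewrite inE ql orbT.
suff /eqP: (be t - val p.1 t) *: x = 0.
  by rewrite scaler_eq0 subr_eq0 eq_sym (negPf nt) => /eqP.
apply: (IHk [seq (q.1, (val q.1 t - val p.1 t) *: q.2) | q <- l]).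
- by rewrite size_map.
- by move=> _ /mapP[q ql ->] u /=; rewrite linearZ /= wl' // !scalerA mulrC.
- by move=> u; rewrite linearZ /= wx !scalerA mulrC.
- rewrite big_map scalerBl -wx def_x big_cons linearD /= (wl p (mem_head _ _)).
  rewrite scalerDr opprD addrACA subrr add0r scaler_sumr linear_sum -sumrB /=.
  by rewrite !big_seq; apply: eq_bigr => q ql; rewrite wl' // scalerBl.
- by move=> _ /mapP[q ql ->]; apply: (neq q); rewrite inE ql orbT.
Qed.

End Subspaces.

(** The finite-dimensionality argument behind the representations of [sl2]: an
    endless string of nonzero vectors with distinct eigenvalues is impossible. *)
Lemma eigen_seq_vanishes (K : fieldType) (V : vectType K) (op : 'End(V))
    (y : nat -> V) (v : nat -> K) :
  injective v -> (forall i, op (y i) = v i *: y i) -> exists i, y i = 0.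
Proof.
move=> inj_v wy; apply: NNPP => ny.
have y_neq0 i : y i != 0 by apply/eqP => yi0; apply: ny; exists i.
have fr N : free (mkseq y N).
  elim: N => [|N IHN]; first by rewrite /= nil_free.
  rewrite mkseqS -cats1 (perm_free (Y := y N :: mkseq y N)); last first.
    by rewrite perm_catC.
  rewrite free_cons IHN andbT; apply/negP => yN.
  pose X := [tuple of mkseq y N].
  have {yN} yN : y N \in <<X>>%VS by [].
  move/eqP: (y_neq0 N); apply.
  apply: (@eigen_sum_eq0 _ _ nat unit (fun=> op) (fun i _ => v i)
    (fun=> v N) [seq (val i, coord X i (y N) *: y i) | i <- index_enum 'I_N]).
  - by move=> _ /mapP[i _ ->] _ /=; rewrite linearZ /= wy !scalerA mulrC.
  - by [].
  - rewrite big_map {1}(coord_span yN); apply: eq_bigr => i _ /=.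
    by rewrite nth_mkseq.
  - move=> _ /mapP[i _ ->]; exists tt; apply/eqP => /inj_v /= eqi.
    by have := ltn_ord i; rewrite eqi ltnn.
have := dimvS (subvf <<mkseq y (\dim {:V}).+1>>).
by have /eqP-> := fr (\dim {:V}).+1; rewrite size_mkseq ltnn.
Qed.

(** * Representations of sl2 inside a Lie algebra *)

Section Lie.
Variables (K : fieldType) (g : lie_alg K).
Implicit Types x y z : g.

HB.instance Definition _ x :=
  GRing.isLinear.Build K g g *:%R (lie x) (@lie_linearr K g x).

Lemma lieDr x y z : lie x (y + z) = lie x y + lie x z.
Proof. exact: linearD. Qed.
Lemma lieZr x c y : lie x (c *: y) = c *: lie x y.
Proof. exact: linearZ. Qed.
Lemma lie0r x : lie x 0 = 0.
Proof. exact: linear0. Qed.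
Lemma lieNr x y : lie x (- y) = - lie x y.
Proof. exact: linearN. Qed.
Lemma lie_sumr x I (r : seq I) P (F : I -> g) :
  lie x (\sum_(i <- r | P i) F i) = \sum_(i <- r | P i) lie x (F i).
Proof. exact: linear_sum. Qed.

Lemma lieC x y : lie x y = - lie y x.
Proof.
have lDl u v w : lie (u + v) w = lie u w + lie v w.
  by rewrite -{1}(scale1r u) lie_linearl scale1r.
have := lie_alt (x + y); rewrite lDl !lieDr !lie_alt add0r addr0.
by move/eqP; rewrite addr_eq0 => /eqP.
Qed.

Lemma lieDl x y z : lie (x + y) z = lie x z + lie y z.
Proof. by rewrite lieC lieDr opprD -(lieC x) -(lieC y). Qed.
Lemma lieZl c x y : lie (c *: x) y = c *: lie x y.
Proof. by rewrite lieC lieZr -scalerN -lieC. Qed.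
Lemma lie0l x : lie 0 x = 0.
Proof. by rewrite lieC lie0r oppr0. Qed.
Lemma lieNl x y : lie (- x) y = - lie x y.
Proof. by rewrite lieC lieNr -lieC. Qed.
Lemma lie_suml x I (r : seq I) P (F : I -> g) :
  lie (\sum_(i <- r | P i) F i) x = \sum_(i <- r | P i) lie (F i) x.
Proof.
by rewrite lieC lie_sumr -sumrN; apply: eq_bigr => i _; rewrite -lieC.
Qed.

Lemma lie_lie x y z : lie x (lie y z) = lie (lie x y) z + lie y (lie x z).
Proof.
have /eqP := lie_jacobi x y z.
rewrite -addrA addr_eq0 => /eqP->.
by rewrite opprD -(lieC (lie x y) z) addrC (lieC z x) lieNr opprK.
Qed.

Definition ad x : 'End(g) := linfun (lie x).
Lemma adE x y : ad x y = lie x y.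
Proof. by rewrite lfunE. Qed.
End Lie.

Section SL2.
Variables (K : numFieldType) (g : lie_alg K) (E F H : g).
Hypotheses (HF : lie H F = - 2 *: F)
  (EF : lie E F = H).

Lemma lowering_eigen m y i : lie H y = m *: y ->
  lie H (iter i (lie F) y) = (m - 2 * i%:R) *: iter i (lie F) y.
Proof.
move=> wy; elim: i => [|i IHi]; first by rewrite mulr0 subr0.
rewrite iterS lie_lie HF lieZl IHi lieZr -scalerDl; congr (_ *: _).
by rewrite -natr1; ring.
Qed.

(** Since [E (F^(i+1) y)] is [(i+1)(m-i)] times [F^i y], the first [i] with
    [F^(i+1) y = 0] must be [m]. *)
Lemma highest_weight_string m y : y != 0 -> lie E y = 0 -> lie H y = m *: y ->
  exists2 N, m = N%:R & forall i, (i <= N)%N -> iter i (lie F) y != 0.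
Proof.
move=> y0 Ey wy.
have EFi i : lie E (iter i.+1 (lie F) y) =
    (i.+1%:R * (m - i%:R)) *: iter i (lie F) y.
  elim: i => [|i IHi].
    by rewrite /= lie_lie EF wy Ey lie0r addr0 mul1r subr0.
  rewrite iterS lie_lie EF IHi lieZr -iterS (lowering_eigen _ wy) -scalerDl.
  by congr (_ *: _); rewrite -!natr1; ring.
have [|i Fi0] := @eigen_seq_vanishes _ _ (ad H) (fun i => iter i (lie F) y)
  (fun i => m - 2 * i%:R) _ (fun i => etrans (adE _ _) (lowering_eigen i wy)).
  move=> i j /addrI /oppr_inj /mulfI; rewrite pnatr_eq0 => /(_ isT) /eqP.
  by rewrite eqr_nat => /eqP.
have {i Fi0} [[|N] FN0 minN] := @ex_minnP (fun i => iter i (lie F) y == 0)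
  (ex_intro _ i (introT eqP Fi0)); first by rewrite (negPf y0) in FN0.
have nz i : (i <= N)%N -> iter i (lie F) y != 0.
  by move=> le_iN; apply/negP => /minN; rewrite leqNgt ltnS le_iN.
exists N => //; have := EFi N; rewrite (eqP FN0) lie0r => /esym/eqP.
rewrite scaler_eq0 (negPf (nz N _)) // orbF mulf_eq0 pnatr_eq0 /=.
by rewrite subr_eq0 => /eqP.
Qed.

End SL2.

Section SL2Weights.
Variables (K : numFieldType) (g : lie_alg K).

(* Raising [x] to a highest weight vector [E^n x] of weight [N = k + 2n] and
   lowering that one by [n + k <= N] steps lands in degree [-k]. *)
Let reflect_up (E F H : g) (P : int -> g -> Prop) (k : K) (x : g) :
  lie H E = 2 *: E -> lie H F = - 2 *: F -> lie E F = H ->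
  (forall j y, P j y -> P (j + 1) (lie E y)) ->
  (forall j y, P j y -> P (j - 1) (lie F y)) ->
  (forall j y, P j y -> lie H y = (k + 2 * j%:~R) *: y) ->
  x != 0 -> P 0 x ->
  exists2 m : int, k = m%:~R &
    (0 <= m -> exists2 z, z != 0 & P (- m) z).
Proof.
move=> HE HF EF PE PF PH x0 Px.
have PEi i : P i%:Z (iter i (lie E) x).
  by elim: i => // i /PE; have -> : i%:Z + 1 = i.+1 by lia.
have PFi i j y : P j y -> P (j - i%:Z) (iter i (lie F) y).
  move=> Py; elim: i => [|i /PF]; first by rewrite subr0.
  by have -> : j - i%:Z - 1 = j - i.+1%:Z by lia.
have [|i Ei0] := @eigen_seq_vanishes _ _ (ad H) (fun i => iter i (lie E) x)
  (fun i => k + 2 * i%:R) _ (fun i => etrans (adE _ _) (PH _ _ (PEi i))).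
  move=> i j /addrI /mulfI; rewrite pnatr_eq0 => /(_ isT) /eqP.
  by rewrite eqr_nat => /eqP.
have {i Ei0} [[|n] En0 minn] := @ex_minnP (fun i => iter i (lie E) x == 0)
  (ex_intro _ i (introT eqP Ei0)); first by rewrite (negPf x0) in En0.
have nz : iter n (lie E) x != 0 by apply/negP => /minn; rewrite ltnn.
have [N defk nzF] := highest_weight_string HF EF nz (eqP En0) (PH _ _ (PEi n)).
exists (N%:Z - 2 * n%:Z).
  by rewrite rmorphB rmorphM /= -pmulrn -defk -pmulrn addrK.
move=> m_ge0; exists (iter (N - n) (lie F) (iter n (lie E) x)).
  by apply: nzF; rewrite leq_subr.
have -> : - (N%:Z - 2 * n%:Z) = n%:Z - (N - n)%N%:Z by lia.
exact/PFi/PEi.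
Qed.

(** The weights of a finite-dimensional module over the span of [E, H, F] are
    integers, symmetric about 0; [P j] stands for a set of vectors, of weight
    [k + 2 j], through which extra grading information can be carried along. *)
Lemma sl2_weight_reflect (E F H : g) (P : int -> g -> Prop) (k : K) (x : g) :
  lie H E = 2 *: E -> lie H F = - 2 *: F -> lie E F = H ->
  (forall j y, P j y -> P (j + 1) (lie E y)) ->
  (forall j y, P j y -> P (j - 1) (lie F y)) ->
  (forall j y, P j y -> lie H y = (k + 2 * j%:~R) *: y) ->
  x != 0 -> P 0 x ->
  exists2 m : int, k = m%:~R & exists2 z, z != 0 & P (- m) z.
Proof.
move=> HE HF EF PE PF PH x0 Px.
have [m km up] := reflect_up HE HF EF PE PF PH x0 Px.
exists m => //; have [/up//|m_lt0] := lerP 0 m.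
have [||||||||m' km' up'] := @reflect_up F E (- H) (fun j => P (- j)) (- k) x.
- by rewrite lieNl HF scaleNr opprK.
- by rewrite lieNl HE scaleNr.
- by rewrite lieC EF.
- by move=> j y /PF; rewrite opprD.
- by move=> j y /PE; rewrite opprB addrC.
- by move=> j y /PH; rewrite lieNl => ->; rewrite -scaleNr rmorphN; congr (_ *: _); ring.
- by [].
- by rewrite oppr0.
- have eq_m : m' = - m.
    have: (m%:~R : K) = (- m')%:~R by rewrite rmorphN /= -km' opprK.
    by move/eqP; rewrite eqr_int => /eqP; lia.
  have [|z z0] := up'; first by lia.
  by rewrite eq_m opprK; exists z.
Qed.

End SL2Weights.

(** * Roots of a Cartan datum and simple reflections *)

Lemma linfun_linear (K : fieldType) (U V : vectType K) (f : U -> V) x :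
  linear f -> linfun f x = f x.
Proof.
move=> lin_f; pose m := GRing.isLinear.Build K U V *:%R f lin_f.
pose fL : {linear U -> V} := HB.pack f m.
exact: (lfunE fL).
Qed.

Section Datum.
Variables (K : numFieldType) (g : lie_alg K).

Lemma evD (U : {vspace g}) (mu nu : dual U) x :
  ev (mu + nu) x = ev mu x + ev nu x.
Proof. by rewrite /ev lfunE. Qed.
Lemma evN (U : {vspace g}) (mu : dual U) x : ev (- mu) x = - ev mu x.
Proof. by rewrite /ev lfunE. Qed.
Lemma evZ (U : {vspace g}) c (mu : dual U) x : ev (c *: mu) x = c * ev mu x.
Proof. by rewrite /ev lfunE. Qed.
Lemma ev0 (U : {vspace g}) x : ev (0 : dual U) x = 0.
Proof. by rewrite /ev lfunE. Qed.
Lemma ev_sum (U : {vspace g}) I (r : seq I) P (F : I -> dual U) x :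
  ev (\sum_(i <- r | P i) F i) x = \sum_(i <- r | P i) ev (F i) x.
Proof. by rewrite /ev sum_lfunE. Qed.
Lemma evxD (U : {vspace g}) (mu : dual U) x y :
  ev mu (x + y) = ev mu x + ev mu y.
Proof. by rewrite /ev !linearD. Qed.
Lemma evxZ (U : {vspace g}) (mu : dual U) c x : ev mu (c *: x) = c * ev mu x.
Proof. by rewrite /ev !linearZ. Qed.
Lemma evxN (U : {vspace g}) (mu : dual U) x : ev mu (- x) = - ev mu x.
Proof. by rewrite /ev !linearN. Qed.
Lemma evx_sum (U : {vspace g}) (mu : dual U) I (r : seq I) P (F : I -> g) :
  ev mu (\sum_(i <- r | P i) F i) = \sum_(i <- r | P i) ev mu (F i).
Proof. by rewrite /ev !linear_sum. Qed.

Lemma evP (U : {vspace g}) (mu nu : dual U) :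
  (forall x, x \in U -> ev mu x = ev nu x) -> mu = nu.
Proof.
move=> eq_mn; apply/lfunP => x.
by have := eq_mn _ (subvsP x); rewrite /ev vsvalK.
Qed.

Variable D : cartan_datum g.

Lemma simple_reflE i (mu : weight D) :
  simple_refl i mu = mu - ev mu (cd_coroot i) *: cd_root i.
Proof.
rewrite linfun_linear // => c u v.
by rewrite evD evZ scalerDl scalerBr scalerA opprD addrACA.
Qed.

(** What the reflections of a Cartan datum need in order to permute its roots:
    each simple root and its coroot sit in an [sl2]-triple. It holds for [g] and
    for [g(0)]. *)
Record sl2_datum : Prop := SL2Datum {
  sd_lie : forall x y, x \in cd_alg D -> y \in cd_alg D -> lie x y \in cd_alg D;
  sd_coroot : forall i : cd_index D, cd_coroot i \in cd_cartan D;
  sd_two : forall i : cd_index D, ev (cd_root i) (cd_coroot i) = 2;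
  sd_triple : forall i : cd_index D, exists E F,
    [/\ E \in cd_alg D, F \in cd_alg D, E != 0, lie E F = cd_coroot i &
     forall h, h \in cd_cartan D -> lie h E = ev (cd_root i) h *: E /\
      lie h F = - ev (cd_root i) h *: F]
}.

Hypothesis sdD : sl2_datum.

Lemma simple_reflK i : involutive (@simple_refl K g D i).
Proof.
move=> mu; rewrite !simple_reflE evD evN evZ sd_two // mulr_natr mulr2n.
by rewrite opprD addNKr scaleNr opprK subrK.
Qed.

Lemma is_root_simple i : is_root (cd_root i : weight D).
Proof.
split.
  apply/eqP => r0; have := sd_two sdD i.
  by rewrite r0 ev0 => /eqP; rewrite eq_sym pnatr_eq0.
have [E [F [Eg _ E0 _ wE]]] := sd_triple sdD i.
by exists E => //; split=> // h /wE[].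
Qed.

(** The [sl2]-triple of the simple root [i] moves a root vector of weight [b] to
    one whose weight is the image of [b] under the reflection. *)
Lemma is_root_refl i (b : weight D) : is_root b -> is_root (simple_refl i b).
Proof.
case=> b0 [x xg [x0 wx]].
have [E [F [Eg Fg E0 EF wEF]]] := sd_triple sdD i.
have [wHE wHF] := wEF _ (sd_coroot sdD i).
pose P j (y : g) := y \in cd_alg D /\ forall h, h \in cd_cartan D ->
  lie h y = (ev b h + j%:~R * ev (cd_root i) h) *: y.
have [||||||||m evm [z z0 [zg wz]]] :=
  @sl2_weight_reflect _ _ E F (cd_coroot i) P (ev b (cd_coroot i)) x.
- by rewrite wHE sd_two.
- by rewrite wHF sd_two.
- by [].
- move=> j y [yg wy]; split=> [|h hh]; first exact: sd_lie.
  have [wE _] := wEF h hh.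
  rewrite lie_lie wE (wy h hh) lieZl lieZr -scalerDl rmorphD; congr (_ *: _) => /=.
  by ring.
- move=> j y [yg wy]; split=> [|h hh]; first exact: sd_lie.
  have [_ wF] := wEF h hh.
  rewrite lie_lie wF (wy h hh) lieZl lieZr -scalerDl rmorphB; congr (_ *: _) => /=.
  by ring.
- by move=> j y [_ ->]; rewrite ?sd_coroot ?sd_two // mulrC.
- by [].
- by split=> // h hh; rewrite wx // mul0r addr0.
split.
  apply: contraNneq b0 => sb0.
  by rewrite -(simple_reflK i b) sb0 linear0.
exists z => //; split=> // h hh; rewrite wz // simple_reflE evD evN evZ evm.
by rewrite rmorphN mulNr.
Qed.

Lemma is_coroot_simple i : is_coroot (cd_root i : weight D) (cd_coroot i).
Proof.
split; [exact: sd_coroot | exact: sd_two | move=> c rc].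
by rewrite -simple_reflE; apply: is_root_refl.
Qed.

Lemma positive_root_simple i : positive_root (cd_root i : weight D).
Proof.
split; first exact: is_root_simple.
exists (fun j => j == i); rewrite (bigD1 i) //= eqxx big1 ?addr0 // => j.
by move/negPf->.
Qed.

End Datum.

(** * Triangular decomposition *)

Lemma span_mktuple (K : fieldType) (V : vectType K) n (F : 'I_n -> V) x :
  x \in <<[tuple F i | i < n]>>%VS -> exists c, x = \sum_i c i *: F i.
Proof.
move=> /coord_span ->; exists (coord [tuple F i | i < n] ^~ x).
by apply: eq_bigr => i _; rewrite -tnth_nth tnth_mktuple.
Qed.

Section Generated.
Variables (K : fieldType) (n : nat) (g : lie_alg K).
Variables (a : 'I_n -> 'I_n -> K) (h e f : 'I_n -> g) (eta : K).
Hypotheses (he : forall i j, lie (h i) (e j) = a i j *: e j)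
  (fe : forall i j, lie (f i) (e j) = if i == j then eta *: h i else 0).
Let hspan := <<[tuple h i | i < n]>>%VS.

(** The span of the iterated brackets of the [e i]. It will be used with the
    [e i] and the [f i] of a Chevalley basis, in both roles. *)
Inductive generated : g -> Prop :=
| gen_base i : generated (e i)
| gen_lie i x : generated x -> generated (lie (e i) x)
| gen_zero : generated 0
| gen_lin k x y : generated x -> generated y -> generated (k *: x + y).

Lemma generatedZ k x : generated x -> generated (k *: x).
Proof. by move=> gx; rewrite -[_ *: _]addr0; apply: gen_lin => //; apply: gen_zero. Qed.

Lemma generatedD x y : generated x -> generated y -> generated (x + y).
Proof. by move=> gx gy; rewrite -[x]scale1r; apply: gen_lin. Qed.

Lemma generated_h i x : generated x -> generated (lie (h i) x).
Proof.
elim=> [j|j {}x gx IH||k {}x y _ IHx _ IHy].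
- by rewrite he; apply/generatedZ/gen_base.
- by rewrite lie_lie he lieZl; apply/generatedD/gen_lie => //; apply/generatedZ/gen_lie.
- by rewrite lie0r; apply: gen_zero.
- by rewrite lieDr lieZr; apply: gen_lin.
Qed.

Lemma h_in_hspan i : h i \in hspan.
Proof. by apply: memv_span; apply/mapP; exists i; rewrite ?mem_enum. Qed.

Lemma hspan_e i t : t \in hspan -> generated (lie (e i) t).
Proof.
move=> /span_mktuple[c ->]; rewrite lie_sumr.
elim/big_rec: _ => [|j y _ gy]; first exact: gen_zero.
by rewrite lieZr lieC he; apply: gen_lin => //; rewrite -scaleNr; apply/generatedZ/gen_base.
Qed.

(** Bracketing with [f i] undoes one [e], up to the Cartan subalgebra. *)
Lemma generated_f i x : generated x ->
  exists t y, [/\ t \in hspan, generated y & lie (f i) x = t + y].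
Proof.
elim=> [j|j {}x gx [t [y [ht gy fx]]]||k {}x y _ [t [z [ht gz fx]]] _ [u [v [hu gv fy]]]].
- exists (lie (f i) (e j)), 0; split; [|exact: gen_zero|by rewrite addr0].
  by rewrite fe; case: eqP => _; rewrite ?mem0v // memvZ // h_in_hspan.
- exists 0, (lie (f i) (lie (e j) x)); split; rewrite ?mem0v ?add0r //.
  rewrite lie_lie fx lieDr; apply: generatedD.
    rewrite fe; case: eqP => _; last by rewrite lie0l; apply: gen_zero.
    by rewrite lieZl; apply/generatedZ/generated_h.
  by apply: generatedD; [apply: hspan_e | apply: gen_lie].
- by exists 0, 0; rewrite mem0v lie0r addr0; split=> //; apply: gen_zero.
- exists (k *: t + u), (k *: z + v); split; last 1 first.
  + by rewrite lieDr lieZr fx fy scalerDr addrACA.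
  + by rewrite memvD ?memvZ.
  + exact: gen_lin.
Qed.

Lemma generated_weights x : generated x ->
  exists2 l : seq ({ffun 'I_n -> nat} * g),
    (forall p, p \in l -> forall i, lie (h i) p.2 = (\sum_j a i j *+ p.1 j) *: p.2)
  & x = \sum_(p <- l) p.2.
Proof.
elim=> [j|j {}x _ [l wl ->]||k {}x y _ [l1 wl1 ->] _ [l2 wl2 ->]].
- exists [:: ([ffun i => (i == j) : nat], e j)]; last by rewrite big_seq1.
  move=> _ /[1!inE] /eqP-> i /=; rewrite he (bigD1 j) //= ffunE eqxx.
  rewrite big1 ?addr0 // => k nkj; by rewrite ffunE (negPf nkj).
- exists [seq ([ffun i => (i == j) + p.1 i]%N, lie (e j) p.2) |
      p : {ffun 'I_n -> nat} * g <- l].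
    move=> _ /mapP[p pl ->] i /=; rewrite lie_lie he lieZl wl // lieZr -scalerDl.
    congr (_ *: _); under [in RHS]eq_bigr do rewrite ffunE mulrnDr.
    rewrite big_split /=; congr (_ + _); rewrite (bigD1 j) //= eqxx.
    by rewrite big1 ?addr0 // => k /negPf->.
  by rewrite big_map lie_sumr.
- by exists [::]; rewrite ?big_nil.
- exists ([seq (p.1, k *: p.2) | p <- l1] ++ l2).
    move=> p; rewrite mem_cat => /orP[/mapP[q ql ->]|]; last exact: wl2.
    by move=> i /=; rewrite lieZr wl1 // !scalerA mulrC.
  by rewrite big_cat big_map scaler_sumr.
Qed.

End Generated.

Section Triangular.
Variables (K : numFieldType) (n : nat) (a : 'I_n -> 'I_n -> int).
Variables (g : lie_alg K) (S : chevalley a g).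

Let gen_e := generated (ce S).
Let gen_f := generated (cf S).
Let aK i j : K := (a i j)%:~R.

Let he i j : lie (ch S i) (ce S j) = aK i j *: ce S j.
Proof. exact: ch_ce. Qed.
Let hf i j : lie (ch S i) (cf S j) = - aK i j *: cf S j.
Proof. by rewrite scaleNr; apply: ch_cf. Qed.
Let fe i j : lie (cf S i) (ce S j) = if i == j then -1 *: ch S i else 0.
Proof.
rewrite lieC ce_cf eq_sym; case: eqP => [->|_]; last exact: oppr0.
by rewrite scaleN1r.
Qed.
Let ef i j : lie (ce S i) (cf S j) = if i == j then 1 *: ch S i else 0.
Proof. by rewrite ce_cf scale1r. Qed.

(** The sum of the Cartan subalgebra and of the subspaces generated by the
    [e_i] and by the [f_i] is stable under [ad e_i] and [ad f_i]; since these
    generate the algebra and a normaliser is a subalgebra, that sum is an ideal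
    containing the generators, hence everything. *)
Lemma triangular_decomposition x :
  exists t y z, [/\ t \in cartan S, gen_e y, gen_f z & x = t + y + z].
Proof.
pose Q x := exists t y z, [/\ t \in cartan S, gen_e y, gen_f z & x = t + y + z].
have [||U UP] := @vspace_of_subspace _ _ Q.
- by exists 0, 0, 0; rewrite mem0v !addr0; split=> //; apply: gen_zero.
- move=> k _ _ [t [y [z [ht gy gz ->]]]] [t' [y' [z' [ht' gy' gz' ->]]]].
  exists (k *: t + t'), (k *: y + y'), (k *: z + z'); split.
  + by rewrite memvD ?memvZ.
  + exact: gen_lin.
  + exact: gen_lin.
  + by rewrite !scalerDr addrACA; congr (_ + _); rewrite addrACA.
pose N x := forall u, u \in U -> lie x u \in U.
have [||NU NUP] := @vspace_of_subspace _ _ N.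
- by move=> u _; rewrite lie0l mem0v.
- by move=> k u v Nu Nv w wU; rewrite lieDl lieZl memvD ?memvZ ?Nu ?Nv.
have Ut t : t \in cartan S -> t \in U.
  by move=> ht; apply/UP; exists t, 0, 0; rewrite !addr0; split=> //; apply: gen_zero.
have Ue y : gen_e y -> y \in U.
  by move=> gy; apply/UP; exists 0, y, 0; rewrite mem0v add0r addr0; split=> //; apply: gen_zero.
have Uf z : gen_f z -> z \in U.
  by move=> gz; apply/UP; exists 0, 0, z; rewrite mem0v !add0r; split=> //; apply: gen_zero.
have Nfull : NU = fullv.
  apply: (@chevalley_gen _ _ _ _ S) => [i|u v /NUP Nu /NUP Nv]; last first.
    apply/NUP => w wU; rewrite -[lie _ _](addrK (lie v (lie u w))) -lie_lie.
    by rewrite memvB ?Nu ?Nv ?Nu ?Nv.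
  split; apply/NUP => _ /UP[t [y [z [ht gy gz ->]]]]; rewrite !lieDr.
    have [t' [z' [ht' gz' ->]]] := generated_f hf ef i gz.
    apply: memvD; last by rewrite memvD ?(Ut _ ht') ?(Uf _ gz').
    by apply: memvD; apply: Ue; [exact: (hspan_e he i ht) | exact: gen_lie].
  have [t' [y' [ht' gy' ->]]] := generated_f he fe i gy.
  apply: memvD; last by apply/Uf/gen_lie.
  by apply: memvD; [exact: Uf (hspan_e hf i ht) | rewrite memvD ?(Ut _ ht') ?(Ue _ gy')].
apply/UP; suff -> : U = fullv by apply: memvf.
apply: (@chevalley_gen _ _ _ _ S) => [i|u v uU vU].
  by split; [apply/Ue/gen_base | apply/Uf/gen_base].
by have /NUP: u \in NU by [rewrite Nfull memvf]; apply.
Qed.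

Definition has_weight (c : 'I_n -> int) (x : g) :=
  forall i, lie (ch S i) x = (\sum_j a i j * c j)%:~R *: x.

(** An iterated bracket of the [e_i] is a weight vector, whose weight counts the
    factors; for the [f_i] the signs are reversed. *)
Lemma sum_of_signed_weights x :
  exists2 l : seq ({ffun 'I_n -> int} * g),
    forall p, p \in l -> has_weight p.1 p.2 /\
      ((forall j, 0 <= p.1 j) \/ (forall j, p.1 j <= 0))
  & x = \sum_(p <- l) p.2.
Proof.
have [t [y [z [ht gy gz ->]]]] := triangular_decomposition x.
have [ly wy ->] := generated_weights he gy.
have [lz wz ->] := generated_weights hf gz.
exists ((([ffun=> 0], t) :: [seq ([ffun j => (p.1 j)%:Z], p.2) |
      p : {ffun 'I_n -> nat} * g <- ly])
  ++ [seq ([ffun j => - (p.1 j)%:Z], p.2) |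
      p : {ffun 'I_n -> nat} * g <- lz]); last first.
  by rewrite big_cat big_cons !big_map.
move=> p; rewrite mem_cat inE => /orP[/orP[/eqP->|/mapP[q ql ->]]|/mapP[q ql ->]] /=.
- split; last by left=> j; rewrite ffunE.
  move=> i /=; rewrite big1 => [|j _]; last by rewrite ffunE mulr0.
  have /span_mktuple[c ->] := ht.
  rewrite lie_sumr scale0r big1 // => j _; by rewrite lieZr ch_ch scaler0.
- split; last by left=> j; rewrite ffunE.
  move=> i /=; rewrite wy // rmorph_sum; congr (_ *: _).
  by apply: eq_bigr => j _; rewrite ffunE rmorphM /= mulr_natr.
- split; last by right=> j; rewrite ffunE oppr_le0.
  move=> i /=; rewrite wz // rmorph_sum; congr (_ *: _).
  by apply: eq_bigr => j _; rewrite ffunE mulrN rmorphN rmorphM /= mulr_natr mulNrn.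
Qed.

End Triangular.

(** * Cartan matrices of types A, D and E6 *)

(** The properties of a simply laced Cartan matrix of finite type on which the
    rest relies. The form is evaluated on rational vectors because averages over
    orbits will be inserted. *)
Record cartan_like n (a : 'I_n -> 'I_n -> int) : Prop := CartanLike {
  cl_sym : forall i j, a i j = a j i;
  cl_diag : forall i, a i i = 2;
  cl_off : forall i j, i != j -> a i j = 0 \/ a i j = -1;
  cl_pos : forall y : 'I_n -> rat, (exists i, y i != 0) ->
    0 < \sum_i \sum_j (a i j)%:~R * (y i * y j)
}.

(** Vinberg's criterion: with [z i = y i / c i], the form is the sum of
    [- a i j * c i * c j * (z i - z j) ^+ 2] over the pairs [i, j] and of
    [(\sum_j a i j * c j) * c i * z i ^+ 2] over [i], all nonnegative. *)
Lemma positive_definite_criterion n (a : 'I_n -> 'I_n -> int) (c : 'I_n -> int) :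
  (forall i j, a i j = a j i) -> (forall i j, i != j -> a i j <= 0) ->
  (forall i, 0 < c i) -> (forall i, 0 < \sum_j a i j * c j) ->
  forall y : 'I_n -> rat, (exists i, y i != 0) ->
    0 < \sum_i \sum_j (a i j)%:~R * (y i * y j).
Proof.
move=> asym aoff c0 ac y [i0 yi0].
pose C i : rat := (c i)%:~R; pose z i := y i / C i.
pose T i j := (a i j)%:~R * (C i * C j).
have C0 i : 0 < C i by rewrite ltr0z.
have yz i : y i = C i * z i by rewrite mulrC divfK // gt_eqF.
have Tsym i j : T i j = T j i by rewrite /T asym [C i * _]mulrC.
have QS : 2 * \sum_i \sum_j T i j * (z i * z j) =
    2 * (\sum_i \sum_j T i j * z i ^+ 2) +
    \sum_i \sum_j - T i j * (z i - z j) ^+ 2.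
  rewrite [in RHS]mulr_natl mulr2n.
  rewrite [X in _ = _ + X + _](_ : _ = \sum_i \sum_j T i j * z j ^+ 2); last first.
    rewrite exchange_big; apply: eq_bigr => i _; apply: eq_bigr => j _.
    by rewrite Tsym.
  rewrite mulr_sumr -!big_split /=; apply: eq_bigr => i _.
  rewrite mulr_sumr -!big_split /=; apply: eq_bigr => j _.
  by ring.
have -> : \sum_i \sum_j (a i j)%:~R * (y i * y j) = \sum_i \sum_j T i j * (z i * z j).
  by apply: eq_bigr => i _; apply: eq_bigr => j _; rewrite !yz /T; ring.
suff: 0 < 2 * \sum_i \sum_j T i j * (z i * z j) by rewrite pmulr_rgt0.
rewrite QS ltr_wpDr //.
  apply: sumr_ge0 => i _; apply: sumr_ge0 => j _; rewrite mulNr oppr_ge0.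
  have [->|nij] := eqVneq i j; first by rewrite subrr expr0n mulr0.
  rewrite mulr_le0_ge0 ?sqr_ge0 // mulr_le0_ge0 ?lerz0 ?aoff //.
  by rewrite mulr_ge0 // ltW.
have row i : \sum_j T i j * z i ^+ 2 = (\sum_j a i j * c j)%:~R * C i * z i ^+ 2.
  rewrite -mulr_suml rmorph_sum /= !mulr_suml; apply: eq_bigr => j _.
  by rewrite rmorphM /= /T -/(C j); ring.
rewrite pmulr_rgt0 // (bigD1 i0) //= row ltr_pwDl //.
  rewrite mulr_gt0 //; first by rewrite mulr_gt0 ?ltr0z ?ac.
  by rewrite exprn_even_gt0 //= mulf_neq0 // invr_eq0 gt_eqF.
apply: sumr_ge0 => i _; rewrite row mulr_ge0 ?sqr_ge0 //.
by rewrite mulr_ge0 ?ltW // ltr0z ac.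
Qed.

Lemma sum_delta n k (c : nat -> int) :
  \sum_(j < n) (nat_of_ord j == k)%:R * c j = (k < n)%N%:R * c k.
Proof.
have [lt_kn|le_nk] := ltnP k n.
  rewrite (bigD1 (Ordinal lt_kn)) //= eqxx big1 ?addr0 // => j.
  by rewrite -val_eqE /= => /negPf->; rewrite mul0r.
rewrite mul0r big1 // => j _; case: eqP => [jk|_]; last by rewrite mul0r.
by have := ltn_ord j; rewrite jk ltnNge le_nk.
Qed.

(** The coordinates of a multiple of the sum of the positive roots in the basis
    of simple roots; it pairs positively with every simple coroot. *)
Definition two_rho (t : dynkin) (i : nat) : int :=
  match t with
  | TypeA n => i.+1%:Z * (n%:Z - i%:Z)
  | TypeD n => if (i < n.-2)%N then 2 * (i.+1%:Z * (2 * n%:Z - i%:Z - 2))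
               else n%:Z * (n%:Z - 1)
  | TypeE6 => nth 0 [:: 16; 22; 30; 42; 30; 16] i
  end.

Lemma two_rho_gt0 t : dynkin_valid t ->
  forall i : 'I_(rank t), 0 < two_rho t i.
Proof.
case: t => [n|n|] /= valid i.
- have := ltn_ord i; move: (nat_of_ord i) => k /= ltk.
  by rewrite mulr_gt0 //; lia.
- have := ltn_ord i; move: (nat_of_ord i) => k /= ltk; case: ifP => lt2.
    by rewrite mulr_gt0 // mulr_gt0 //; lia.
  by rewrite mulr_gt0 //; lia.
- by case: i => [[|[|[|[|[|[|i]]]]]]].
Qed.


Lemma cartan_mxA n (i j : 'I_n) : @cartan_mx (TypeA n) i j =
  2 * (j == i :> nat)%:R - (j == i.+1 :> nat)%:R
  - (0 < i)%N%:R * (j == i.-1 :> nat)%:R.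
Proof.
rewrite /cartan_mx -val_eqE /=; case: i j => [i lti] [j ltj] /=.
case: (i =P j) => ?; case: (j =P i) => ?; case: (j =P i.+1) => ?;
case: (i =P j.+1) => ?; case: (j =P i.-1) => ?; case: (ltnP 0 i) => ? /=; lia.
Qed.

Lemma cartan_mxD n (i j : 'I_n) : (3 < n)%N -> @cartan_mx (TypeD n) i j =
  2 * (j == i :> nat)%:R - (i.+1 < n.-1)%N%:R * (j == i.+1 :> nat)%:R
  - ((0 < i) && (i < n.-1))%N%:R * (j == i.-1 :> nat)%:R
  - (i == (n - 3)%N :> nat)%:R * (j == n.-1 :> nat)%:R
  - (i == n.-1 :> nat)%:R * (j == (n - 3)%N :> nat)%:R.
Proof.
move=> n_gt3; rewrite /cartan_mx -val_eqE /=; case: i j => [i lti] [j ltj] /=.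
have [<-|nij] := eqVneq i j.
  rewrite /=; case: (i =P i.-1) => ?; case: (ltnP 0 i) => ? /=;
    try (by exfalso; lia);
  case: (i =P n.-1) => ?; case: (i =P (n - 3)%N) => ? /=; lia.
have [->|nj] := eqVneq j i.+1.
  have -> : (i == i.+2) = false by lia.
  have -> : (i.+1 == i.-1) = false by lia.
  have -> : (i.+1 == n - 3)%N && (i == n.-1) = false by lia.
  case: (i =P (n - 3)%N) => ?; case: (i =P n.-1) => ?;
    try (by exfalso; lia);
  case: (i.+1 =P n.-1) => ?; case: (ltnP i.+1 n.-1) => ? /=; lia.
rewrite /=; have [->|ni] := eqVneq i j.+1.
  rewrite /= eqxx; have -> : (j.+1 == n - 3)%N && (j == n.-1) = false by lia.
  case: (j =P (n - 3)%N) => ?; case: (j =P n.-1) => ?;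
    try (by exfalso; lia);
  case: (j.+1 =P n.-1) => ?; case: (ltnP j.+1 n.-1) => ? /=; lia.
case: (ltnP 0 i) => ? /=; case: (j =P i.-1) => ? /=; try (by exfalso; lia);
case: (i =P (n - 3)%N) => ?; case: (j =P n.-1) => ? /=;
case: (i =P n.-1) => ?; case: (j =P (n - 3)%N) => ? /=; lia.
Qed.

Lemma two_rho_row t : dynkin_valid t ->
  forall i : 'I_(rank t), 0 < \sum_j cartan_mx i j * two_rho t j.
Proof.
case: t => [n|n|] valid i.
- under eq_bigr do rewrite cartan_mxA 2!mulrBl -!mulrA.
  rewrite !sumrB -!mulr_sumr !sum_delta /=.
  case: i => [[|i] lti] /=; move: lti => /= lti;
    do ![case: ltnP => ? /=]; nia.
- under eq_bigr do rewrite cartan_mxD // 4!mulrBl -!mulrA.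
  rewrite !sumrB -!mulr_sumr !sum_delta /=.
  case: i => [[|i] lti] /=; move: valid lti => /= valid lti;
    do ![case: ltnP => ? /=; try (by exfalso; lia)];
    do ![case: eqP => ? /=; try (by exfalso; lia)]; nia.
- by case: i => [[|[|[|[|[|[|i]]]]]]] // lti; rewrite !big_ord_recl big_ord0.
Qed.

Lemma cartan_mx_like t : dynkin_valid t -> cartan_like (@cartan_mx t).
Proof.
move=> valid.
have sym (i j : 'I_(rank t)) : cartan_mx i j = cartan_mx j i.
  by rewrite /cartan_mx eq_sym orbC.
have off (i j : 'I_(rank t)) : i != j -> cartan_mx i j = 0 \/ cartan_mx i j = -1.
  by rewrite /cartan_mx => /negPf->; case: ifP; [right | left].
split=> // [i|]; first by rewrite /cartan_mx eqxx.
apply: (positive_definite_criterion (c := two_rho t)) => //.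
- by move=> i j /off[] ->.
- exact: two_rho_gt0.
- exact: two_rho_row.
Qed.

Section CartanLike.
Variables (n : nat) (a : 'I_n -> 'I_n -> int).
Hypothesis ca : cartan_like a.

Lemma cl_pos_int (e : 'I_n -> int) : (exists i, e i != 0) ->
  0 < \sum_i \sum_j a i j * (e i * e j).
Proof.
case=> i ei0.
have := cl_pos ca (y := fun i => (e i)%:~R) (ex_intro _ i _).
rewrite intr_eq0 => /(_ ei0).
rewrite (_ : \sum_i _ = (\sum_i \sum_j a i j * (e i * e j))%:~R) ?ltr0z //.
rewrite rmorph_sum /=; apply: eq_bigr => k _; rewrite rmorph_sum /=.
by apply: eq_bigr => j _; rewrite !rmorphM.
Qed.

(** The determinant is nonzero over the rationals, hence over any field of
    characteristic 0, although such a field need not be ordered. *)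
Lemma cl_nondegenerate (K : numFieldType) (y : 'I_n -> K) :
  (forall i, \sum_j (a i j)%:~R * y j = 0) -> forall j, y j = 0.
Proof.
move=> ay0.
pose A : 'M[rat]_n := \matrix_(i, j) (a i j)%:~R.
have detA : \det A != 0.
  apply/det0P => -[v v0 vA0]; have [i vi] : exists i, v 0 i != 0.
    by have /rV0Pn := v0.
  have := cl_pos ca (y := fun i => v 0 i) (ex_intro _ i vi).
  rewrite exchange_big big1 ?ltxx // => j _ /=.
  have /matrixP/(_ 0 j) := vA0; rewrite !mxE => vA0j.
  transitivity ((\sum_k v 0 k * A k j) * v 0 j); last by rewrite vA0j mul0r.
  rewrite mulr_suml; apply: eq_bigr => k _.
  by rewrite mxE; ring.
have unitA : map_mx (ratr : rat -> K) A \in unitmx.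
  by rewrite unitmxE det_map_mx unitfE fmorph_eq0.
have colK : map_mx (ratr : rat -> K) A *m (\col_j y j) = 0.
  apply/matrixP => i j; rewrite !mxE -[RHS](ay0 i).
  by apply: eq_bigr => k _; rewrite !mxE ratr_int.
move=> j; have /matrixP/(_ j 0) : \col_j y j = 0.
  by rewrite -[LHS](mulKmx unitA) colK mulmx0.
by rewrite !mxE.
Qed.

End CartanLike.


(** * The quadratic form of the Cartan matrix *)

Section Form.
Variables (n : nat) (a : 'I_n -> 'I_n -> int).
Hypothesis ca : cartan_like a.

Lemma form_shift (R : comPzRingType) (y v : 'I_n -> R) :
  \sum_i \sum_j (a i j)%:~R * ((y i + v i) * (y j + v j)) =
  \sum_i \sum_j (a i j)%:~R * (y i * y j)
  + 2 * (\sum_i v i * \sum_j (a i j)%:~R * y j)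
  + \sum_i \sum_j (a i j)%:~R * (v i * v j).
Proof.
rewrite mulr_natl mulr2n [X in _ + (X + _)](_ : _ =
    \sum_i \sum_j (a i j)%:~R * (y i * v j)); last first.
  rewrite exchange_big; apply: eq_bigr => i _; rewrite mulr_sumr.
  by apply: eq_bigr => j _; rewrite (cl_sym ca); ring.
rewrite -!big_split; apply: eq_bigr => i _ /=.
rewrite mulr_sumr -!big_split; apply: eq_bigr => j _ /=.
by ring.
Qed.

Lemma form_even (c : 'I_n -> int) :
  exists k, \sum_i \sum_j a i j * (c i * c j) = 2 * k.
Proof.
pose F i j := a i j * (c i * c j).
have Fsym i j : F i j = F j i by rewrite /F (cl_sym ca) [c i * _]mulrC.
exists (\sum_i c i * c i + \sum_(i < n) \sum_(j < n | (j < i)%N) F i j).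
rewrite mulrDr [X in _ = _ + X]mulr_natl mulr2n.
rewrite [X in _ = _ + (X + _)](_ : _ = \sum_(i < n) \sum_(j < n | (i < j)%N) F i j).
  rewrite mulr_sumr -!big_split; apply: eq_bigr => i _ /=.
  rewrite (bigD1 i) //= (cl_diag ca); congr (_ + _).
  rewrite (bigID (fun j : 'I_n => (i < j)%N)) /=; congr (_ + _); apply: eq_bigl => j.
    by rewrite -val_eqE /=; case: ltngtP.
  by rewrite -val_eqE /=; case: ltngtP.
rewrite (exchange_big_dep xpredT) //=; apply: eq_bigr => i _.
by apply: eq_bigr => j _.
Qed.

(** Separating the positive and negative parts of [c] only increases the form,
    as the off-diagonal entries are nonpositive; but a nonzero vector has form
    at least 2. *)
Lemma short_root_sign (c : 'I_n -> int) :
  \sum_i \sum_j a i j * (c i * c j) = 2 ->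
  (forall i, 0 <= c i) \/ (forall i, c i <= 0).
Proof.
move=> qc.
pose u i := Num.max (c i) 0; pose v i := Num.max (- c i) 0.
have cuv i : c i = u i - v i by rewrite /u /v; lia.
have qc' : \sum_i \sum_j a i j * (c i * c j) =
    \sum_i \sum_j a i j * (u i * u j) + \sum_i \sum_j a i j * (v i * v j)
    - 2 * \sum_i \sum_j a i j * (u i * v j).
  rewrite mulr_natl mulr2n opprD addrA.
  rewrite [X in _ = _ - X - _](_ : _ = \sum_i \sum_j a i j * (v i * u j)); last first.
    rewrite exchange_big; apply: eq_bigr => i _; apply: eq_bigr => j _ /=.
    by rewrite (cl_sym ca) [u j * _]mulrC.
  rewrite -!sumrN -!big_split; apply: eq_bigr => i _ /=.
  rewrite -!sumrN -!big_split; apply: eq_bigr => j _ /=.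
  by rewrite !cuv; ring.
have uv_le0 : \sum_i \sum_j a i j * (u i * v j) <= 0.
  apply: sumr_le0 => i _; apply: sumr_le0 => j _.
  have [->|nij] := eqVneq i j.
    have [->|->] : u j = 0 \/ v j = 0 by rewrite /u /v; lia.
      by rewrite mul0r mulr0.
    by rewrite !mulr0.
  have [->|->] := cl_off ca nij; first by rewrite mul0r.
  by rewrite mulN1r oppr_le0 mulr_ge0 // le_max lexx orbT.
have big2 w : (exists i, w i != 0) -> 2 <= \sum_i \sum_j a i j * (w i * w j).
  by move=> /(cl_pos_int ca); have [k ->] := form_even w; lia.
have [/forallP u0|/forallPn[i ui]] := boolP [forall i, u i == 0].
  by right=> i; have := u0 i; rewrite /u; lia.
have [/forallP v0|/forallPn[j vj]] := boolP [forall j, v j == 0].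
  by left=> k; have := v0 k; rewrite /v; lia.
have := big2 u (ex_intro _ i ui); have := big2 v (ex_intro _ j vj).
move: uv_le0 qc; rewrite qc'; move: (\sum_i _) => U; move: (\sum_i _) => X.
by move: (\sum_i _) => W *; exfalso; lia.
Qed.

Lemma form_add1 (c : 'I_n -> int) (i : 'I_n) (k : int) :
  \sum_j \sum_l a j l * ((c j + (j == i)%:R * k) * (c l + (l == i)%:R * k)) =
  \sum_j \sum_l a j l * (c j * c l) + 2 * k * (\sum_j a i j * c j) + 2 * k * k.
Proof.
have := form_shift c (fun j => (j == i)%:R * k).
have E (F : 'I_n -> 'I_n -> int) :
    \sum_j \sum_l (a j l)%:~R * F j l = \sum_j \sum_l a j l * F j l.
  by apply: eq_bigr => j _; apply: eq_bigr => l _; rewrite intz.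
rewrite !E => ->.
have Sd (F : 'I_n -> int) : \sum_j (j == i)%:R * k * F j = k * F i.
  rewrite (bigD1 i) //= eqxx mul1r big1 ?addr0 // => j /negPf->.
  by rewrite !mul0r.
rewrite Sd mulrA; congr (_ + _ * _ + _).
  by apply: eq_bigr => j _; rewrite intz.
rewrite (eq_bigr (fun j => (j == i)%:R * k * (k * a j i))) => [|j _].
  by rewrite Sd (cl_diag ca); ring.
rewrite -Sd mulr_sumr; apply: eq_bigr => l _; ring.
Qed.

(** A reflection is an isometry; here it acts on the coordinates of a vector in
    the basis of simple roots. *)
Lemma form_reflect (c : 'I_n -> int) (i : 'I_n) :
  let t := \sum_j a i j * c j in
  let c' j := c j - (j == i)%:R * t in
  \sum_i \sum_j a i j * (c' i * c' j) = \sum_i \sum_j a i j * (c i * c j).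
Proof.
move=> t c'; have := form_add1 c i (- t); rewrite -/t.
under eq_bigr do under eq_bigr do rewrite !mulrN.
by rewrite -/(c' _) => ->; ring.
Qed.

Lemma form_simple (i : 'I_n) :
  \sum_j \sum_k a j k * (((j == i)%:R : int) * (k == i)%:R) = 2.
Proof.
rewrite (bigD1 i) //= [X in _ + X]big1 => [|j /negPf nj]; last first.
  by rewrite big1 // => k _; rewrite nj mul0r mulr0.
rewrite addr0 (bigD1 i) //= big1 => [|j /negPf->]; last by rewrite !mulr0.
by rewrite eqxx (cl_diag ca).
Qed.

(** The form is the sum of the [y i * (A y) i], so one of these is positive. *)
Lemma descent_index (R : realDomainType) (y : 'I_n -> R) :
  0 < \sum_i \sum_j (a i j)%:~R * (y i * y j) -> (forall i, 0 <= y i) ->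
  exists2 i, 0 < y i & 0 < \sum_j (a i j)%:~R * y j.
Proof.
move=> q0 y0; apply: NNPP => none.
suff: \sum_i \sum_j (a i j)%:~R * (y i * y j) <= 0 by rewrite leNgt q0.
apply: sumr_le0 => i _.
rewrite (_ : \sum_j _ = y i * \sum_j (a i j)%:~R * y j); last first.
  by rewrite mulr_sumr; apply: eq_bigr => j _; ring.
have [->|yi] := eqVneq (y i) 0; first by rewrite mul0r.
rewrite mulr_ge0_le0 // leNgt; apply/negP => pos; apply: none; exists i => //.
by rewrite lt_def yi y0.
Qed.

End Form.

(** * Orbits of a diagram automorphism *)

Section Orbits.
Variables (n : nat) (a : 'I_n -> 'I_n -> int) (s : {perm 'I_n}).
Hypotheses (ca : cartan_like a) (hs : diagram_aut a s).
Implicit Types p : sigma_orbit s.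

Lemma diagram_aut_expg k : diagram_aut a (s ^+ k)%g.
Proof.
elim: k => [|k IHk] i j; first by rewrite expg0 !perm1.
by rewrite expgSr !permM hs IHk.
Qed.

Lemma mem_sigma_orbit p i : (i \in val p) = (orbit_of s i == p).
Proof.
case: p => p hp; rewrite -val_eqE /=; have /imsetP[j _ ->] := hp.
by rewrite -eq_porbit_mem eq_sym.
Qed.

Lemma orbit_of_mem i : i \in val (orbit_of s i).
Proof. by rewrite mem_sigma_orbit. Qed.

Lemma orbit_nonempty p : exists i, i \in val p.
Proof. by case: p => p hp /=; have /imsetP[j _ ->] := hp; exists j; apply: porbit_id. Qed.

Lemma orbit_of_expg k i : orbit_of s ((s ^+ k)%g i) = orbit_of s i.
Proof. by apply/val_inj; rewrite /= porbit_perm. Qed.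

Lemma orbit_of_expg_mem p k i : ((s ^+ k)%g i \in val p) = (i \in val p).
Proof. by rewrite !mem_sigma_orbit orbit_of_expg. Qed.

Lemma orbit_of_perm_mem p i : (s i \in val p) = (i \in val p).
Proof. by have := orbit_of_expg_mem p 1 i; rewrite expg1. Qed.

Lemma orbit_expgP p i j : i \in val p -> j \in val p -> exists k, j = (s ^+ k)%g i.
Proof.
rewrite !mem_sigma_orbit => /eqP<- /eqP/(congr1 val) /= eq_ij.
by apply/porbitP; rewrite -eq_ij porbit_id.
Qed.

Lemma sum_orbits (R : nmodType) (F : 'I_n -> R) :
  \sum_i F i = \sum_(p : sigma_orbit s) \sum_(i in val p) F i.
Proof.
rewrite (partition_big (orbit_of s) xpredT) //=.
by apply: eq_bigr => p _; apply: eq_bigl => i; rewrite mem_sigma_orbit.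
Qed.

(** [2 / (2 - d)], where [d] is the number of neighbours that a node of the
    orbit [p] has inside [p]. *)
Definition eps p : nat := if orthogonal_orbit a (val p) then 1 else 2.

(** The neighbours of [i] inside the orbit, together with [i] itself. *)
Definition inner_nb p i j := (j \in val p) && (a i j != 0).

(** An orbit spans a regular subgraph, of degree [d] say, and evaluating the
    form at the indicator function of the orbit gives a positive multiple of
    [2 - d], whence [d <= 1]. *)
Lemma orbit_structure p i : i \in val p ->
  (eps p = 1%N /\ forall (R : nmodType) (F : 'I_n -> R), \sum_(j | inner_nb p i j) F j = F i)
  \/ (eps p = 2%N /\ exists j, [/\ j \in val p, j != i, a i j = -1,
      forall (R : nmodType) (F : 'I_n -> R), \sum_(k | inner_nb p i k) F k = F i + F j
    & forall (R : nmodType) (F : 'I_n -> R), \sum_(k | inner_nb p j k) F k = F j + F i]).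
Proof.
move=> ip; pose D i := [set j in val p | (j != i) && (a i j != 0)].
pose row i := \sum_(j in val p) a i j.
have rowE k : k \in val p -> row k = 2 - #|D k|%:Z.
  move=> kp; rewrite /row (bigD1 k) //= (cl_diag ca); congr (_ + _).
  rewrite -sum1_card -[_%:Z]natz natr_sum -sumrN.
  rewrite (bigID (fun j => a k j != 0)) /= [X in _ + X]big1 ?addr0; last first.
    by move=> j /andP[_ /negPn/eqP].
  apply: eq_big => [j|j /andP[/andP[_ nj] aj]]; first by rewrite inE andbA.
  by rewrite eq_sym in nj; have [a0|->//] := cl_off ca nj; rewrite a0 eqxx in aj.
have row_const k l : k \in val p -> l \in val p -> row k = row l.
  move=> kp /(orbit_expgP kp)[m ->]; rewrite /row.
  rewrite [RHS](reindex_inj (@perm_inj _ (s ^+ m)%g)) /=; apply: eq_big => j.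
    exact/esym/orbit_of_expg_mem.
  by rewrite diagram_aut_expg.
have row_gt0 : 0 < row i.
  pose y (j : 'I_n) : int := (j \in val p)%:R.
  have yi : y i != 0 by rewrite /y ip.
  have := cl_pos_int ca (ex_intro (fun j => y j != 0) i yi).
  rewrite (_ : \sum_i _ = \sum_(k in val p) row k).
    rewrite (eq_bigr (fun=> row i)) => [|k kp]; last exact: row_const.
    by rewrite sumr_const pmulrn_lgt0 //; apply/card_gt0P; exists i.
  rewrite [RHS]big_mkcond; apply: eq_bigr => k _; rewrite /y.
  case: ifP => _; last by rewrite big1 // => j _; rewrite mul0r mulr0.
  rewrite /row [RHS]big_mkcond; apply: eq_bigr => j _; rewrite mul1r.
  by case: ifP => _; rewrite ?mulr1 ?mulr0.
have cardD k : k \in val p -> #|D k| = #|D i| /\ (#|D i| <= 1)%N.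
  by move=> kp; move: row_gt0 (row_const _ _ kp ip); rewrite !rowE //; lia.
have nbE k l : k \in val p -> inner_nb p k l = (l == k) || (l \in D k).
  rewrite /inner_nb inE => kp; have [->|] := eqVneq l k; last by [].
  by rewrite kp (cl_diag ca).
have epsE : eps p = #|D i|.+1.
  rewrite /eps; case: ifPn => [/forall_inP orth|/forall_inPn[k kp]].
    apply/esym/eqP; rewrite eqSS cards_eq0; apply/eqP/setP => j; rewrite !inE.
    apply/negP => /and3P[jp nji]; have /forall_inP/(_ j jp) := orth i ip.
    by rewrite eq_sym nji => /eqP->; rewrite eqxx.
  case/forall_inPn=> l lp; rewrite negb_imply => /andP[nkl akl].
  have : (0 < #|D k|)%N.
    by apply/card_gt0P; exists l; rewrite inE lp eq_sym nkl.
  by have [-> ] := cardD k kp; case: #|D i| => [|[|]].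
have [_ leD] := cardD i ip; have [D0|D1] : #|D i| = 0%N \/ #|D i| = 1%N by lia.
  left; rewrite epsE D0; split=> // R F; rewrite (big_pred1 i) // => j.
  by rewrite nbE // (cards0_eq D0) inE orbF.
right; rewrite epsE D1; split=> //; have /eqP/cards1P[j Dij] := D1.
have : j \in D i by rewrite Dij inE.
rewrite inE => /and3P[jp nji aij0].
have aij : a i j = -1.
  by rewrite eq_sym in nji; have [a0|->//] := cl_off ca nji; rewrite a0 eqxx in aij0.
have Dji : D j = [set i].
  have [+ _] := cardD j jp; rewrite D1 => /eqP/cards1P[k Djk].
  suff : i \in D j by rewrite Djk inE => /eqP->.
  by rewrite inE ip eq_sym nji (cl_sym ca) aij0.
exists j; split=> // R F.
  rewrite (bigD1 i) ?nbE ?eqxx //=; congr (_ + _); apply: big_pred1 => k.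
  rewrite nbE // Dij inE; have [->|_] := eqVneq k i; last by rewrite andbT.
  by rewrite andbF /= eq_sym (negPf nji).
rewrite (bigD1 j) ?nbE ?eqxx //=; congr (_ + _); apply: big_pred1 => k.
rewrite nbE // Dji inE; have [->|_] := eqVneq k j; last by rewrite andbT.
by rewrite andbF /= (negPf nji).
Qed.

Lemma inner_nb_refl p i : i \in val p -> inner_nb p i i.
Proof. by move=> ip; rewrite /inner_nb ip (cl_diag ca). Qed.

Lemma inner_nb_sym p i j : i \in val p -> j \in val p -> inner_nb p i j = inner_nb p j i.
Proof. by rewrite /inner_nb => -> ->; rewrite (cl_sym ca). Qed.

(** This says that the simple root [beta_p] takes the value 2 at its coroot. *)
Lemma eps_row p i : i \in val p -> (\sum_(j in val p) a i j) *+ eps p = 2.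
Proof.
move=> ip; have -> : \sum_(j in val p) a i j = \sum_(j | inner_nb p i j) a i j.
  rewrite (bigID (fun j => a i j != 0)) /= [X in _ + X]big1 ?addr0 //.
  by move=> j /andP[_ /negPn/eqP].
have [[-> ->]|[-> [j [_ _ aij -> _]]]] := orbit_structure ip.
  by rewrite (cl_diag ca).
by rewrite (cl_diag ca) aij.
Qed.

Lemma eps_gt0 p : (0 < eps p)%N.
Proof. by rewrite /eps; case: ifP. Qed.

(** The coefficient of the simple root [i] that the reflection attached to the
    orbit [p] subtracts from a weight with values [x] at the simple coroots. *)
Definition tau (R : nmodType) p (x : 'I_n -> R) i := \sum_(j | inner_nb p i j) x j.

Lemma sum_tau (R : nmodType) p (x : 'I_n -> R) :
  \sum_(i in val p) tau p x i = (\sum_(i in val p) x i) *+ eps p.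
Proof.
rewrite -sumrMnl (exchange_big_dep (mem (val p))) /=; last by move=> i j _ /andP[].
apply: eq_bigr => j jp.
rewrite (eq_bigl (fun i => inner_nb p j i)) => [|i]; last first.
  rewrite /inner_nb; case: (boolP (i \in val p)) => //= ip.
  by rewrite jp (cl_sym ca).
have [[-> ->//]|[-> [k [_ _ _ -> _]]]] := orbit_structure jp.
by rewrite mulr2n.
Qed.

End Orbits.

(** * The orbit of a minuscule weight and its orders *)

Section Chains.
Variables (T : Type) (A : T -> Prop) (step : T -> T -> Prop).

Lemma chain_in_refl x : A x -> chain_in A step x x.
Proof. by move=> Ax; exists 0%N, (fun=> x); split. Qed.

Lemma chain_in_cons x y z :
  A x -> step x y -> chain_in A step y z -> chain_in A step x z.
Proof.
move=> Ax xy [k [u [u0 uk Au su]]].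
exists k.+1, (fun i => if i is j.+1 then u j else x); split=> // -[|i] //=.
- exact: Au.
- by rewrite u0.
- exact: su.
Qed.

Lemma chain_in_ind (R : T -> T -> Prop) :
  (forall x, A x -> R x x) ->
  (forall x y z, A x -> A y -> A z -> step x y -> R y z -> R x z) ->
  forall x y, chain_in A step x y -> R x y.
Proof.
move=> Rxx Rs x y [k]; elim: k x => [|k IHk] x [u [u0 uk Au su]].
  by rewrite -uk u0; apply: Rxx; rewrite -u0; apply: Au.
rewrite -u0; apply: (Rs _ (u 1%N)); rewrite -?uk; try exact: Au; first exact: su.
rewrite uk; apply: IHk; exists (fun i => u i.+1); split=> // i lti; first exact: Au.
exact: su.
Qed.

Lemma chain_in_trans x y z :
  chain_in A step x y -> chain_in A step y z -> chain_in A step x z.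
Proof.
move=> xy; move: x y xy z.
apply: (@chain_in_ind (fun x y => forall z, chain_in A step y z -> chain_in A step x z)).
  by [].
by move=> x y z Ax _ _ st IH t /IH; apply: chain_in_cons.
Qed.

Lemma chain_in1 x y : A x -> A y -> step x y -> chain_in A step x y.
Proof. by move=> Ax Ay st; apply: chain_in_cons st _ => //; apply: chain_in_refl. Qed.

End Chains.

Section Weyl.
Variables (K : numFieldType) (g : lie_alg K) (D : cartan_datum g).

Lemma weyl_comp (w w' : 'End(weight D)) : weyl w -> weyl w' -> weyl (w \o w')%VF.
Proof.
by elim=> [|i {}w _ IH] ww'; rewrite ?comp_lfun1l // -comp_lfunA; apply/weyl_refl/IH.
Qed.

Lemma weyl_orbit_refl la i (mu : weight D) :
  weyl_orbit la mu -> weyl_orbit la (simple_refl i mu).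
Proof.
case=> w ww ->; exists (simple_refl i \o w)%VF; first exact: weyl_refl.
by rewrite comp_lfunE.
Qed.

Lemma weyl_orbit_id (la : weight D) : weyl_orbit la la.
Proof. by exists \1%VF; [exact: weyl_id | rewrite id_lfunE]. Qed.

Lemma weyl_orbit_ind (la : weight D) (P : weight D -> Prop) :
  P la -> (forall i mu, P mu -> P (simple_refl i mu)) ->
  forall mu, weyl_orbit la mu -> P mu.
Proof.
move=> Pla Ps _ [w ww ->]; elim: ww => [|i {}w _ IH]; first by rewrite id_lfunE.
by rewrite comp_lfunE; apply: Ps.
Qed.
End Weyl.

Section Weights.
Variables (K : numFieldType) (n : nat) (a : 'I_n -> 'I_n -> int).
Variables (g : lie_alg K) (S : chevalley a g).
Hypothesis ca : cartan_like a.

Lemma ch_in_cartan i : ch S i \in cartan S.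
Proof. by apply: memv_span; apply/mapP; exists i; rewrite ?mem_enum. Qed.

Lemma ev_form_of c i : ev (form_of S c) (ch S i) = c i.
Proof.
rewrite /ev /form_of linfun_linear => [|k x y]; last first.
  rewrite scaler_sumr -big_split; apply: eq_bigr => j _ /=.
  by rewrite !linearP mulrDr; congr (_ + _); exact: mulrCA.
rewrite vsprojK ?ch_in_cartan //.
rewrite (bigD1 i) //= big1 => [|j nji].
  have -> : ch S i = [tuple ch S i | i < n]`_i by rewrite -tnth_nth tnth_mktuple.
  by rewrite coord_free ?ch_free // eqxx mulr1 addr0.
have -> : ch S i = [tuple ch S i | i < n]`_i by rewrite -tnth_nth tnth_mktuple.
by rewrite coord_free ?ch_free // eq_sym (negPf nji) mulr0.
Qed.

Lemma ev_alpha i j : ev (alpha S j) (ch S i) = (a i j)%:~R.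
Proof. exact: ev_form_of. Qed.

Lemma cartan_evP (mu nu : weight (datum S)) :
  (forall i, ev mu (ch S i) = ev nu (ch S i)) -> mu = nu.
Proof.
move=> eq_mn; apply: evP => x /span_mktuple[c ->]; rewrite !evx_sum.
by apply: eq_bigr => i _; rewrite !evxZ eq_mn.
Qed.

Lemma alpha_free (y : 'I_n -> K) :
  \sum_i y i *: alpha S i = 0 -> forall i, y i = 0.
Proof.
move=> y0; apply: (cl_nondegenerate ca) => i.
have := congr1 (fun mu => ev mu (ch S i)) y0; rewrite ev0 ev_sum => e; rewrite -[RHS]e.
by apply: eq_bigr => j _; rewrite evZ ev_alpha mulrC.
Qed.

Lemma datum_sl2 : sl2_datum (datum S).
Proof.
split=> [x y _ _|i|i|i]; rewrite ?memvf //=.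
- exact: ch_in_cartan.
- by rewrite ev_alpha (cl_diag ca).
exists (ce S i), (cf S i); rewrite !memvf ce_cf eqxx; split=> // [|h].
  apply/eqP => e0; have := ce_cf S i i; rewrite eqxx e0 lie0l => h0.
  have := ev_alpha i i; rewrite -h0 (cl_diag ca).
  have := evxZ (alpha S i) 0 (ch S i); rewrite scale0r mul0r => ->.
  by move/eqP; rewrite eq_sym intr_eq0.
move=> /span_mktuple[c ->]; rewrite !lie_suml evx_sum scaler_suml -sumrN scaler_suml.
split; apply: eq_bigr => j _; rewrite lieZl evxZ ev_alpha.
  by rewrite ch_ce scalerA.
by rewrite ch_cf scalerN scalerA scaleNr.
Qed.

Variable (la : weight (datum S)) (lam : 'I_n -> int).
Hypothesis la_lam : forall i, ev la (ch S i) = (lam i)%:~R.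

(** All weights of the orbit of [la] have this form, and their root order is the
    pointwise order on [d]. *)
Definition wt (d : 'I_n -> int) : weight (datum S) :=
  la - \sum_i (d i)%:~R *: alpha S i.

Definition wval (d : 'I_n -> int) (i : 'I_n) : int := lam i - \sum_j a i j * d j.

Lemma eq_wt d d' : d =1 d' -> wt d = wt d'.
Proof. by move=> eqd; rewrite /wt; under eq_bigr do rewrite eqd. Qed.

Lemma ev_wt d i : ev (wt d) (ch S i) = (wval d i)%:~R.
Proof.
rewrite /wt evD evN la_lam ev_sum rmorphB rmorph_sum /=; congr (_ - _).
by apply: eq_bigr => j _; rewrite evZ ev_alpha mulrC rmorphM.
Qed.

Lemma wt0 : wt (fun=> 0) = la.
Proof. by rewrite /wt big1 ?subr0 // => i _; rewrite scale0r. Qed.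

Lemma wtB d d' : wt d - wt d' = \sum_i (d' i - d i)%:~R *: alpha S i.
Proof.
rewrite /wt opprB addrC addrA subrK -sumrB.
by apply: eq_bigr => i _; rewrite rmorphB scalerBl.
Qed.

Lemma wtD d y : wt (fun i => d i + y i) = wt d - \sum_i (y i)%:~R *: alpha S i.
Proof.
rewrite /wt -addrA -opprD -big_split; congr (_ - _).
by apply: eq_bigr => i _; rewrite rmorphD scalerDl.
Qed.

Lemma wt_inj d d' : wt d = wt d' -> d =1 d'.
Proof.
move=> eq_dd' i; apply/eqP; rewrite eq_sym -subr_eq0 -(intr_eq0 K); apply/eqP.
by move: i; apply: alpha_free; rewrite -wtB eq_dd' subrr.
Qed.

Definition add_simple (d : 'I_n -> int) j k : 'I_n -> int := fun i => d i + (i == j)%:R * k.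

Lemma wval_add_simple d j k i : wval (add_simple d j k) i = wval d i - a i j * k.
Proof.
rewrite /wval /add_simple; under eq_bigr do rewrite mulrDr.
rewrite big_split opprD addrA /=; congr (_ - _).
rewrite (bigD1 j) //= eqxx mul1r big1 ?addr0 // => l /negPf->.
by rewrite mul0r mulr0.
Qed.

Lemma simple_refl_wt j d : simple_refl j (wt d) = wt (add_simple d j (wval d j)).
Proof.
apply: cartan_evP => i; rewrite simple_reflE evD evN evZ !ev_wt ev_alpha.
by rewrite wval_add_simple (rmorphB _ (wval d i)) rmorphM /= [_%:~R * (a i j)%:~R]mulrC.
Qed.

Hypothesis lam_ge0 : forall i, 0 <= lam i.
Hypothesis la_min : minuscule la.

Definition orb d := weyl_orbit la (wt d).

Lemma orb0 : orb (fun=> 0).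
Proof. by rewrite /orb wt0; apply: weyl_orbit_id. Qed.

Lemma orb_refl j d : orb d -> orb (add_simple d j (wval d j)).
Proof. by move=> od; rewrite /orb -simple_refl_wt; apply: weyl_orbit_refl. Qed.

(** Weyl group elements preserve the norm: [|la - v| ^ 2 = |la| ^ 2]. *)
Lemma orb_form mu : weyl_orbit la mu -> exists2 d, mu = wt d &
  \sum_i \sum_j a i j * (d i * d j) = 2 * \sum_i lam i * d i.
Proof.
move: mu; apply: weyl_orbit_ind.
  exists (fun=> 0); first by rewrite wt0.
  rewrite !big1 // => i _; first by rewrite mulr0.
  by rewrite big1 // => j _; rewrite !mulr0.
move=> i _ [d -> qd]; exists (add_simple d i (wval d i)); first exact: simple_refl_wt.
rewrite /add_simple form_add1 // qd.
have -> : \sum_j lam j * (d j + (j == i)%:R * wval d i) =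
    \sum_j lam j * d j + lam i * wval d i.
  under eq_bigr do rewrite mulrDr; rewrite big_split /=; congr (_ + _).
  rewrite (bigD1 i) //= eqxx mul1r big1 ?addr0 // => j /negPf->.
  by rewrite mul0r mulr0.
by rewrite /wval; ring.
Qed.

Lemma orb_form_wt d : orb d ->
  \sum_i \sum_j a i j * (d i * d j) = 2 * \sum_i lam i * d i.
Proof.
move=> /orb_form[d' /wt_inj eqd q].
rewrite [in RHS](eq_bigr (fun i => lam i * d' i)) => [|i _]; last by rewrite eqd.
rewrite -q; apply: eq_bigr => i _; apply: eq_bigr => j _; by rewrite !eqd.
Qed.

Lemma orb_wval d i : orb d -> `|wval d i| <= 1.
Proof.
case=> w ww def_d; have [_ _ /(_ w i ww)] := la_min.
rewrite -def_d [cd_coroot _]/= ev_wt !inE.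
rewrite -[-1 : K](rmorphN1 (intmul 1)) -[0 : K]/(0%:~R) -[1 : K]/(1%:~R) !eqr_int.
by case/or3P => /eqP->.
Qed.

(** With [v = d' - d], some [v j] and [(A v) j] are both positive; the latter is
    the difference of two values in [{-1, 0, 1}]. *)
Lemma orb_descent d d' : orb d -> orb d' -> (forall i, d i <= d' i) ->
  (exists i, d i != d' i) ->
  exists2 j, d j < d' j & wval d j = 1 \/ wval d' j = -1.
Proof.
move=> od od' le_d [i ni].
have e_neq0 : d' i - d i != 0 by rewrite subr_eq0 eq_sym.
have := cl_pos_int ca (ex_intro (fun i => d' i - d i != 0) i e_neq0).
rewrite (eq_bigr (fun i => \sum_j (a i j)%:~R * ((d' i - d i) * (d' j - d j))));
  last by move=> k _; apply: eq_bigr => j _; rewrite intz.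
move=> /(descent_index)[k|j]; first by rewrite subr_ge0.
rewrite subr_gt0 => lt_dj.
rewrite (_ : \sum_k _ = wval d j - wval d' j).
  by have := orb_wval j od; have := orb_wval j od'; exists j => //; lia.
rewrite /wval opprB addrC addrA subrK -sumrB; apply: eq_bigr => k _.
by rewrite intz mulrBr.
Qed.

Lemma orb_step d j : orb d -> wval d j = 1 ->
  le_s la (wt d) (wt (add_simple d j 1)) /\ le_w la (wt d) (wt (add_simple d j 1)).
Proof.
move=> od wj; have od' : orb (add_simple d j 1) by rewrite -wj; apply: orb_refl.
have evj : ev (wt d) (ch S j) = 1 by rewrite ev_wt wj.
split; apply: chain_in1 => //.
  exists (alpha S j), (ch S j); split; rewrite ?evj ?ltr01 //.
  - exact: (positive_root_simple datum_sl2 j).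
  - exact: (is_coroot_simple datum_sl2 j).
  - by have := simple_refl_wt j d; rewrite simple_reflE [cd_coroot _]/= evj wj.
exists j; rewrite [cd_coroot _]/= evj ltr01; split=> //.
by rewrite simple_refl_wt wj.
Qed.

Lemma eq_le_s d d' e e' : d =1 d' -> e =1 e' ->
  le_s la (wt d) (wt e) -> le_s la (wt d') (wt e').
Proof. by move=> /eq_wt-> /eq_wt->. Qed.

(** Each step of the Bruhat order subtracts a positive multiple of a positive
    root. *)
Lemma le_s_wt_ge d d' : le_s la (wt d) (wt d') -> forall i, d i <= d' i.
Proof.
move=> le_dd'.
pose R (mu nu : weight (datum S)) := forall d d', mu = wt d -> nu = wt d' ->
  forall i, d i <= d' i.
suff: R (wt d) (wt d') by apply.
apply: (@chain_in_ind _ _ _ R _ _ _ _ le_dd') => [mu _ e e' -> /wt_inj eq_e i|].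
  by rewrite eq_e.
move=> mu0 mu nu _ omu _ [b [v [[_ [c ->]] _ def_mu1 pos]]] IH e e' def_mu0 def_nu i.
rewrite def_mu0 in def_mu1 pos.
have [e1 def_mu _] := orb_form omu; rewrite def_mu in IH.
apply: le_trans (IH _ _ erefl def_nu i).
rewrite def_mu in def_mu1; set t := ev _ v in pos def_mu1.
have : forall k, (e1 k - e k)%:~R - t * (c k)%:R = 0.
  apply: alpha_free; transitivity (wt e - wt e1 - t *: \sum_k alpha S k *+ c k).
    rewrite wtB scaler_sumr -sumrB.
    apply: eq_bigr => k _; rewrite scalerBl; congr (_ - _).
    by rewrite -[_ *+ _ in RHS]scaler_nat scalerA.
  by rewrite addrAC def_mu1 subrr.
move/(_ i)/eqP; rewrite subr_eq0 => /eqP pos_i.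
by rewrite -subr_ge0 -(ler0z K) pos_i mulr_ge0 ?ler0n // ltW.
Qed.

(** On a minuscule orbit the Bruhat order is the root order, and even simple
    reflections suffice to go up in it. *)
Lemma ge_le_s d d' : orb d -> orb d' -> (forall i, d i <= d' i) ->
  le_s la (wt d) (wt d').
Proof.
have [k] := ubnP `|(\sum_i (d' i - d i))%R|%N.
elim: k d d' => // k IHk d d' lt_k od od' le_dd'.
have [/forallP eq_d|/forallPn ne_d] := boolP [forall i, d i == d' i].
  rewrite (@eq_wt d d') => [|i]; last exact/eqP.
  exact: chain_in_refl.
have [j lt_j] := orb_descent od od' le_dd' ne_d.
have sum_e (e e' : 'I_n -> int) : (forall i, e' i - e i = d' i - d i - (i == j)%:R) ->
    (`|(\sum_i (e' i - e i))%R| < k)%N.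
  move=> eqe; under eq_bigr do rewrite eqe.
  rewrite sumrB [X in _ - X](_ : _ = 1) => [|]; last first.
    by rewrite (bigD1 j) //= eqxx big1 ?addr0 // => i /negPf->.
  have : 0 < \sum_i (d' i - d i).
    rewrite (bigD1 j) //= ltr_pwDl ?subr_gt0 // sumr_ge0 // => i _.
    by rewrite subr_ge0.
  move: lt_k; move: (\sum_i (d' i - d i)) => X; by move: k {IHk} => k; lia.
case=> wj.
  have [st _] := orb_step od wj; apply: chain_in_trans st _.
  apply: IHk => //; first by apply: sum_e => i; rewrite /add_simple mulr1; lia.
    by rewrite -wj; apply: orb_refl.
  move=> i; rewrite /add_simple; have [->|_] := eqVneq i j; last by rewrite mul0r addr0.
  by move: lt_j; rewrite mulr1; lia.
have od1 : orb (add_simple d' j (-1)) by rewrite -wj; apply: orb_refl.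
have wj1 : wval (add_simple d' j (-1)) j = 1 by rewrite wval_add_simple wj (cl_diag ca).
have [st _] := orb_step od1 wj1.
apply: chain_in_trans (eq_le_s (fun=> erefl) _ st); last first.
  by move=> i; rewrite /add_simple; lia.
apply: IHk => //; first by apply: sum_e => i; rewrite /add_simple mulrN1; lia.
move=> i; rewrite /add_simple; have [->|_] := eqVneq i j; last by rewrite mul0r addr0.
by move: lt_j; rewrite mul1r; lia.
Qed.

End Weights.

(** * Lifting the folded reflections to the Weyl group *)

Section FoldedReflections.
Variables (K : numFieldType) (n : nat) (a : 'I_n -> 'I_n -> int).
Variables (g : lie_alg K) (S : chevalley a g).
Hypothesis ca : cartan_like a.
Variables (s : {perm 'I_n}) (sg : 'End(g)).
Hypotheses (hs : diagram_aut a s) (hsg : lifts_diagram_aut S s sg).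
Implicit Types (p : sigma_orbit s) (mu : weight (datum S)).

Let evs mu := fun j => ev mu (ch S j).

Lemma simple_refl_ev j mu i :
  ev (simple_refl j mu) (ch S i) = ev mu (ch S i) - ev mu (ch S j) * (a i j)%:~R.
Proof. by rewrite simple_reflE evD evN evZ [cd_root j]/= ev_alpha. Qed.

Lemma ev_sub_alpha mu (A : {set 'I_n}) (y : 'I_n -> K) i :
  ev (mu - \sum_(k in A) y k *: alpha S k) (ch S i) =
  ev mu (ch S i) - \sum_(k in A) y k * (a i k)%:~R.
Proof.
rewrite evD evN ev_sum; congr (_ - _).
by apply: eq_bigr => k _; rewrite evZ ev_alpha.
Qed.

(** The node [i] contributes the reflection [s_i] when it has no neighbour in
    its orbit, and with its only neighbour [j] the longest element
    [s_i s_j s_i] of a parabolic subgroup of type A2. *)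
Lemma fold_refl_weyl p : exists2 w, weyl w &
  forall mu, w mu = mu - \sum_(i in val p) tau a p (evs mu) i *: alpha S i.
Proof.
suff H : forall (A : {set 'I_n}), A \subset val p ->
    (forall k l, k \in A -> inner_nb a p k l -> l \in A) ->
    exists2 w : 'End(weight (datum S)), weyl w &
    forall mu, w mu = mu - \sum_(i in A) tau a p (evs mu) i *: alpha S i.
  by apply: H => // k l _ /andP[].
move=> A; have [k] := ubnP #|A|; elim: k A => // k IHk A.
rewrite ltnS => leA sAp clA.
have [->|[i iA]] := set_0Vmem A.
  exists \1%VF => [|mu]; first exact: weyl_id.
  by rewrite id_lfunE big_set0 subr0.
have ip : i \in val p := subsetP sAp i iA.
have nb_sum (i' : 'I_n) (B : seq 'I_n) :
    (forall F : 'I_n -> nat, \sum_(l | inner_nb a p i' l) F l = \sum_(l <- B) F l)%N ->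
    forall l, inner_nb a p i' l -> l \in B.
  move=> eqB l nbl; apply: contraT => lB.
  have := eqB (fun m => m == l : nat).
  rewrite (bigD1 l) //= eqxx [in RHS]big_seq [in RHS]big1 // => m mB.
  by case: eqP => // eqm; rewrite -eqm mB in lB.
have [[_ nbi]|[_ [j [jp nji aij nbi nbj]]]] := orbit_structure ca hs ip.
  have only_i l : inner_nb a p i l -> l = i.
    by move/(nb_sum i [:: i]); rewrite inE => H; apply/eqP/H => F; rewrite big_seq1 nbi.
  have a0 l : l \in A :\ i -> a i l = 0.
    rewrite !inE => /andP[nli lA]; apply: contraNeq nli => al.
    by apply/eqP/only_i; rewrite /inner_nb (subsetP sAp).
  have [|||w ww wE] := IHk (A :\ i).
  - by rewrite (leq_trans _ leA) // [in X in (_ < X)%N](cardsD1 i) iA.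
  - by rewrite (subset_trans _ sAp) // subD1set.
  - move=> u v; rewrite !inE => /andP[nui uA] nbv; rewrite (clA u) // andbT.
    apply: contraNneq nui => vi; apply/eqP/only_i.
    by rewrite (inner_nb_sym ca) ?(subsetP sAp u uA) // -{1}vi.
  exists (simple_refl (i : cd_index (datum S)) \o w)%VF; first exact: weyl_refl.
  move=> mu; rewrite comp_lfunE simple_reflE [cd_coroot _]/=.
  have -> : ev (w mu) (ch S i) = ev mu (ch S i).
    by rewrite wE ev_sub_alpha big1 ?subr0 // => l /a0->; rewrite mulr0.
  rewrite wE -addrA -opprD [in RHS](big_setD1 i) //=.
  by congr (_ - _); rewrite addrC /tau nbi.
have only_ij l : inner_nb a p i l -> l \in [:: i; j].
  by apply: nb_sum => F; rewrite nbi !big_cons big_nil addn0.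
have only_ji l : inner_nb a p j l -> l \in [:: i; j].
  by apply: nb_sum => F; rewrite nbj !big_cons big_nil addn0 addnC.
have jA : j \in A by apply: (clA i) => //; rewrite /inner_nb jp aij.
have jAi : j \in A :\ i by rewrite !inE nji.
pose B := A :\ i :\ j.
have BA l : l \in B -> [/\ l != i, l != j & l \in A].
  by rewrite !inE => /and3P[-> ->].
have a0 l : l \in B -> a i l = 0 /\ a j l = 0.
  move=> /BA[nli nlj lA]; split; apply/eqP; apply: contraTT isT => al.
    have : inner_nb a p i l by rewrite /inner_nb (subsetP sAp).
    by move/only_ij; rewrite !inE (negPf nli) (negPf nlj).
  have : inner_nb a p j l by rewrite /inner_nb (subsetP sAp).
  by move/only_ji; rewrite !inE (negPf nli) (negPf nlj).
have [|||w ww wE] := IHk B.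
- by move: leA (cardsD1 i A) (cardsD1 j (A :\ i)); rewrite iA jAi -/B; lia.
- by apply/subsetP => l /BA[_ _ /(subsetP sAp)].
- move=> u v /BA[nui nuj uA] nbv; rewrite !inE (clA u) // andbT.
  have up := subsetP sAp u uA.
  apply/andP; split; apply/negP => /eqP eqv; rewrite eqv in nbv.
    by move: nbv; rewrite (inner_nb_sym ca) // => /only_ji; rewrite !inE (negPf nui) (negPf nuj).
  by move: nbv; rewrite (inner_nb_sym ca) // => /only_ij; rewrite !inE (negPf nui) (negPf nuj).
pose r (l : cd_index (datum S)) := simple_refl l.
exists (r i \o (r j \o (r i \o w)))%VF.
  by do 3![apply: weyl_refl].
move=> mu; set x := ev mu (ch S i); set y := ev mu (ch S j).
have wi : ev (w mu) (ch S i) = x.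
  by rewrite wE ev_sub_alpha big1 ?subr0 // => l /a0[-> _]; rewrite mulr0.
have wj : ev (w mu) (ch S j) = y.
  by rewrite wE ev_sub_alpha big1 ?subr0 // => l /a0[_ ->]; rewrite mulr0.
have ti : tau a p (evs mu) i = x + y by rewrite /tau nbi.
have tj : tau a p (evs mu) j = x + y by rewrite /tau nbj addrC.
have aji : a j i = -1 by rewrite (cl_sym ca).
rewrite !comp_lfunE; apply: cartan_evP => l.
rewrite !simple_refl_ev !wi !wj aij aji !(cl_diag ca) wE !ev_sub_alpha.
rewrite [in RHS](big_setD1 i) //= [in RHS](big_setD1 j) //= -/B.
rewrite ti tj rmorphN1; ring.
Qed.

Lemma sg_inv_ch i : (sg^-1)%VF (ch S (s i)) = ch S i.
Proof.
have [/eqP ker0 _ /(_ i)[_ _ <-]] := hsg.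
by rewrite lker0_lfunK.
Qed.

Lemma sigma_dual_ev mu i : ev (sigma_dual S sg mu) (ch S (s i)) = ev mu (ch S i).
Proof.
have E1 nu (x : subvs_of (cartan S)) :
    linfun (fun x : subvs_of (cartan S) => ev nu ((sg^-1)%VF (vsval x)) : K^o) x
    = ev nu ((sg^-1)%VF (vsval x)).
  by rewrite linfun_linear // => k u v; rewrite !linearP evxD evxZ.
rewrite /sigma_dual linfun_linear => [|k u v].
  by rewrite {1}/ev E1 vsprojK ?ch_in_cartan // sg_inv_ch.
by apply/lfunP => x; rewrite add_lfunE scale_lfunE !E1 evD evZ.
Qed.

Lemma sigma_dual_ker : lker (sigma_dual S sg) == 0%VS.
Proof.
apply/lker0P => mu nu eq_s; apply: cartan_evP => i.
by rewrite -sigma_dual_ev eq_s sigma_dual_ev.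
Qed.

(** Commuting with the automorphism is easier to compose than being fixed by
    conjugation. *)
Lemma weyl_fixedP w :
  weyl_fixed sg w <-> weyl w /\ forall mu, sigma_dual S sg (w mu) = w (sigma_dual S sg mu).
Proof.
split=> -[ww comm]; split=> //.
  move=> mu; rewrite -[in RHS]comm !comp_lfunE.
  by rewrite lker0_lfunK ?sigma_dual_ker.
apply/lfunP => mu; rewrite !comp_lfunE comm lker0_lfunVK ?sigma_dual_ker //.
Qed.

Lemma weyl_fixed_comp w w' : weyl_fixed sg w -> weyl_fixed sg w' ->
  weyl_fixed sg (w \o w' : 'End(weight (datum S)))%VF.
Proof.
move=> /weyl_fixedP[ww cw] /weyl_fixedP[ww' cw'].
apply/weyl_fixedP; split=> [|mu]; first exact: weyl_comp.
by rewrite !comp_lfunE cw cw'.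
Qed.

Lemma weyl_fixed_id : weyl_fixed sg (\1%VF : 'End(weight (datum S))).
Proof. by apply/weyl_fixedP; split=> [|mu]; rewrite ?id_lfunE //; apply: weyl_id. Qed.

Lemma sigma_dual_alpha i : sigma_dual S sg (alpha S i) = alpha S (s i).
Proof.
apply: cartan_evP => j; rewrite -[j](permKV s) sigma_dual_ev.
by rewrite !ev_alpha hs.
Qed.

Lemma fold_refl_fixed p : exists2 w, weyl_fixed sg w &
  forall mu, w mu = mu - \sum_(i in val p) tau a p (evs mu) i *: alpha S i.
Proof.
have [w ww wE] := fold_refl_weyl p; exists w => //.
apply/weyl_fixedP; split=> // mu; rewrite !wE linearB linear_sum /=; congr (_ - _).
rewrite [RHS](reindex_inj (@perm_inj _ s)) /=; apply: eq_big => [i|i ip].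
  exact/esym/orbit_of_perm_mem.
rewrite linearZ /= sigma_dual_alpha; congr (_ *: _).
rewrite /tau [RHS](reindex_inj (@perm_inj _ s)) /=; apply: eq_big => [j|j _].
  by rewrite /inner_nb orbit_of_perm_mem hs.
by rewrite /evs sigma_dual_ev.
Qed.

(** The transpose of a Weyl group element acts on vectors of form 2. *)
Lemma weyl_pairing (w : 'End(weight (datum S))) (c : 'I_n -> int) : weyl w ->
  \sum_i \sum_j a i j * (c i * c j) = 2 ->
  exists2 c' : 'I_n -> int, \sum_i \sum_j a i j * (c' i * c' j) = 2 &
  forall mu, \sum_i (c i)%:~R * evs (w mu) i = \sum_i (c' i)%:~R * evs mu i.
Proof.
move=> ww; elim: ww c => [|i {}w _ IH] c qc.
  by exists c => // mu; rewrite id_lfunE.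
have [|c' qc' cc'] := IH (fun j => c j - (j == i)%:R * \sum_l a i l * c l).
  by rewrite form_reflect.
exists c' => // mu; rewrite -cc' comp_lfunE.
under eq_bigr do rewrite /evs simple_refl_ev mulrBr.
under [RHS]eq_bigr do rewrite rmorphB mulrBl.
rewrite !sumrB; congr (_ - _).
rewrite [RHS](bigD1 i) //= eqxx mul1r [X in _ = _ + X]big1 ?addr0 => [|j /negPf->].
  rewrite rmorph_sum mulr_suml; apply: eq_bigr => j _.
  by rewrite rmorphM /= (cl_sym ca) /evs; ring.
by rewrite mul0r mulr0z mul0r.
Qed.

Variable la : weight (datum S).
Hypothesis la_ge0 : forall i, 0 <= ev la (ch S i).

(** A weight of the [W^]-orbit of [la] evaluates to numbers of the same sign at
    the coroots of one orbit: they are the values at a root, and its images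
    under the automorphism, of [la] and its images, which are dominant. *)
Lemma weyl_fixed_coherent w p i j : weyl_fixed sg w ->
  i \in val p -> j \in val p ->
  0 < ev (w la) (ch S i) -> 0 <= ev (w la) (ch S j).
Proof.
move=> /weyl_fixedP[ww cw] ip jp.
have [m ->] := orbit_expgP jp ip.
have [c' qc' cc'] := weyl_pairing ww (form_simple ca ((s ^+ m)%g j)).
pose sgm k := iter k (sigma_dual S sg).
have sgm_ev k mu l : ev (sgm k mu) (ch S ((s ^+ k)%g l)) = ev mu (ch S l).
  elim: k => [|k IHk]; first by rewrite expg0 perm1.
  by rewrite expgSr permM /= sigma_dual_ev.
have sgm_ge0 k l : 0 <= ev (sgm k la) (ch S l).
  by rewrite -[l](permKV (s ^+ k)%g) sgm_ev.
have sgmw k mu : sgm k (w mu) = w (sgm k mu).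
  by elim: k => //= k ->; rewrite cw.
have delta mu k : \sum_l (((l == k)%:R : int)%:~R : K) * evs mu l = evs mu k.
  rewrite (bigD1 k) //= eqxx mul1r big1 ?addr0 // => l /negPf->.
  by rewrite mulr0z mul0r.
have := cc' la; have := cc' (sgm m la); rewrite !delta /evs -sgmw sgm_ev => -> ->.
have [c_ge0 _|c_le0] := short_root_sign ca qc'.
  by apply: sumr_ge0 => l _; rewrite mulr_ge0 // ler0z.
rewrite le_gtF //; apply: sumr_le0 => l _.
by rewrite mulr_le0_ge0 // lerz0.
Qed.

End FoldedReflections.

(** * The fixed subalgebra *)

Lemma span_image (K : fieldType) (V : vectType K) (J : finType) (F : J -> V) x :
  x \in <<[seq F p | p : J]>>%VS -> exists c, x = \sum_p c p *: F p.
Proof.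
rewrite span_def big_image /= => /memv_sumP[us usP ->].
have /fin_all_exists[c cP] : forall p, exists k, us p = k *: F p.
  by move=> p; have /vlineP := usP p isT.
by exists c; apply: eq_bigr => p _; apply: cP.
Qed.

Section FoldDatum.
Variables (K : numFieldType) (n : nat) (a : 'I_n -> 'I_n -> int).
Variables (g : lie_alg K) (S : chevalley a g).
Hypothesis ca : cartan_like a.
Variables (s : {perm 'I_n}) (sg : 'End(g)).
Hypotheses (hs : diagram_aut a s) (hsg : lifts_diagram_aut S s sg).
Implicit Types (p q : sigma_orbit s) (mu : weight (datum S)).

Notation FD := (fold_datum S s sg).
Notation H p := (fold_coroot S p).
Definition beta p : weight FD := fold_root S p.
Definition fres mu : weight FD := res s mu.

Lemma fold_corootE p : H p = (eps a p)%:R *: \sum_(i in val p) ch S i.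
Proof.
rewrite /fold_coroot /eps; case: ifP => _; first by rewrite scale1r.
by rewrite scaler_nat.
Qed.

Lemma fold_coroot_in p : H p \in fold_cartan S s.
Proof. by apply/memv_span/mapP; exists p; rewrite ?mem_enum. Qed.

Lemma fold_cartan_sub h : h \in fold_cartan S s -> h \in cartan S.
Proof.
move=> /span_image[c ->]; apply: memv_suml => p _; rewrite memvZ //.
rewrite fold_corootE memvZ //; apply: memv_suml => i _; exact: ch_in_cartan.
Qed.

Lemma ev_fres mu h : h \in fold_cartan S s -> ev (fres mu) h = ev mu h.
Proof.
move=> hh; rewrite /fres /res {1}/ev linfun_linear ?vsprojK // => k x y.
by rewrite linearP evxD evxZ.
Qed.

Lemma ev_fres_H mu p :
  ev (fres mu) (H p) = (eps a p)%:R * \sum_(i in val p) ev mu (ch S i).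
Proof. by rewrite ev_fres ?fold_coroot_in // fold_corootE evxZ evx_sum. Qed.

Lemma fold_evP (mu nu : weight FD) :
  (forall p, ev mu (H p) = ev nu (H p)) -> mu = nu.
Proof.
move=> eq_mn; apply: evP => h /span_image[c ->]; rewrite !evx_sum.
by apply: eq_bigr => p _; rewrite !evxZ eq_mn.
Qed.

Lemma fres_alpha i : fres (alpha S i) = beta (orbit_of s i).
Proof.
rewrite /beta /fold_root; case: pickP => [j jp|/(_ i)]; last first.
  by rewrite orbit_of_mem.
apply: fold_evP => p; rewrite !ev_fres_H; congr (_ * _).
have [k ->] := orbit_expgP jp (orbit_of_mem s i).
rewrite (reindex_inj (@perm_inj _ (s ^+ k)%g)) /=; apply: eq_big => l.
  exact: orbit_of_expg_mem.
by rewrite !ev_alpha (diagram_aut_expg hs).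
Qed.

Lemma beta_mem p i : i \in val p -> beta p = fres (alpha S i).
Proof. by rewrite mem_sigma_orbit fres_alpha => /eqP->. Qed.

Lemma ev_beta p i q : i \in val p ->
  ev (beta p) (H q) = (eps a q)%:R * \sum_(j in val q) (a j i)%:~R.
Proof.
move=> /beta_mem->; rewrite ev_fres_H; congr (_ * _).
by apply: eq_bigr => j _; rewrite ev_alpha.
Qed.

Lemma ev_beta_diag p : ev (beta p) (H p) = 2.
Proof.
have [i ip] := orbit_nonempty p; rewrite (ev_beta _ ip).
have -> : 2 = (2 : int)%:~R :> K by [].
rewrite mulr_natl -(eps_row ca hs ip) rmorphMn rmorph_sum /=; congr (_ *+ _).
by apply: eq_bigr => j _; rewrite (cl_sym ca).
Qed.

Lemma fres_sub mu (y : 'I_n -> K) :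
  fres (mu - \sum_i y i *: alpha S i) =
  fres mu - \sum_(p : sigma_orbit s) (\sum_(i in val p) y i) *: beta p.
Proof.
apply: evP => h hh; rewrite evD evN !ev_fres // evD evN; congr (_ - _).
rewrite !ev_sum (sum_orbits s); apply: eq_bigr => p _.
rewrite evZ mulr_suml; apply: eq_bigr => i ip.
by rewrite evZ (beta_mem ip) ev_fres.
Qed.

(** A relation between the [beta p] gives a vector in the kernel of the Cartan
    matrix of [g], by spreading each coefficient evenly over its orbit. *)
Lemma beta_free (y : sigma_orbit s -> K) :
  \sum_p y p *: beta p = 0 -> forall p, y p = 0.
Proof.
move=> y0 p; pose z i := y (orbit_of s i) / #|val (orbit_of s i)|%:R.
have zp q i : i \in val q -> z i = y q / #|val q|%:R.
  by rewrite mem_sigma_orbit /z => /eqP->.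
have card0 q : #|val q|%:R != 0 :> K.
  by rewrite pnatr_eq0 -lt0n; apply/card_gt0P; apply: orbit_nonempty.
have row_const q i j : i \in val q -> j \in val q ->
    \sum_k (a i k)%:~R * z k = \sum_k (a j k)%:~R * z k.
  move=> iq jq; have [m ->] := orbit_expgP iq jq.
  rewrite [RHS](reindex_inj (@perm_inj _ (s ^+ m)%g)) /=; apply: eq_bigr => k _.
  by rewrite (diagram_aut_expg hs) /z orbit_of_expg.
have z0 : forall i, z i = 0.
  apply: (cl_nondegenerate ca) => i; pose q := orbit_of s i.
  have iq : i \in val q by apply: orbit_of_mem.
  have /(congr1 (fun be : weight FD => ev be (H q))) := y0; rewrite ev0 ev_sum.
  rewrite (_ : \sum_p _ = (eps a q * #|val q|)%:R * \sum_k (a i k)%:~R * z k).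
    move/eqP; rewrite mulf_eq0 natrM mulf_eq0 (negPf (card0 q)) pnatr_eq0 orbF.
    by rewrite eqn0Ngt eps_gt0 /= => /eqP.
  transitivity ((eps a q)%:R * \sum_(j in val q) \sum_k (a j k)%:~R * z k); last first.
    rewrite (eq_bigr (fun=> \sum_k (a i k)%:~R * z k)) => [|j jq].
      by rewrite sumr_const natrM -mulrA; congr (_ * _); rewrite mulr_natl.
    exact: (row_const q).
  rewrite exchange_big mulr_sumr (sum_orbits s); apply: eq_bigr => r _ /=.
  rewrite evZ; have [j jr] := orbit_nonempty r; rewrite (ev_beta _ jr).
  rewrite [in RHS](eq_bigr (fun=> (eps a q)%:R * ((\sum_(k in val q) (a k j)%:~R) *
      (y r / #|val r|%:R)))) => [|k kr].
    rewrite sumr_const -[RHS]mulr_natr.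
    by field; rewrite card0.
  rewrite -(zp r k kr) -mulr_suml; congr (_ * (_ * _)).
  have [m ->] := orbit_expgP jr kr.
  rewrite (reindex_inj (@perm_inj _ (s ^+ m)%g)) /=; apply: eq_big => l.
    exact: (orbit_of_expg_mem q).
  by rewrite (diagram_aut_expg hs).
have [i ip] := orbit_nonempty p; have := z0 i; rewrite (zp p) // => /eqP.
by rewrite mulf_eq0 invr_eq0 (negPf (card0 p)) orbF => /eqP.
Qed.

(** The sums over an orbit of the [e i] and of the [f i], the latter scaled by
    [eps], complete the folded coroot to an [sl2]-triple fixed by the automorphism. *)
Lemma fold_sl2 : sl2_datum FD.
Proof.
have [_ sg_lie sg_gen] := hsg.
split=> [x y /fixedSpaceP sx /fixedSpaceP sy|p|p|p].
- by apply/fixedSpaceP; rewrite sg_lie sx sy.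
- exact: fold_coroot_in.
- exact: ev_beta_diag.
have sum_fixed (F : 'I_n -> g) : (forall i, sg (F i) = F (s i)) ->
    \sum_(i in val p) F i \in fixedSpace sg.
  move=> sF; apply/fixedSpaceP; rewrite linear_sum /=.
  rewrite [RHS](reindex_inj (@perm_inj _ s)) /=; apply: eq_big => i.
    exact/esym/orbit_of_perm_mem.
  by rewrite sF.
pose E := \sum_(i in val p) ce S i; pose F := \sum_(i in val p) cf S i.
have EF : lie E ((eps a p)%:R *: F) = H p.
  rewrite lieZr fold_corootE; congr (_ *: _); rewrite lie_suml.
  apply: eq_bigr => i ip; rewrite lie_sumr (bigD1 i) //= ce_cf eqxx.
  by rewrite big1 ?addr0 // => j /andP[_ /negPf nji]; rewrite ce_cf eq_sym nji.
exists E, ((eps a p)%:R *: F); split=> //.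
- by apply: sum_fixed => i; have [] := sg_gen i.
- by rewrite memvZ //; apply: sum_fixed => i; have [] := sg_gen i.
- apply/eqP => E0; have := ev_beta_diag p; rewrite -EF E0 lie0l.
  have := evxZ (beta p) 0 (H p); rewrite scale0r mul0r => ->.
  by move/eqP; rewrite eq_sym pnatr_eq0.
move=> h hh; have hc := fold_cartan_sub hh.
have wE i : i \in val p -> lie h (ce S i) = ev (beta p) h *: ce S i /\
    lie h (cf S i) = - ev (beta p) h *: cf S i.
  move=> ip; rewrite (beta_mem ip) ev_fres //.
  move: hc => /span_mktuple[c ->]; rewrite !lie_suml evx_sum.
  rewrite scaler_suml -sumrN scaler_suml; split; apply: eq_bigr => j _.
    by rewrite lieZl evxZ ev_alpha ch_ce scalerA.
  by rewrite lieZl evxZ ev_alpha ch_cf scalerN scalerA scaleNr.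
split.
  by rewrite lie_sumr scaler_sumr; apply: eq_bigr => i /wE[].
rewrite lieZr lie_sumr [RHS]scalerA [_ * (eps a p)%:R]mulrC -scalerA.
congr (_ *: _); rewrite scaler_sumr.
by apply: eq_bigr => i /wE[].
Qed.

(** A root vector of [g(0)] is a sum of weight vectors of [g] of weights [c] with
    coordinates of one sign; as eigenvectors for distinct weights are
    independent, one of these [c] restricts to the given root. *)
Lemma fold_root_signed (b : weight FD) : is_root b ->
  exists2 c : sigma_orbit s -> int, b = \sum_p (c p)%:~R *: beta p &
    (forall p, 0 <= c p) \/ (forall p, c p <= 0).
Proof.
case=> b0 [x _ [x0 wx]].
have [l wl def_x] := sum_of_signed_weights S x.
pose vl (c : {ffun 'I_n -> int}) p : K :=
  (eps a p)%:R * \sum_(i in val p) (\sum_j a i j * c j)%:~R.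
have [none|] := classic (forall pp, pp \in l -> exists p, vl pp.1 p != ev b (H p)).
  case/eqP: x0; apply: (@eigen_sum_eq0 _ _ _ _ (fun p => ad (H p)) vl
    (fun p => ev b (H p)) l) => // [pp /wl[wpp _] p|p]; rewrite adE.
    rewrite fold_corootE lieZl lie_suml -scalerA; congr (_ *: _).
    by rewrite scaler_suml; apply: eq_bigr => i _; apply: wpp.
  exact/wx/fold_coroot_in.
move=> /not_all_ex_not ex_pp; have [[c y] npp] := ex_pp.
have [ppl eq_vl] := imply_to_and _ _ npp; have [_ sgn] := wl _ ppl.
exists (fun p => \sum_(i in val p) c i); last first.
  by case: sgn => sgn; [left|right] => p; [apply: sumr_ge0|apply: sumr_le0].
apply: fold_evP => p; have /eqP <- : vl c p == ev b (H p).
  by apply/negPn/negP => ne; apply: eq_vl; exists p.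
rewrite ev_sum /vl; under eq_bigr do rewrite rmorph_sum.
rewrite exchange_big (sum_orbits s) mulr_sumr; apply: eq_bigr => q _ /=.
rewrite evZ rmorph_sum /= mulr_suml mulr_sumr; apply: eq_bigr => j jq.
rewrite (ev_beta _ jq) mulrCA; congr (_ * _).
by rewrite mulr_sumr; apply: eq_bigr => i _; rewrite rmorphM mulrC.
Qed.

(** Restriction intertwines the reflection of [W~] with its lift to [W]. *)
Lemma fold_reflE mu p :
  @simple_refl K g FD p (fres mu) =
  fres (mu - \sum_(i in val p) tau a p (fun j => ev mu (ch S j)) i *: alpha S i).
Proof.
rewrite simple_reflE [cd_coroot _]/= [cd_root _]/= ev_fres_H.
set t := tau _ _ _; rewrite [in RHS]big_mkcond /=.
rewrite [in RHS](eq_bigr (fun i => (if i \in val p then t i else 0) *: alpha S i)) =>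
  [|i _]; last by case: ifP => // _; rewrite scale0r.
rewrite fres_sub; congr (_ - _).
rewrite (bigD1 p) //= [X in _ = _ + X]big1 ?addr0 => [|q nqp].
  congr (_ *: _); rewrite [RHS](eq_bigr t) => [|i ->] //.
  by rewrite sum_tau // mulr_natl.
rewrite big1 ?scale0r // => i iq; case: ifP => // ip.
by case/eqP: nqp; move: iq ip; rewrite !mem_sigma_orbit => /eqP<- /eqP<-.
Qed.

End FoldDatum.

(** * Lifting properties *)

Section Lifting.
Variables (K : numFieldType) (n : nat) (a : 'I_n -> 'I_n -> int).
Variables (g : lie_alg K) (S : chevalley a g).
Hypothesis ca : cartan_like a.
Variables (s : {perm 'I_n}) (sg : 'End(g)).
Hypotheses (hs : diagram_aut a s) (hsg : lifts_diagram_aut S s sg).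
Variables (la : weight (datum S)) (lam : 'I_n -> int).
Hypotheses (la_lam : forall i, ev la (ch S i) = (lam i)%:~R)
  (lam_ge0 : forall i, 0 <= lam i) (la_min : minuscule la).
Implicit Types (p : sigma_orbit s) (d e : 'I_n -> int).

Local Notation wv := (wval a lam).
Local Notation orb := (@orb K n a g S la).
Local Notation wt := (wt la).

Definition fixed_orb d := exists2 w, weyl_fixed sg w & wt d = w la.

(** The lift to [W] of the reflection of [W~] attached to [p], in coordinates. *)
Definition fold_move p d : 'I_n -> int :=
  fun i => d i + if i \in val p then tau a p (wv d) i else 0.

Lemma fold_moveE p d i :
  fold_move p d i = d i + if i \in val p then tau a p (wv d) i else 0.
Proof. by []. Qed.

(** Up to the factor [eps a p], the value of the restricted weight at the folded
    coroot; its sign decides whether [p] moves the weight up or down. *)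
Definition fold_value p d := \sum_(i in val p) wv d i.

Lemma fold_valueE p d : fold_value p d = \sum_(i in val p) wv d i.
Proof. by []. Qed.

Lemma fixed_orb_orb d : fixed_orb d -> orb d.
Proof. by case=> w [ww _] wd; exists w. Qed.

Lemma fixed_orb0 : fixed_orb (fun=> 0).
Proof. by exists \1%VF; [apply: weyl_fixed_id hsg | rewrite wt0 id_lfunE]. Qed.

Lemma wt_fold_move p d : wt (fold_move p d) =
  wt d - \sum_(i in val p) tau a p (fun j => ev (wt d) (ch S j)) i *: alpha S i.
Proof.
rewrite wtD [in RHS]big_mkcond /=; congr (_ - _); apply: eq_bigr => i _.
case: ifP => [_|_]; last by rewrite mulr0z scale0r.
rewrite /tau rmorph_sum /=; congr (_ *: _); apply: eq_bigr => j _.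
by rewrite (ev_wt la_lam).
Qed.

Lemma fixed_orb_move p d : fixed_orb d -> fixed_orb (fold_move p d).
Proof.
case=> w ww def_d; have [w' ww' w'E] := fold_refl_fixed ca hs hsg p.
exists (w' \o w)%VF; first exact: (weyl_fixed_comp hsg ww' ww).
by rewrite comp_lfunE -def_d w'E wt_fold_move.
Qed.

Lemma fres_fold_move p d : fres s sg (wt (fold_move p d)) =
  @simple_refl K g (fold_datum S s sg) p (fres s sg (wt d)).
Proof. by rewrite fold_reflE // wt_fold_move. Qed.

Lemma ev_fres_wt p d : ev (fres s sg (wt d)) (fold_coroot S p) =
  (eps a p)%:R * (fold_value p d)%:~R.
Proof.
rewrite ev_fres_H; congr (_ * _); rewrite /fold_value rmorph_sum.
by apply: eq_bigr => i _; apply: ev_wt.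
Qed.

Lemma fixed_orb_coherent p d i j : fixed_orb d -> i \in val p -> j \in val p ->
  0 < wv d i -> 0 <= wv d j.
Proof.
case=> w ww def_d ip jp; rewrite -(ltr0z K) -(ler0z K) -!(ev_wt la_lam) def_d.
by apply: (weyl_fixed_coherent ca hsg _ ww ip jp) => k; rewrite la_lam ler0z.
Qed.

(** On an orbit the values have one sign, which is therefore the sign of their
    sum. *)
Lemma fold_value_ge0 p d i : fixed_orb d -> 0 <= fold_value p d -> i \in val p -> 0 <= wv d i.
Proof.
move=> hd t0 ip; rewrite leNgt; apply/negP => wi.
move: t0; apply/negP; rewrite -ltNge /fold_value (bigD1 i) //= ltr_nwDl // sumr_le0 //.
move=> j /andP[jp _]; rewrite leNgt; apply/negP => wj.
by move: wi; rewrite ltNge (fixed_orb_coherent hd jp ip).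
Qed.

Lemma fold_value_le0 p d i : fixed_orb d -> fold_value p d <= 0 -> i \in val p -> wv d i <= 0.
Proof.
move=> hd t0 ip; rewrite leNgt; apply/negP => wi.
move: t0; apply/negP; rewrite -ltNge /fold_value (bigD1 i) //= ltr_pwDl // sumr_ge0 //.
by move=> j /andP[jp _]; apply: (fixed_orb_coherent hd ip jp).
Qed.

Lemma wval_diff p d e i : (forall k, k \notin val p -> d k = e k) ->
  i \in val p -> wv e i = wv d i - \sum_(k | inner_nb a p i k) a i k * (e k - d k).
Proof.
move=> eq_de ip; rewrite /wval -addrA -opprD; congr (_ - _).
rewrite [X in _ + X]big_mkcond -big_split; apply: eq_bigr => k _ /=.
rewrite /inner_nb; have [kp|/eq_de->] := boolP (k \in val p); last by rewrite addr0.
by have [->|_] /= := eqVneq (a i k) 0; [rewrite !mul0r addr0 | ring].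
Qed.

Lemma fold_move_out p d k : k \notin val p -> d k = fold_move p d k.
Proof. by rewrite /fold_move => /negPf->; rewrite addr0. Qed.

Lemma fold_move_in p d k : k \in val p -> fold_move p d k = d k + tau a p (wv d) k.
Proof. by rewrite /fold_move => ->. Qed.

(** Two adjacent nodes cannot both take the value 1, nor both -1: a simple
    reflection at one of them would give the value 2 at the other. *)
Lemma orb_adjacent d i j : orb d -> a i j = -1 -> `|wv d i + wv d j| <= 1.
Proof.
move=> od aij; have wi := orb_wval la_lam la_min i od.
have wj := orb_wval la_lam la_min j od.
have := orb_wval la_lam la_min i (orb_refl la_lam j od).
by rewrite wval_add_simple aij; lia.
Qed.

Lemma tau_bound p d i : orb d -> i \in val p -> `|tau a p (wv d) i| <= 1.
Proof.
move=> od ip; rewrite /tau.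
have [[_ ->]|[_ [j [_ _ aij -> _]]]] := orbit_structure ca hs ip.
  exact: (orb_wval la_lam la_min).
exact: orb_adjacent.
Qed.

Lemma tau_fold_move p d i : i \in val p -> tau a p (wv (fold_move p d)) i = - tau a p (wv d) i.
Proof.
move=> ip; have wT := wval_diff (@fold_move_out p d).
have [[_ nbi]|[_ [j [jp _ aij nbi nbj]]]] := orbit_structure ca hs ip.
  rewrite /tau !nbi (wT _ ip) nbi (cl_diag ca) fold_move_in // /tau nbi; lia.
have aji : a j i = -1 by rewrite (cl_sym ca).
rewrite {1}/tau nbi (wT _ ip) (wT _ jp) nbi nbj !(cl_diag ca) aij aji.
by rewrite !fold_move_in // /tau !nbi !nbj; lia.
Qed.

Lemma fold_moveK p d : fold_move p (fold_move p d) =1 d.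
Proof.
move=> i; rewrite {1}/fold_move; case: ifP => ip; last first.
  by rewrite addr0 -fold_move_out // ip.
by rewrite tau_fold_move // fold_move_in // addrK.
Qed.

Lemma fold_value_fold_move p d : fold_value p (fold_move p d) = - fold_value p d.
Proof.
have sumE e : \sum_(i in val p) tau a p (wv e) i = fold_value p e *+ eps a p.
  by rewrite sum_tau.
have : fold_value p (fold_move p d) *+ eps a p = - fold_value p d *+ eps a p.
  by rewrite mulNrn -!sumE -sumrN; apply: eq_bigr => i; apply: tau_fold_move.
move/eqP; rewrite -subr_eq0 -mulrnBl mulrn_eq0 eqn0Ngt eps_gt0 /= subr_eq0.
by move/eqP.
Qed.

(** Either [2 e i >= (A e) i > 0], or the neighbour [j] of [i] has [e j > 0] and
    then [2 e i >= (A e) i + e j > 0]. *)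
Lemma lift_key p e i : i \in val p -> (forall k, 0 <= e k) ->
  (forall j, inner_nb a p i j -> 0 <= \sum_k a j k * e k) ->
  0 < \sum_(j | inner_nb a p i j) \sum_k a j k * e k -> 0 < e i.
Proof.
move=> ip e0 Ae0.
have le2 j : \sum_k a j k * e k <= 2 * e j.
  rewrite (bigD1 j) //= (cl_diag ca) gerDl sumr_le0 // => k nkj.
  rewrite eq_sym in nkj; have [->|->] := cl_off ca nkj; first by rewrite mul0r.
  by rewrite mulN1r oppr_le0.
have [[_ ->]|[_ [j [jp nji aij nbi nbj]]]] := orbit_structure ca hs ip.
  by have := le2 i; lia.
have nij : inner_nb a p i j by rewrite /inner_nb jp aij.
have := Ae0 _ (inner_nb_refl ca ip); have := Ae0 _ nij; rewrite nbi.
have le2' : \sum_k a i k * e k <= 2 * e i - e j.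
  rewrite (bigD1 i) //= (bigD1 j) //= (cl_diag ca) aij mulN1r addrA gerDl.
  rewrite sumr_le0 // => k /andP[nki _].
  rewrite eq_sym in nki; have [->|->] := cl_off ca nki; first by rewrite mul0r.
  by rewrite mulN1r oppr_le0.
by have := le2 j; lia.
Qed.

Lemma sub_wval d e i : \sum_k a i k * (e k - d k) = wv d i - wv e i.
Proof.
rewrite /wval opprB addrC addrA subrK -sumrB.
by apply: eq_bigr => k _; rewrite mulrBr.
Qed.

(** Lifting property of the Bruhat order: a reflection that moves both weights
    the same way, or the two away from each other, preserves their order. The
    coordinate [i] could only fail when the coefficients that are subtracted
    differ by 1, and then [lift_key] shows that there was room. *)
Lemma fold_move_mono p d e : fixed_orb d -> fixed_orb e -> (forall i, d i <= e i) ->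
  fold_value p d <= 0 \/ 0 <= fold_value p e -> forall i, fold_move p d i <= fold_move p e i.
Proof.
move=> hd he le_de sgn i; rewrite /fold_move; case: ifP => ip; last by rewrite !addr0.
have td := tau_bound (fixed_orb_orb hd) ip; have te := tau_bound (fixed_orb_orb he) ip.
have nbp j : inner_nb a p i j -> j \in val p by case/andP.
have le_tau (f : 'I_n -> int) : fixed_orb f -> fold_value p f <= 0 -> tau a p (wv f) i <= 0.
  by move=> hf f0; apply: sumr_le0 => j /nbp; apply: fold_value_le0.
have ge_tau (f : 'I_n -> int) : fixed_orb f -> 0 <= fold_value p f -> 0 <= tau a p (wv f) i.
  by move=> hf f0; apply: sumr_ge0 => j /nbp; apply: fold_value_ge0.
have [le_t|lt_t] := lerP (tau a p (wv d) i) (tau a p (wv e) i).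
  by have := le_de i; lia.
suff : 0 < e i - d i.
  have := le_de i; case: sgn => [/(le_tau _ hd)|/(ge_tau _ he)]; lia.
apply: (@lift_key p (fun k => e k - d k)) => // [k|j nbj|].
- by rewrite subr_ge0.
- rewrite sub_wval subr_ge0; have jp := nbp j nbj.
  have [ge_d|lt_d] := lerP 0 (fold_value p d); last first.
    have d0 := le_tau _ hd (ltW lt_d).
    have [ge_e|lt_e] := lerP 0 (fold_value p e); first by have := ge_tau _ he ge_e; lia.
    have td0 : tau a p (wv d) i = 0 by lia.
    have : \sum_(k | inner_nb a p i k) - wv d k == 0 by rewrite sumrN -/(tau _ _ _ _) td0 oppr0.
    rewrite psumr_eq0 => [|k /nbp kp]; last first.
      by rewrite oppr_ge0; apply: fold_value_le0 (ltW lt_d) kp.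
    move/allP/(_ j (mem_index_enum j)); rewrite nbj /= oppr_eq0 => /eqP->.
    exact: (fold_value_le0 he (ltW lt_e) jp).
  have wdj := fold_value_ge0 hd ge_d jp.
  have [le_e|gt_e] := lerP (fold_value p e) 0.
    exact: le_trans (fold_value_le0 he le_e jp) wdj.
  have e0 := ge_tau _ he (ltW gt_e); have te0 : tau a p (wv e) i = 0 by lia.
  have : \sum_(k | inner_nb a p i k) wv e k == 0 by rewrite -/(tau _ _ _ _) te0.
  rewrite psumr_eq0 => [|k /nbp kp]; last exact: fold_value_ge0 (ltW gt_e) kp.
  by move/allP/(_ j (mem_index_enum j)); rewrite nbj /= => /eqP->.
- rewrite (eq_bigr (fun j => wv d j - wv e j)) => [|j _]; last exact: sub_wval.
  by rewrite sumrB subr_gt0.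
Qed.

(** Lifting property for a reflection that moves the two weights towards each
    other: it may be applied to one of them. *)
Lemma fold_move_lift p d e : fixed_orb d -> fixed_orb e -> (forall i, d i <= e i) ->
  0 <= fold_value p d -> fold_value p e <= 0 -> forall i, d i <= fold_move p e i.
Proof.
move=> hd he le_de d0 e0 i; rewrite /fold_move; case: ifP => ip; last by rewrite addr0.
have te := tau_bound (fixed_orb_orb he) ip.
have nbp j : inner_nb a p i j -> j \in val p by case/andP.
have [t0|lt_t] := lerP 0 (tau a p (wv e) i); first by have := le_de i; lia.
suff : 0 < e i - d i by lia.
apply: (@lift_key p (fun k => e k - d k)) => // [k|j nbj|].
- by rewrite subr_ge0.
- rewrite sub_wval subr_ge0; have jp := nbp j nbj.
  exact: le_trans (fold_value_le0 he e0 jp) (fold_value_ge0 hd d0 jp).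
- rewrite (eq_bigr (fun j => wv d j - wv e j)) => [|j _]; last exact: sub_wval.
  rewrite sumrB subr_gt0 (lt_le_trans lt_t) // sumr_ge0 // => j /nbp.
  exact: fold_value_ge0.
Qed.

(** Inside the parabolic subgroup attached to [p], the weights of the orbit
    lying below the one of [d] are bounded by its image under the reflection. *)
Lemma fold_move_max p d e : fixed_orb d -> orb e -> (forall k, k \notin val p -> d k = e k) ->
  (forall k, d k <= e k) -> 0 <= fold_value p d -> forall i, e i <= fold_move p d i.
Proof.
move=> hd oe eq_de le_de d0 i; rewrite /fold_move.
case: ifPn => [ip|/eq_de->]; last by rewrite addr0.
have := wval_diff eq_de ip; have := orb_wval la_lam la_min i oe.
have := fold_value_ge0 hd d0 ip; have := le_de i; rewrite /tau.
have := orb_wval la_lam la_min i (fixed_orb_orb hd).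
have [[_ nbi]|[_ [j [jp _ aij nbi nbj]]]] := orbit_structure ca hs ip.
  by rewrite !nbi (cl_diag ca); lia.
have aji : a j i = -1 by rewrite (cl_sym ca).
have := wval_diff eq_de jp; have := orb_wval la_lam la_min j oe.
have := fold_value_ge0 hd d0 jp; have := le_de j.
have := orb_adjacent (fixed_orb_orb hd) aij; have := orb_adjacent oe aij.
by rewrite !nbi !nbj !(cl_diag ca) aij aji; lia.
Qed.

Lemma fold_move_trivial_below p d e : fixed_orb d -> orb e ->
  (forall k, k \notin val p -> d k = e k) ->
  (forall k, d k <= e k) -> fold_value p d <= 0 -> forall i, e i = d i.
Proof.
move=> hd oe eq_de le_de d0 i; have [ip|/eq_de->//] := boolP (i \in val p).
have := wval_diff eq_de ip; have := orb_wval la_lam la_min i oe.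
have := fold_value_le0 hd d0 ip; have := le_de i.
have [[_ nbi]|[_ [j [jp _ aij nbi nbj]]]] := orbit_structure ca hs ip.
  by rewrite !nbi (cl_diag ca); lia.
have aji : a j i = -1 by rewrite (cl_sym ca).
have := wval_diff eq_de jp; have := orb_wval la_lam la_min j oe.
have := fold_value_le0 hd d0 jp; have := le_de j.
have := orb_adjacent (fixed_orb_orb hd) aij; have := orb_adjacent oe aij.
by rewrite !nbi !nbj !(cl_diag ca) aij aji; lia.
Qed.

Lemma fold_move_trivial_above p d e : fixed_orb d -> orb e ->
  (forall k, k \notin val p -> d k = e k) ->
  (forall k, e k <= d k) -> 0 <= fold_value p d -> forall i, e i = d i.
Proof.
move=> hd oe eq_de le_de d0 i; have [ip|/eq_de->//] := boolP (i \in val p).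
have := wval_diff eq_de ip; have := orb_wval la_lam la_min i oe.
have := fold_value_ge0 hd d0 ip; have := le_de i.
have [[_ nbi]|[_ [j [jp _ aij nbi nbj]]]] := orbit_structure ca hs ip.
  by rewrite !nbi (cl_diag ca); lia.
have aji : a j i = -1 by rewrite (cl_sym ca).
have := wval_diff eq_de jp; have := orb_wval la_lam la_min j oe.
have := fold_value_ge0 hd d0 jp; have := le_de j.
have := orb_adjacent (fixed_orb_orb hd) aij; have := orb_adjacent oe aij.
by rewrite !nbi !nbj !(cl_diag ca) aij aji; lia.
Qed.

End Lifting.

(** * Weights and order filters *)

Section Filters.
Variables (K : numFieldType) (n : nat) (a : 'I_n -> 'I_n -> int).
Variables (g : lie_alg K) (S : chevalley a g).
Hypothesis ca : cartan_like a.
Variables (la : weight (datum S)) (lam : 'I_n -> int).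
Hypotheses (la_lam : forall i, ev la (ch S i) = (lam i)%:~R)
  (lam_ge0 : forall i, 0 <= lam i) (la_min : minuscule la).
Variables (disp : Order.disp_t) (P : finPOrderType disp) (kappa : P -> 'I_n).
Variable f : weight (datum S) -> {set P}.
Hypothesis hf : @colored_iso K g (datum S) la disp P kappa f.
Implicit Types (d e : 'I_n -> int).

Local Notation wv := (wval a lam).
Local Notation orb := (@orb K n a g S la).
Local Notation wt := (wt la).

Definition filt d : {set P} := f (wt d).

Lemma eq_filt d e : d =1 e -> filt d = filt e.
Proof. by move=> eq_de; rewrite /filt (eq_wt _ eq_de). Qed.

Lemma filt_filter d : orb d -> order_filter (filt d).
Proof. by have [[fA _ _ _] _] := hf; apply: fA. Qed.

Lemma filt_subP d e : orb d -> orb e -> filt d \subset filt e <-> forall i, d i <= e i.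
Proof.
move=> od oe; have [[_ _ _ /(_ _ _ od oe) fle] _] := hf.
split=> [/fle|le_de]; first exact: (le_s_wt_ge ca la_lam).
by apply/fle; apply: (ge_le_s ca la_lam la_min).
Qed.

Lemma filt_inj d e : orb d -> orb e -> filt d = filt e -> d =1 e.
Proof. by move=> od oe; have [[_ fI _ _] _] := hf => /(fI _ _ od oe); apply: wt_inj. Qed.

Lemma filt_surj F : order_filter F -> exists2 d, orb d & filt d = F.
Proof.
have [[_ _ fS _] _] := hf => /fS[mu omu def_F].
have [d def_mu _] := orb_form ca la_lam omu.
by rewrite def_mu in omu def_F; exists d.
Qed.

Lemma order_filter0 : order_filter (set0 : {set P}).
Proof. by apply/forallP => x; apply/forallP => y; rewrite inE. Qed.

Lemma order_filterU (F G : {set P}) :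
  order_filter F -> order_filter G -> order_filter (F :|: G).
Proof.
move=> /forallP oF /forallP oG; apply/forallP => x; apply/forallP => y.
have /forallP/(_ y) := oF x; have /forallP/(_ y) := oG x; rewrite !inE.
by do 2?[case: (x \in _); case: (y \in _)] => //=; case: (x <= y)%O.
Qed.

Lemma order_filterI (F G : {set P}) :
  order_filter F -> order_filter G -> order_filter (F :&: G).
Proof.
move=> /forallP oF /forallP oG; apply/forallP => x; apply/forallP => y.
have /forallP/(_ y) := oF x; have /forallP/(_ y) := oG x; rewrite !inE.
by do 2?[case: (x \in _); case: (y \in _)] => //=; case: (x <= y)%O.
Qed.

(** If [la - v] is dominant, of the norm of [la], with [v >= 0], then the pairing
    of [v] with [la] and with [la - v] is nonnegative, while the two pairings are
    opposite. *)
Lemma dominant_eq0 d : (forall i, 0 <= wv d i) -> (forall i, 0 <= d i) ->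
  \sum_i \sum_j a i j * (d i * d j) = 2 * \sum_i lam i * d i -> forall i, d i = 0.
Proof.
move=> w0 d0 qd i; apply/eqP; apply: contraT => di.
have := cl_pos_int ca (ex_intro (fun i => d i != 0) i di).
have : 0 <= \sum_i wv d i * d i by apply: sumr_ge0 => k _; rewrite mulr_ge0.
have : 0 <= \sum_i lam i * d i by apply: sumr_ge0 => k _; rewrite mulr_ge0.
rewrite (_ : \sum_i wv d i * d i = \sum_i lam i * d i - \sum_i \sum_j a i j * (d i * d j)).
  by rewrite qd; lia.
rewrite -sumrB; apply: eq_bigr => k _; rewrite /wval mulrBl; congr (_ - _).
by rewrite mulr_suml; apply: eq_bigr => j _; ring.
Qed.

(** The empty filter corresponds to the least weight [la - sum d0], with
    [d0 <= 0]; comparing the norms of two weights of the orbit gives [d0 = 0]. *)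
Lemma filt0 : filt (fun=> 0) = set0.
Proof.
have [d od def0] := filt_surj order_filter0.
have le_d0 : forall i, d i <= 0.
  by apply/(filt_subP od (orb0 la)); rewrite def0 sub0set.
rewrite -def0; apply: eq_filt => i; apply/eqP; rewrite eq_sym; apply: contraT => di.
have := cl_pos_int ca (ex_intro (fun i => d i != 0) i di).
rewrite (orb_form_wt ca la_lam od).
suff : \sum_i lam i * d i <= 0 by lia.
by apply: sumr_le0 => k _; rewrite mulr_ge0_le0.
Qed.

Lemma orb_ge0 d i : orb d -> 0 <= d i.
Proof. by move=> od; move: i; apply/(filt_subP (orb0 la) od); rewrite filt0 sub0set. Qed.

Lemma orb_dominant d : orb d -> (forall i, 0 <= wv d i) -> forall i, d i = 0.
Proof.
move=> od w0; apply: dominant_eq0 => // [i|]; first exact: orb_ge0.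
exact: (orb_form_wt ca la_lam od).
Qed.

(** The weight [la - d - alpha_i] covers [la - d] since nothing fits between them
    in the root order; the colouring then names the element that is added. *)
Lemma filt_step d i : orb d -> wv d i = 1 ->
  exists u, [/\ kappa u = i, u \notin filt d & filt (add_simple d i 1) = u |: filt d].
Proof.
move=> od wi; have [[_ fI _ fle] /(_ (wt d) i od) [cov_f _]] := hf.
have od1 : orb (add_simple d i 1) by rewrite -wi; apply: orb_refl.
have le1 k : d k <= add_simple d i 1 k by rewrite /add_simple mulr1; lia.
have def1 : @simple_refl K g (datum S) i (wt d) = wt (add_simple d i 1).
  by rewrite (simple_refl_wt la_lam) wi.
have [|u def_u ku] := cov_f.
  rewrite def1; split=> //.
  - by apply: (ge_le_s ca la_lam la_min).
  - by move=> /(wt_inj ca)/(_ i); rewrite /add_simple eqxx mul1r; lia.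
  move=> z oz; have [e def_z _] := orb_form ca la_lam oz.
  rewrite def_z => /(le_s_wt_ge ca la_lam) le_de /(le_s_wt_ge ca la_lam) le_ed.
  have out k : k != i -> e k = d k.
    by move=> /negPf nki; have := le_de k; have := le_ed k; rewrite /add_simple nki; lia.
  have [ei|ni] := eqVneq (e i) (d i).
    left; apply: eq_wt => k; have [->//|] := eqVneq k i; exact: out.
  right; apply: eq_wt => k; rewrite /add_simple; have [->|nki] := eqVneq k i.
    by have := le_de i; have := le_ed i; rewrite /add_simple eqxx; lia.
  by rewrite (out k nki) mul0r addr0.
move: def_u; rewrite def1 -/(filt _) -/(filt _) => def_u.
have sub1 : filt d \subset filt (add_simple d i 1) by apply/filt_subP.
have := set11 u; rewrite -def_u inE => /andP[nu u1].
exists u; split=> //; apply/setP => x; rewrite !inE.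
have [xd|xd] := boolP (x \in filt d); first by rewrite (subsetP sub1) // orbT.
by rewrite orbF -in_set1 -def_u inE xd.
Qed.

(** By induction along simple reflections that lead down to a dominant weight,
    which can only be [la]: each of them accounts for one element. *)
Lemma card_filt d i : orb d -> #|[set u in filt d | kappa u == i]|%:Z = d i.
Proof.
have [k] := ubnP `|(\sum_j d j)%R|%N; elim: k d => // k IHk d lt_k od.
have [/forallP w0|/forallPn[j]] := boolP [forall j, 0 <= wv d j].
  have d0 := orb_dominant od w0.
  rewrite (@eq_filt d (fun=> 0)) // filt0 d0 (_ : [set u in _ | _] = set0) ?cards0 //.
  by apply/setP => u; rewrite !inE.
rewrite -ltNge => wj; have wj1 : wv d j = -1.
  by have := orb_wval la_lam la_min j od; lia.
pose e := add_simple d j (-1); have oe : orb e by rewrite /e -wj1; apply: orb_refl.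
have we : wv e j = 1 by rewrite wval_add_simple wj1 (cl_diag ca).
have de : d =1 add_simple e j 1 by move=> l; rewrite /e /add_simple; lia.
have [u [ku nu def_u]] := filt_step oe we.
rewrite (eq_filt de) def_u.
have lt_e : (`|(\sum_l e l)%R| < k)%N.
  rewrite /e /add_simple big_split /= [X in _ + X](_ : _ = -1) => [|]; last first.
    by rewrite (bigD1 j) //= eqxx big1 ?addr0 // => l /negPf->.
  have : 0 < \sum_l d l.
    rewrite (bigD1 j) //= ltr_pwDl ?sumr_ge0 // => [|l _]; last exact: orb_ge0.
    by have := orb_ge0 j oe; rewrite /e /add_simple eqxx; lia.
  by move: lt_k; move: (\sum_l d l) => X; clear; lia.
have := IHk e lt_e oe; rewrite (de i) [add_simple e j 1 i]/add_simple => <-.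
rewrite eq_sym -ku; have [eq_u|ne_u] := eqVneq (kappa u) i.
  rewrite (_ : [set _ in _ | _] = u |: [set v in filt e | kappa v == i]).
    by rewrite cardsU1 inE (negPf nu) /=; lia.
  apply/setP => v; rewrite !inE; have [->|] := eqVneq v u; first by rewrite eq_u eqxx.
  by [].
rewrite (_ : [set _ in _ | _] = [set v in filt e | kappa v == i]); first by lia.
apply/setP => v; rewrite !inE; have [->|] := eqVneq v u; last by [].
by rewrite (negPf ne_u) !andbF.
Qed.

(** Condition on colours under which [fold_add] and [fold_rem] collect filters,
    read on the coordinates. *)
Lemma filt_color_diff (C : {set 'I_n}) d e : orb d -> orb e ->
  (forall i, d i <= e i) ->
  filt e :\: filt d \subset kappa @^-1: C <-> forall i, i \notin C -> d i = e i.
Proof.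
move=> od oe le_de; have sub_de : filt d \subset filt e by apply/filt_subP.
pose part e i := [set u in filt e | kappa u == i].
have subp i : part d i \subset part e i.
  by apply/subsetP => u; rewrite !inE => /andP[/(subsetP sub_de)->].
split=> [/subsetP col i iC|eq_de].
  rewrite -(card_filt i od) -(card_filt i oe); congr (Posz #|pred_of_set _|).
  apply/eqP; rewrite eqEsubset subp /=; apply/subsetP => u; rewrite !inE.
  case/andP=> ue /eqP ku; rewrite ku eqxx andbT; apply: contraNT iC => ud.
  by have := col u; rewrite !inE ud ue ku; apply.
apply/subsetP => u; rewrite !inE => /andP[nud ue]; apply: contraT => nC.
have : part d (kappa u) = part e (kappa u).
  apply/eqP; rewrite eqEcard subp /=.
  by rewrite -lez_nat (card_filt _ od) (card_filt _ oe) eq_de.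
by move/setP/(_ u); rewrite !inE eqxx !andbT ue (negPf nud).
Qed.

End Filters.

(** * The weak order *)

Section WeakOrder.
Variables (K : numFieldType) (n : nat) (a : 'I_n -> 'I_n -> int).
Variables (g : lie_alg K) (S : chevalley a g).
Hypothesis ca : cartan_like a.
Variables (s : {perm 'I_n}) (sg : 'End(g)).
Hypotheses (hs : diagram_aut a s) (hsg : lifts_diagram_aut S s sg).
Variables (la : weight (datum S)) (lam : 'I_n -> int).
Hypotheses (la_lam : forall i, ev la (ch S i) = (lam i)%:~R)
  (lam_ge0 : forall i, 0 <= lam i) (la_min : minuscule la).
Variables (disp : Order.disp_t) (P : finPOrderType disp) (kappa : P -> 'I_n).
Variable f : weight (datum S) -> {set P}.
Hypothesis hf : @colored_iso K g (datum S) la disp P kappa f.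
Variable ft : weight (fold_datum S s sg) -> {set P}.
Hypothesis hft : forall w, weyl_fixed sg w -> ft (res s (w la)) = f (w la).
Implicit Types (d e : 'I_n -> int) (p : sigma_orbit s).

Local Notation wv := (wval a lam).
Local Notation orb := (@orb K n a g S la).
Local Notation wt := (wt la).
Local Notation fixed_orb := (@fixed_orb K n a g S sg la).
Local Notation fold_move := (fold_move a lam).
Local Notation fold_value := (@fold_value n a s lam).
Local Notation filt := (filt la f).
Local Notation col := (fold_color s kappa).
Local Notation FD := (fold_datum S s sg).
Local Notation fw d := (fres s sg (wt d)).

Lemma fold_color_preim p : col @^-1: [set p] = kappa @^-1: val p.
Proof. by apply/setP => u; rewrite !inE mem_sigma_orbit. Qed.

(** A filter [F] with the prescribed colours outside [filt d] may be replaced by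
    its union with [filt d], which belongs to a weight comparable with [d]. *)
Lemma fold_add_bound p d (B : {set P}) : orb d ->
  (forall e, orb e -> (forall k, k \notin val p -> d k = e k) ->
     (forall k, d k <= e k) -> filt e \subset B) ->
  fold_add col p (filt d) \subset B.
Proof.
move=> od bound; apply/bigcupsP => F /andP[oF]; rewrite fold_color_preim => colF.
have oFU := order_filterU oF (filt_filter hf od).
have [e oe def_e] := filt_surj ca la_lam hf oFU.
have le_de : forall k, d k <= e k.
  by apply/(filt_subP ca la_lam la_min hf od oe); rewrite def_e subsetUr.
apply: subset_trans (bound e oe _ le_de); first by rewrite def_e subsetUl.
apply/(filt_color_diff ca la_lam lam_ge0 la_min hf _ od oe le_de).
by rewrite def_e setDUl setDv setU0.
Qed.

Lemma fold_add_sup p d e : orb d -> orb e ->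
  (forall k, k \notin val p -> d k = e k) -> (forall k, d k <= e k) ->
  filt e \subset fold_add col p (filt d).
Proof.
move=> od oe eq_de le_de; apply: (bigcup_sup (filt e)).
rewrite (filt_filter hf oe) fold_color_preim.
by apply/(filt_color_diff ca la_lam lam_ge0 la_min hf _ od oe le_de).
Qed.

Lemma fold_rem_sub p d : orb d -> fold_rem col p (filt d) \subset filt d.
Proof.
move=> od; apply: bigcap_inf.
by rewrite (filt_filter hf od) setDv sub0set.
Qed.

Lemma fold_rem_id p d : orb d ->
  (forall e, orb e -> (forall k, k \notin val p -> d k = e k) ->
     (forall k, e k <= d k) -> forall k, e k = d k) ->
  fold_rem col p (filt d) = filt d.
Proof.
move=> od triv; apply/eqP; rewrite eqEsubset fold_rem_sub //.
apply/bigcapsP => F /andP[oF]; rewrite fold_color_preim => colF.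
have oFI := order_filterI oF (filt_filter hf od).
have [e oe def_e] := filt_surj ca la_lam hf oFI.
have le_ed : forall k, e k <= d k.
  by apply/(filt_subP ca la_lam la_min hf oe od); rewrite def_e subsetIr.
rewrite -(eq_filt la f (triv e oe _ le_ed)) ?def_e ?subsetIl // => k kp.
apply/esym; move: k kp.
apply/(filt_color_diff ca la_lam lam_ge0 la_min hf _ oe od le_ed).
by rewrite def_e setDIr setDv setU0.
Qed.

(** The image under the folded reflection is the largest filter that [fold_add]
    collects, while [fold_rem] removes nothing. *)
Lemma fold_S_up p d : fixed_orb d -> 0 < fold_value p d ->
  fold_S col p (filt d) = filt (fold_move p d) /\ filt d \proper filt (fold_move p d).
Proof.
move=> hd t0; have od := fixed_orb_orb hd; have t_ge0 := ltW t0.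
have ht := fixed_orb_move ca hs hsg la_lam p hd; have ot := fixed_orb_orb ht.
have nbp i j : inner_nb a p i j -> j \in val p by case/andP.
have le_t : forall k, d k <= fold_move p d k.
  move=> k; rewrite fold_moveE; case: ifP => _; last by rewrite addr0.
  by rewrite lerDl sumr_ge0 // => j /nbp; apply: (fold_value_ge0 ca hsg la_lam lam_ge0).
have sub_t : filt d \subset filt (fold_move p d).
  by apply/(filt_subP ca la_lam la_min hf od ot).
have addE : fold_add col p (filt d) = filt (fold_move p d).
  apply/eqP; rewrite eqEsubset (fold_add_sup (p := p) od ot) ?andbT //.
    apply: fold_add_bound => // e oe eq_de le_de.
    apply/(filt_subP ca la_lam la_min hf oe ot).
    exact: (fold_move_max ca hs hsg la_lam lam_ge0 la_min).
  exact: fold_move_out.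
have remE : fold_rem col p (filt d) = filt d.
  apply: fold_rem_id => // e oe eq_de le_ed.
  exact: (fold_move_trivial_above ca hs hsg la_lam lam_ge0 la_min hd oe eq_de).
split.
  rewrite /fold_S addE remE setDE setUIl setUC (setUidPr _) // setUC setUCr setIT.
  by rewrite (filt_filter hf ot).
rewrite properEneq sub_t andbT; apply: contraTneq t0 => eq_f.
have eq_d := filt_inj ca hf od ot eq_f.
have := fold_value_fold_move ca hs lam p d.
rewrite (_ : fold_value p (fold_move p d) = fold_value p d); first by lia.
apply: eq_bigr => i _; rewrite /wval; congr (_ - _).
by apply: eq_bigr => j _; rewrite -eq_d.
Qed.

(** Nothing can be added, so the result is contained in the original filter. *)
Lemma fold_S_not_up p d : fixed_orb d -> fold_value p d <= 0 ->
  ~~ (filt d \proper fold_S col p (filt d)).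
Proof.
move=> hd t0; have od := fixed_orb_orb hd.
have addE : fold_add col p (filt d) \subset filt d.
  apply: fold_add_bound => // e oe eq_de le_de.
  apply/(filt_subP ca la_lam la_min hf oe od) => k.
  by rewrite (fold_move_trivial_below ca hs hsg la_lam lam_ge0 la_min hd oe eq_de).
rewrite properE negb_and negbK; apply/orP; right; rewrite /fold_S.
case: ifP => // _; rewrite subUset fold_rem_sub // andbT.
by rewrite subDset setUid.
Qed.

(** Closure of [la] under the lifted reflections; restriction maps these weights
    onto the orbit of [W~], and norms will be computed by induction on them. *)
Inductive fold_orb : ('I_n -> int) -> Prop :=
| fold_orb0 : fold_orb (fun=> 0)
| fold_orb_move p d : fold_orb d -> fold_orb (fold_move p d).

Lemma fold_orb_fixed d : fold_orb d -> fixed_orb d.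
Proof.
by elim=> [|p {}d _ hd]; [exact: (fixed_orb0 hsg) | apply: (fixed_orb_move ca hs hsg la_lam)].
Qed.

Lemma fold_orb_orbit d : fold_orb d -> weyl_orbit (fres s sg la) (fw d).
Proof.
elim=> [|p {}d _ IH]; first by rewrite wt0; apply: weyl_orbit_id.
by rewrite (fres_fold_move ca sg hs la_lam); apply: weyl_orbit_refl.
Qed.

Lemma orbit_fold_orb nu : weyl_orbit (fres s sg la) nu -> exists2 d, fold_orb d & nu = fw d.
Proof.
move: nu; apply: weyl_orbit_ind => [|p _ [d gd ->]].
  by exists (fun=> 0); [exact: fold_orb0 | rewrite wt0].
by exists (fold_move p d); [exact: fold_orb_move | rewrite (fres_fold_move ca sg hs la_lam)].
Qed.

Lemma ft_fres d : fixed_orb d -> ft (fw d) = filt d.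
Proof. by case=> w ww def_d; rewrite -[RHS]/(f (wt d)) def_d -hft. Qed.

Lemma fres_inj d e : fixed_orb d -> fixed_orb e -> fw d = fw e -> d =1 e.
Proof.
move=> hd he eq_de; apply: (filt_inj ca hf (fixed_orb_orb hd) (fixed_orb_orb he)).
by rewrite -!ft_fres // eq_de.
Qed.

Lemma ev_fw_gt0 p d : (0 < ev (fw d) (fold_coroot S p)) = (0 < fold_value p d).
Proof.
by rewrite (ev_fres_wt sg la_lam) pmulr_rgt0 ?ltr0z // ltr0n eps_gt0.
Qed.

Let rla : weight FD := res s la.
Let imft (F : {set P}) := exists2 nu, weyl_orbit rla nu & ft nu = F.

(** Every weight of the folded orbit lifts to [W^ la], where [f] is injective. *)
Lemma ft_inj nu nu' : weyl_orbit rla nu -> weyl_orbit rla nu' ->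
  ft nu = ft nu' -> nu = nu'.
Proof.
move=> /orbit_fold_orb[d /fold_orb_fixed hd ->] /orbit_fold_orb[e /fold_orb_fixed he ->].
rewrite !ft_fres // => /(filt_inj ca hf (fixed_orb_orb hd) (fixed_orb_orb he)) eq_de.
by rewrite (eq_wt la eq_de).
Qed.

(** Chains correspond step by step; on the side of filters, a chain that starts in
    the image of [ft] stays in it. *)
Lemma weak_order_iso : poset_iso (weyl_orbit rla) (le_w rla) imft (fold_le col) ft.
Proof.
split=> [nu onu|||nu nu' onu onu']; first by exists nu.
- exact: ft_inj.
- by move=> _ [nu onu <-]; exists nu.
split.
  move=> le_nu; pose R nu nu' := fold_le col (ft nu) (ft nu').
  apply: (@chain_in_ind _ _ _ R _ _ _ _ le_nu) => [x ox|x y z ox oy oz [p [xy x0]]].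
    have [d /fold_orb_fixed hd ->] := orbit_fold_orb ox.
    by rewrite /R ft_fres //; apply/chain_in_refl/(filt_filter hf (fixed_orb_orb hd)).
  have [d gd def_x] := orbit_fold_orb ox; have hd := fold_orb_fixed gd.
  rewrite def_x in x0 xy *; rewrite ev_fw_gt0 in x0.
  have ht := fixed_orb_move ca hs hsg la_lam p hd.
  rewrite -xy -(fres_fold_move ca sg hs la_lam) /R (ft_fres hd) (ft_fres ht).
  have [S_up lt_up] := fold_S_up hd x0.
  apply: chain_in_cons; first exact: (filt_filter hf (fixed_orb_orb hd)).
  by exists p.
move=> le_F; pose R F F' := forall nu nu', weyl_orbit rla nu -> weyl_orbit rla nu' ->
  ft nu = F -> ft nu' = F' -> le_w rla nu nu'.
suff: R (ft nu) (ft nu') by apply.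
apply: (@chain_in_ind _ _ _ R _ _ _ _ le_F) => [F _ x y ox oy <-|].
  by move=> /(ft_inj oy ox) ->; apply: chain_in_refl.
move=> F G G' _ _ _ [p [S_F lt_F]] IH x y ox oy def_F def_G.
have [d gd def_x] := orbit_fold_orb ox; have hd := fold_orb_fixed gd.
rewrite -def_F def_x (ft_fres hd) in S_F lt_F.
have [t0|t0] := lerP (fold_value p d) 0.
  by have := fold_S_not_up hd t0; rewrite S_F lt_F.
have [S_up _] := fold_S_up hd t0.
apply: (@chain_in_cons _ _ _ _ (fw (fold_move p d))) => //.
  exists p; rewrite def_x ev_fw_gt0 t0 (fres_fold_move ca sg hs la_lam); split=> //.
apply: IH => //; first exact/fold_orb_orbit/fold_orb_move.
by rewrite (ft_fres (fixed_orb_move ca hs hsg la_lam p hd)) -S_up.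
Qed.

End WeakOrder.

(** * The norm of an averaged weight *)

Section AveragedNorm.
Variables (n : nat) (a : 'I_n -> 'I_n -> int) (s : {perm 'I_n}).
Hypotheses (ca : cartan_like a) (hs : diagram_aut a s).
Variable lam : 'I_n -> int.
Implicit Types (d : 'I_n -> int) (p q : sigma_orbit s).

Definition orbsum d p : int := \sum_(i in val p) d i.

(** The vector with the orbit sums of [d] that is fixed by the automorphism; it
    stands for the restriction of the weight to [h(0)]. *)
Definition orbit_average d (i : 'I_n) : rat :=
  (orbsum d (orbit_of s i))%:~R / #|val (orbit_of s i)|%:R.

(** [|la - y| ^ 2 - |la| ^ 2] for the invariant form. *)
Definition rel_norm (y : 'I_n -> rat) : rat :=
  \sum_i \sum_j (a i j)%:~R * (y i * y j) - 2 * \sum_i (lam i)%:~R * y i.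

Local Notation av := orbit_average.

Lemma card_orbit_gt0 p : 0 < #|val p|%:R :> rat.
Proof. by rewrite ltr0n; apply/card_gt0P; apply: orbit_nonempty. Qed.

Lemma averageE d p i : i \in val p -> av d i = (orbsum d p)%:~R / #|val p|%:R.
Proof. by rewrite mem_sigma_orbit /orbit_average => /eqP->. Qed.

(** The Cartan matrix commutes with averaging over orbits. *)
Lemma average_rows d p :
  \sum_(i in val p) \sum_j (a i j)%:~R * av d j =
  (\sum_(i in val p) \sum_j a i j * d j)%:~R.
Proof.
rewrite exchange_big [in RHS]exchange_big /= rmorph_sum /=.
rewrite (sum_orbits s) [RHS](sum_orbits s); apply: eq_bigr => q _.
have [k kq] := orbit_nonempty q.
have colE j : j \in val q -> \sum_(i in val p) a i j = \sum_(i in val p) a i k.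
  move=> jq; have [m ->] := orbit_expgP kq jq.
  rewrite (reindex_inj (@perm_inj _ (s ^+ m)%g)) /=; apply: eq_big => i.
    exact: orbit_of_expg_mem.
  by rewrite (diagram_aut_expg hs).
transitivity ((\sum_(i in val p) a i k)%:~R * (orbsum d q)%:~R : rat); last first.
  rewrite -rmorphM -rmorph_sum mulr_sumr; congr _%:~R; apply: eq_bigr => j jq.
  by rewrite -(colE j jq) mulr_suml.
rewrite (eq_bigr (fun=> (\sum_(i in val p) a i k)%:~R *
    ((orbsum d q)%:~R / #|val q|%:R))) => [|j jq].
  rewrite sumr_const -[LHS]mulr_natr -mulrA divfK // gt_eqF //.
  exact: card_orbit_gt0.
rewrite (averageE d jq) -mulr_suml; congr (_ * _).
by rewrite -(colE j jq) rmorph_sum.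
Qed.

(** The second factor vanishes exactly when the shift is that of the reflection
    attached to [p]. *)
Lemma rel_norm_shift d p m :
  rel_norm (fun i => av d i + (i \in val p)%:R * m) =
  rel_norm (av d) + m * (m * (#|val p|%:R * 2 / (eps a p)%:R)
    - 2 * (fold_value a lam p d)%:~R).
Proof.
have restrict (F : 'I_n -> rat) :
    \sum_i (i \in val p)%:R * m * F i = m * \sum_(i in val p) F i.
  rewrite [in RHS]big_mkcond mulr_sumr; apply: eq_bigr => i _.
  by case: ifP => _; rewrite ?mul1r // mul0r mulr0 mul0r.
rewrite /rel_norm (form_shift ca (av d)) restrict average_rows.
have -> : \sum_i \sum_j (a i j)%:~R * ((i \in val p)%:R * m * ((j \in val p)%:R * m))
    = m * (m * (#|val p|%:R * 2 / (eps a p)%:R)).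
  transitivity (\sum_i (i \in val p)%:R * m * (m * (2 / (eps a p)%:R))); last first.
    by rewrite restrict sumr_const -mulr_natr; ring.
  apply: eq_bigr => i _; case: (boolP (i \in val p)) => ip; last first.
    by rewrite !mul0r big1 // => j _; rewrite !mul0r mulr0.
  have <- : \sum_(j in val p) (a i j)%:~R = 2 / (eps a p)%:R :> rat.
    have -> : 2 = (2 : int)%:~R :> rat by [].
    rewrite -(eps_row ca hs ip) rmorphMn rmorph_sum /= -mulr_natr mulfK //.
    by rewrite pnatr_eq0 -lt0n eps_gt0.
  by rewrite !mul1r -restrict mulr_sumr; apply: eq_bigr => j _; ring.
have -> : \sum_i (lam i)%:~R * (av d i + (i \in val p)%:R * m) =
    \sum_i (lam i)%:~R * av d i + m * \sum_(i in val p) (lam i)%:~R.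
  rewrite -restrict -big_split; apply: eq_bigr => i _ /=; ring.
have -> : \sum_(i in val p) (lam i)%:~R = (\sum_(i in val p) lam i)%:~R :> rat.
  by rewrite rmorph_sum.
rewrite /fold_value /wval sumrB rmorphB /=; ring.
Qed.

Lemma orbsum_fold_move p d q :
  orbsum (fold_move a lam p d) q = orbsum d q + (fold_value a lam p d *+ eps a p) *+ (q == p).
Proof.
rewrite /orbsum; under eq_bigr do rewrite fold_moveE.
rewrite big_split /=; congr (_ + _); have [->|nqp] := eqVneq q p.
  rewrite mulr1n -(sum_tau ca hs); apply: eq_bigr => i ->; by [].
rewrite mulr0n big1 // => i iq; case: ifP => // ip.
by case/eqP: nqp; move: iq ip; rewrite !mem_sigma_orbit => /eqP<- /eqP<-.
Qed.

Lemma rel_norm_fold_move p d : rel_norm (av (fold_move a lam p d)) = rel_norm (av d).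
Proof.
have c0 := card_orbit_gt0 p; have e0 : 0 < (eps a p)%:R :> rat by rewrite ltr0n eps_gt0.
pose m : rat := (eps a p)%:R * (fold_value a lam p d)%:~R / #|val p|%:R.
transitivity (rel_norm (fun i => av d i + (i \in val p)%:R * m)); last first.
  rewrite rel_norm_shift (_ : _ - _ = 0) ?mulr0 ?addr0 // /m.
  by field; rewrite !gt_eqF.
have E i : av (fold_move a lam p d) i = av d i + (i \in val p)%:R * m.
  rewrite /orbit_average orbsum_fold_move mem_sigma_orbit; case: eqP => [->|_] /=.
    by rewrite mul1r rmorphD mulr1n rmorphMn /= -mulr_natl mulrDl.
  by rewrite mulr0n addr0 mul0r addr0.
rewrite /rel_norm; congr (_ - 2 * _); apply: eq_bigr => i _; last by rewrite E.
by apply: eq_bigr => j _; rewrite !E.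
Qed.

(** A line meets a sphere in at most two points, and the reflection attached to
    [p] exchanges them when the line has the direction of [p]. *)
Lemma rel_norm_reflect p d e : rel_norm (av d) = rel_norm (av e) ->
  (forall q, q != p -> orbsum d q = orbsum e q) -> orbsum d p != orbsum e p ->
  orbsum e p - orbsum d p = fold_value a lam p d *+ eps a p.
Proof.
move=> eq_n eq_q ne_p.
have c0 := card_orbit_gt0 p; have e0 : 0 < (eps a p)%:R :> rat by rewrite ltr0n eps_gt0.
pose m : rat := (orbsum e p - orbsum d p)%:~R / #|val p|%:R.
have m0 : m != 0.
  apply: mulf_neq0; last by rewrite invr_eq0 gt_eqF.
  by rewrite intr_eq0 subr_eq0 eq_sym.
have E i : av e i = av d i + (i \in val p)%:R * m.
  rewrite /orbit_average mem_sigma_orbit; have [->|nqp] := eqVneq (orbit_of s i) p.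
    by rewrite mul1r -mulrDl rmorphB addrC subrK.
  by rewrite -eq_q // mul0r addr0.
have : rel_norm (av e) = rel_norm (fun i => av d i + (i \in val p)%:R * m).
  rewrite /rel_norm; congr (_ - 2 * _); apply: eq_bigr => i _; last by rewrite E.
  by apply: eq_bigr => j _; rewrite !E.
rewrite rel_norm_shift eq_n => /esym/eqP; rewrite addrC -subr_eq0 addrK mulf_eq0.
rewrite (negPf m0) /= subr_eq0 => /eqP eq_m.
apply/eqP; rewrite -(eqr_int rat) rmorphMn /= -mulr_natr; apply/eqP.
have -> : (orbsum e p - orbsum d p)%:~R = m * #|val p|%:R :> rat.
  by rewrite divfK // gt_eqF.
have -> : (fold_value a lam p d)%:~R = m * (#|val p|%:R * 2 / (eps a p)%:R) / 2 :> rat.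
  by rewrite eq_m; field.
by field; rewrite gt_eqF.
Qed.

(** For the restriction of a positive combination of simple roots of [g], some
    simple root occurs in it and pairs positively with it. *)
Lemma fold_descent d : (forall p, 0 <= orbsum d p) -> (exists p, orbsum d p != 0) ->
  exists2 p, 0 < orbsum d p & 0 < \sum_(i in val p) \sum_j a i j * d j.
Proof.
move=> d0 [p dp].
have av0 i : 0 <= av d i by rewrite mulr_ge0 ?invr_ge0 ?ler0n ?ler0z.
have [i ip] := orbit_nonempty p.
have avi : av d i != 0.
  rewrite (averageE d ip) mulf_neq0 ?intr_eq0 // invr_eq0 gt_eqF //.
  exact: card_orbit_gt0.
have := cl_pos ca (ex_intro (fun i => av d i != 0) i avi).
move=> /descent_index[//|k avk rowk].
exists (orbit_of s k).
  move: avk; rewrite (averageE d (orbit_of_mem s k)) pmulr_lgt0 ?ltr0z //.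
  by rewrite invr_gt0 card_orbit_gt0.
rewrite -(ltr0z rat) -average_rows (eq_bigr (fun=> \sum_j (a k j)%:~R * av d j)).
  rewrite sumr_const pmulrn_lgt0 //; apply/card_gt0P; exact: orbit_nonempty.
move=> l lk; have [m ->] := orbit_expgP (orbit_of_mem s k) lk.
rewrite (reindex_inj (@perm_inj _ (s ^+ m)%g)) /=; apply: eq_bigr => j _.
by rewrite (diagram_aut_expg hs) /orbit_average orbit_of_expg.
Qed.

End AveragedNorm.

(** * The Bruhat order of the folded orbit *)

Section StrongOrder.
Variables (K : numFieldType) (n : nat) (a : 'I_n -> 'I_n -> int).
Variables (g : lie_alg K) (S : chevalley a g).
Hypothesis ca : cartan_like a.
Variables (s : {perm 'I_n}) (sg : 'End(g)).
Hypotheses (hs : diagram_aut a s) (hsg : lifts_diagram_aut S s sg).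
Variables (la : weight (datum S)) (lam : 'I_n -> int).
Hypotheses (la_lam : forall i, ev la (ch S i) = (lam i)%:~R)
  (lam_ge0 : forall i, 0 <= lam i) (la_min : minuscule la).
Variables (disp : Order.disp_t) (P : finPOrderType disp) (kappa : P -> 'I_n).
Variable f : weight (datum S) -> {set P}.
Hypothesis hf : @colored_iso K g (datum S) la disp P kappa f.
Variable ft : weight (fold_datum S s sg) -> {set P}.
Hypothesis hft : forall w, weyl_fixed sg w -> ft (res s (w la)) = f (w la).
Implicit Types (d e : 'I_n -> int) (p q : sigma_orbit s).

Local Notation wv := (wval a lam).
Local Notation orb := (@orb K n a g S la).
Local Notation wt := (wt la).
Local Notation fixed_orb := (@fixed_orb K n a g S sg la).
Local Notation fold_orb := (@fold_orb n a s lam).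
Local Notation fold_move := (fold_move a lam).
Local Notation fold_value := (@fold_value n a s lam).
Local Notation filt := (filt la f).
Local Notation FD := (fold_datum S s sg).
Local Notation fw d := (fres s sg (wt d)).
Local Notation H p := (fold_coroot S p).
Local Notation beta p := (beta S sg p).
Local Notation sr p := (@simple_refl K g FD p).

Let fixed_of d : fold_orb d -> fixed_orb d.
Proof. exact: (fold_orb_fixed ca hs hsg la_lam). Qed.

Let fsd : sl2_datum FD := fold_sl2 ca hs hsg.

Lemma fwB d e : fw d - fw e =
  \sum_(p : sigma_orbit s) (orbsum e p - orbsum d p)%:~R *: beta p.
Proof.
have -> : wt d = wt e - \sum_i (d i - e i)%:~R *: alpha S i.
  by rewrite -(wtB la) opprB addrCA subrr addr0.
rewrite (fres_sub sg hs) addrAC subrr add0r -sumrN; apply: eq_bigr => p _.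
rewrite -scaleNr; congr (_ *: _).
by rewrite -rmorph_sum -rmorphN /= sumrB opprB.
Qed.

Lemma fw_orbsum d e : @orbsum n s d =1 @orbsum n s e -> fw d = fw e.
Proof.
move=> eq_de; apply/eqP; rewrite -subr_eq0 fwB big1 // => p _.
by rewrite eq_de subrr scale0r.
Qed.

Lemma fold_orb_norm d : fold_orb d -> rel_norm a lam (orbit_average s d) = 0.
Proof.
elim=> [|p {}d _ IH]; last by rewrite rel_norm_fold_move.
have av0 i : orbit_average s (fun=> 0) i = 0.
  by rewrite /orbit_average /orbsum big1 // mul0r.
rewrite /rel_norm !big1 ?mulr0 ?subrr // => i _; first by rewrite av0 mulr0.
by rewrite big1 // => j _; rewrite !av0 !mulr0.
Qed.

Lemma fold_orb_reflect p d e : fold_orb d -> fold_orb e ->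
  (forall q, q != p -> orbsum d q = orbsum e q) -> orbsum d p != orbsum e p ->
  orbsum e p - orbsum d p = fold_value p d *+ eps a p /\ fw e = fw (fold_move p d).
Proof.
move=> gd ge eq_q ne_p.
have := rel_norm_reflect ca hs (etrans (fold_orb_norm gd) (esym (fold_orb_norm ge))) eq_q ne_p.
move=> eq_p; split=> //; apply: fw_orbsum => q; rewrite (orbsum_fold_move ca hs) -eq_p.
have [->|/eq_q->] := eqVneq q p; first by rewrite mulr1n addrC subrK.
by rewrite mulr0n addr0.
Qed.

Definition root_of (b : sigma_orbit s -> nat) : weight FD := \sum_p beta p *+ b p.

Lemma fw_root_of d e c b : fw d - fw e = c *: root_of b ->
  forall p, (orbsum e p - orbsum d p)%:~R = c * (b p)%:R.
Proof.
move=> eq_de p; apply/eqP; rewrite -subr_eq0; apply/eqP.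
move: p; apply: (beta_free (S := S) (sg := sg) ca hs).
rewrite (eq_bigr (fun p => (orbsum e p - orbsum d p)%:~R *: beta p - c *: (beta p *+ b p))).
  by rewrite sumrB -fwB -scaler_sumr eq_de subrr.
by move=> p _; rewrite scalerBl -[X in _ = _ - _ *: X]scaler_nat scalerA.
Qed.

(** A simple reflection keeps a root positive unless this root is a multiple of
    the simple one, since it alters one coordinate and roots have a sign. *)
Lemma root_reflect p b : is_root (root_of b) -> (exists2 q, q != p & b q != 0%N) ->
  exists b', [/\ sr p (root_of b) = root_of b', forall q, q != p -> b' q = b q &
    (b' p)%:R = (b p)%:R - ev (root_of b) (H p)].
Proof.
move=> rb [q0 nq0 bq0].
have [c def_c sgn_c] := fold_root_signed hs (is_root_refl fsd p rb).
set t := ev (root_of b) (H p).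
have eq_c q : (c q)%:~R = (b q)%:R - (q == p)%:R * t :> K.
  apply/eqP; rewrite -subr_eq0; apply/eqP; move: q; apply: (beta_free (S := S) (sg := sg) ca hs).
  under eq_bigr do rewrite !scalerBl.
  rewrite sumrB -def_c simple_reflE [cd_coroot _]/= [cd_root _]/= -/t sumrB.
  rewrite [X in _ - (_ - X)](_ : _ = t *: beta p); last first.
    rewrite (bigD1 p) //= eqxx mul1r big1 ?addr0 // => q /negPf->.
    by rewrite mul0r scale0r.
  rewrite [X in _ - (X - _)](_ : _ = root_of b) ?subrr //.
  by apply: eq_bigr => q _; rewrite scaler_nat.
have c_ge0 : forall q, 0 <= c q.
  case: sgn_c => // c_le0; have := eq_c q0; rewrite (negPf nq0) mul0r subr0.
  move=> eq0; have : (0 : K) < (c q0)%:~R by rewrite eq0 ltr0n lt0n.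
  by rewrite ltr0z ltNge c_le0.
have absc q : (`|c q|%N)%:R = (c q)%:~R :> K.
  by rewrite pmulrn gez0_abs.
exists (fun q => `|c q|%N); split=> [|q nqp|].
- rewrite def_c; apply: eq_bigr => q _; by rewrite -absc scaler_nat.
- apply/eqP; rewrite -(eqr_nat K) absc eq_c (negPf nqp) mul0r subr0 //.
- by rewrite absc eq_c eqxx mul1r.
Qed.

Lemma fold_value_lt_of_pairing p d e c b : 0 < c -> fw d - fw e = c *: root_of b ->
  (0 < ev (root_of b) (H p)) = (fold_value p e < fold_value p d).
Proof.
move=> c0 eq_de; rewrite -(pmulr_rgt0 _ c0) -evZ -eq_de evD evN.
rewrite !(ev_fres_wt sg la_lam) -mulrBr pmulr_rgt0 ?ltr0n ?eps_gt0 //.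
by rewrite -rmorphB ltr0z subr_gt0.
Qed.

Lemma single_support p b : ~ (exists2 q, q != p & b q != 0%N) ->
  forall q : sigma_orbit s, q != p -> b q = 0%N.
Proof.
move=> none q nqp; apply/eqP; apply: contraT => bq; case: none; by exists q.
Qed.

(** A step in the direction of a multiple of the simple root of [p] is the
    reflection attached to [p], by comparison of norms. *)
Lemma fold_orb_reflect_root p d e c b : fold_orb d -> fold_orb e -> 0 < c ->
  fw d - fw e = c *: root_of b -> is_root (root_of b) ->
  (forall q, q != p -> b q = 0%N) ->
  0 < fold_value p d /\ fw e = fw (fold_move p d).
Proof.
move=> gd ge c0 eq_de [b0 _] b_out; have eqD := fw_root_of eq_de.
have bp : (0 < b p)%N.
  rewrite lt0n; apply: contraNneq b0 => bp0; rewrite /root_of big1 // => q _.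
  by have [->|/b_out->] := eqVneq q p; rewrite ?bp0.
have posp : 0 < orbsum e p - orbsum d p.
  by rewrite -(ltr0z K) eqD mulr_gt0 ?ltr0n.
have eq_q q : q != p -> orbsum d q = orbsum e q.
  move=> /b_out bq; apply/eqP; rewrite eq_sym -subr_eq0 -(intr_eq0 K) eqD bq.
  by rewrite mulr0.
have ne_p : orbsum d p != orbsum e p by rewrite eq_sym -subr_eq0 gt_eqF.
have [eq_p ->] := fold_orb_reflect gd ge eq_q ne_p; split=> //.
by move: posp; rewrite eq_p pmulrn_lgt0 // eps_gt0.
Qed.

(** A reflection of [W~] that moves a weight down in the root order of [g(0)]
    does so in the root order of [g], for the corresponding weights: by
    induction on the height of the root, conjugating by simple reflections. *)
Lemma strong_step_le b d e c : fold_orb d -> fold_orb e -> 0 < c ->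
  fw d - fw e = c *: root_of b -> is_root (root_of b) -> forall i, d i <= e i.
Proof.
have [k] := ubnP (\sum_p b p)%N; elim: k b d e c => // k IHk b d e c.
rewrite ltnS => le_k gd ge c0 eq_de rb.
have eqD := fw_root_of eq_de.
have hd := fixed_of gd; have he := fixed_of ge.
have [p bp tp] : exists2 p, (0 < b p)%N & fold_value p e < fold_value p d.
  have orbsumB p : orbsum (fun i => e i - d i) p = orbsum e p - orbsum d p.
    exact: sumrB.
  have [||p posp rowp] := fold_descent ca hs (d := fun i => e i - d i).
  - by move=> p; rewrite orbsumB -(ler0z K) eqD mulr_ge0 ?ler0n // ltW.
  - have [b0 _] := rb; apply: NNPP => none; case/eqP: b0.
    rewrite /root_of big1 // => p _.
    suff -> : b p = 0%N by [].
    apply/eqP; rewrite -(eqr_nat K) -(mulrI_eq0 _ (lregP (lt0r_neq0 c0))) -eqD.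
    by rewrite intr_eq0 -orbsumB; apply: contraT => ?; case: none; exists p.
  exists p.
    move: posp; rewrite orbsumB -(ltr0z K) eqD pmulr_rgt0 // ltr0n //.
  rewrite -subr_gt0; move: rowp; rewrite !fold_valueE -sumrB; congr (0 < _).
  by apply: eq_bigr => i _; apply: sub_wval.
have [[q nqp bq]|none] := classic (exists2 q, q != p & b q != 0%N); last first.
  have [tp0 eq_e] := fold_orb_reflect_root gd ge c0 eq_de rb (single_support none).
  have ht := fixed_orb_move ca hs hsg la_lam p hd.
  move=> i; rewrite (fres_inj ca hf hft he ht eq_e) fold_moveE.
  case: ifP => _; last by rewrite addr0.
  rewrite lerDl sumr_ge0 // => j /andP[jp _].
  exact: (fold_value_ge0 ca hsg la_lam lam_ge0 hd (ltW tp0)).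
have [b' [eq_b' out_b' at_b']] := root_reflect rb (ex_intro2 _ _ q nqp bq).
have ev0 : 0 < ev (root_of b) (H p) by rewrite (fold_value_lt_of_pairing p c0 eq_de).
have lt_b' : (b' p < b p)%N.
  by rewrite -(ltr_nat K) at_b' gtrBl.
have le_t : forall i, fold_move p d i <= fold_move p e i.
  apply: (IHk b' _ _ c) => //; try exact: fold_orb_move.
  - apply: leq_trans le_k; rewrite (bigD1 p) //= [in X in (_ < X)%N](bigD1 p) //=.
    rewrite -addSn leq_add //; apply: leq_sum => r nr; by rewrite out_b'.
  - rewrite (fres_fold_move ca sg hs la_lam p d) (fres_fold_move ca sg hs la_lam p e) -eq_b'.
    by rewrite -linearB eq_de linearZ.
  - by rewrite -eq_b'; apply: is_root_refl.
move=> i; rewrite -(fold_moveK ca hs lam p d) -(fold_moveK ca hs lam p e).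
apply: (fold_move_mono ca hs hsg la_lam lam_ge0 la_min) => //;
  try exact: (fixed_orb_move ca hs hsg la_lam).
by rewrite !(fold_value_fold_move ca hs); lia.
Qed.

Let rla : weight FD := res s la.

(** Every weight of a chain in [W~ res la] lifts, so the steps can be treated one
    by one. *)
Lemma strong_le d e : fold_orb d -> fold_orb e -> le_s rla (fw d) (fw e) ->
  forall i, d i <= e i.
Proof.
move=> gd ge le_de.
pose R (mu nu : weight FD) := forall d e, fold_orb d -> fold_orb e -> mu = fw d -> nu = fw e ->
  forall i, d i <= e i.
suff: R (fw d) (fw e) by apply.
apply: (@chain_in_ind _ _ _ R _ _ _ _ le_de) => [mu _ d' e' gd' ge' -> eq_de i|].
  by rewrite (fres_inj ca hf hft (fixed_of gd') (fixed_of ge') eq_de).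
move=> x y z _ oy _ [be [v [[rb [b def_b]] _ def_y pos]]] IH d' e' gd' ge' def_x def_z i.
have [d1 gd1 def_y1] := orbit_fold_orb ca hs la_lam oy.
apply: le_trans (IH _ _ gd1 ge' def_y1 def_z i).
apply: (strong_step_le (b := b) gd' gd1 pos); last by rewrite /root_of -def_b.
by rewrite -def_x -def_y1 -def_y opprB addrC subrK def_b.
Qed.

Lemma simple_step p d : fold_orb d -> 0 < fold_value p d ->
  le_s rla (fw d) (fw (fold_move p d)).
Proof.
move=> gd t0; apply: chain_in1; try exact: (fold_orb_orbit ca sg hs la_lam).
  by apply: (fold_orb_orbit ca sg hs la_lam); apply: fold_orb_move.
exists (beta p), (H p); split.
- exact: (positive_root_simple fsd p).
- exact: (is_coroot_simple fsd p).
- by rewrite (fres_fold_move ca sg hs la_lam) simple_reflE.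
- by rewrite (ev_fw_gt0 sg la_lam).
Qed.

(** The reflection attached to [p] maps the step to a step, unless the root is a
    multiple of the simple root of [p], whose sign it changes; in that case it
    exchanges the two ends. *)
Lemma step_reflect p d e b v : fold_orb d -> fold_orb e -> positive_root b -> is_coroot b v ->
  fw d - ev (fw d) v *: b = fw e -> 0 < ev (fw d) v ->
  fw e = fw (fold_move p d) \/ le_s rla (fw (fold_move p d)) (fw (fold_move p e)).
Proof.
move=> gd ge [rb [c def_b]] [v_in bv v_refl] def_e pos.
have rb' : is_root (root_of c) by rewrite /root_of -def_b.
have eq_de : fw d - fw e = ev (fw d) v *: root_of c.
  by rewrite -def_e opprB addrC subrK def_b.
have [[q nqp cq]|none] := classic (exists2 q, q != p & c q != 0%N); last first.
  by left; have [] := fold_orb_reflect_root gd ge pos eq_de rb' (single_support none).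
right; have [c' [eq_c' _ _]] := root_reflect rb' (ex_intro2 _ _ q nqp cq).
pose v' := v - ev (beta p) v *: H p.
have ev_v' (mu : weight FD) : ev (sr p mu) v' = ev mu v.
  rewrite simple_reflE [cd_coroot _]/= [cd_root _]/= /v'.
  rewrite evD evN evZ evxD evxN evxZ evxD evxN evxZ (ev_beta_diag S ca sg hs); ring.
have ev_v (mu : weight FD) : ev (sr p mu) v = ev mu v'.
  by rewrite -ev_v' (simple_reflK fsd).
apply: chain_in1; try by apply: (fold_orb_orbit ca sg hs la_lam); apply: fold_orb_move.
exists (sr p b), v'.
rewrite (fres_fold_move ca sg hs la_lam p d) (fres_fold_move ca sg hs la_lam p e) ev_v'.
split=> //.
- split; first exact: (is_root_refl fsd).
  by exists c'; rewrite [b]def_b.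
- split; first by rewrite memvB ?memvZ //; apply: fold_coroot_in.
    by rewrite ev_v'.
  move=> x rx; have /(is_root_refl fsd p) := v_refl _ (is_root_refl fsd p rx).
  by rewrite linearB linearZ /= (simple_reflK fsd) ev_v.
- by rewrite -def_e linearB; congr (_ - _); exact/esym/linearZ.
Qed.

(* In the root order; in the Bruhat order this is the larger of the two weights
   exchanged by [p]. *)
Let low p d := if fold_value p d <= 0 then fw d else fw (fold_move p d).

Let le_low p d : fold_orb d -> le_s rla (fw d) (low p d).
Proof.
move=> gd; rewrite /low; case: lerP => t0; last exact: simple_step.
exact/chain_in_refl/(fold_orb_orbit ca sg hs la_lam).
Qed.

Let fw_fold_moveK p d : fw (fold_move p (fold_move p d)) = fw d.
Proof. by rewrite (eq_wt la (fold_moveK ca hs lam p d)). Qed.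

Let low_fold_move p d : low p (fold_move p d) = low p d.
Proof.
rewrite /low (fold_value_fold_move ca hs) fw_fold_moveK oppr_le0.
case: (ltrgtP (fold_value p d) 0) => // t0.
rewrite (fres_fold_move ca sg hs la_lam) simple_reflE [cd_coroot _]/=.
by rewrite (ev_fres_wt sg la_lam) t0 mulr0 scale0r subr0.
Qed.

(** A step is either fixed up to exchange by [p], in which case [low] does not
    change, or it has an image under [p]; both the step and its image then lead
    to weights from which [low] can be reached. *)
Lemma low_mono p d e : fold_orb d -> fold_orb e -> le_s rla (fw d) (fw e) ->
  le_s rla (low p d) (low p e).
Proof.
have eq_low d1 d2 : fold_orb d1 -> fold_orb d2 -> fw d1 = fw d2 -> low p d1 = low p d2.
  move=> g1 g2 /(fres_inj ca hf hft (fixed_of g1) (fixed_of g2)) eq_d.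
  have eq_w i : wv d1 i = wv d2 i.
    by rewrite /wval; congr (_ - _); apply: eq_bigr => j _; rewrite eq_d.
  rewrite /low /fold_value (eq_bigr (wv d2)) // (eq_wt la eq_d).
  rewrite (@eq_wt _ _ _ _ _ la (fold_move p d1) (fold_move p d2)) // => i.
  by rewrite !fold_moveE eq_d /tau; under eq_bigr do rewrite eq_w.
move=> gd ge le_de.
pose R (mu nu : weight FD) := forall d e, fold_orb d -> fold_orb e -> mu = fw d -> nu = fw e ->
  le_s rla (low p d) (low p e).
have low_orbit d1 : fold_orb d1 -> weyl_orbit rla (low p d1).
  move=> g1; rewrite /low.
  by case: ifP => _; apply: (fold_orb_orbit ca sg hs la_lam) => //; apply: fold_orb_move.
suff: R (fw d) (fw e) by apply.
apply: (@chain_in_ind _ _ _ R _ _ _ _ le_de) => [mu _ d' e' gd' ge' -> eq_de|].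
  by rewrite (eq_low _ _ gd' ge' eq_de); apply/chain_in_refl/low_orbit.
move=> x y z ox oy _ st IH d' e' gd' ge' def_x def_z.
have [d1 gd1 def_y] := orbit_fold_orb ca hs la_lam oy.
apply: chain_in_trans (IH _ _ gd1 ge' def_y def_z).
have st_chain : le_s rla x y by apply: chain_in1.
case: st => b [v [pb cb def_y1 pos]]; rewrite def_x def_y in def_y1 pos st_chain.
have [eq_y|le_t] := step_reflect p gd' gd1 pb cb def_y1 pos.
  rewrite (eq_low _ _ gd1 (fold_orb_move p gd') eq_y) low_fold_move.
  exact/chain_in_refl/low_orbit.
rewrite {1}/low; case: ifP => _; first exact: chain_in_trans st_chain (le_low p gd1).
apply: chain_in_trans le_t _; rewrite -low_fold_move; exact/le_low/fold_orb_move.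
Qed.

(** Induction on [e]: if the weight of [e] is not dominant, it lies above its image
    under some [p], and the lifting properties compare [d], or its image under [p],
    with that image. *)
Lemma ge_strong d e : fold_orb d -> fold_orb e -> (forall i, d i <= e i) ->
  le_s rla (fw d) (fw e).
Proof.
have ge0 e' i : fold_orb e' -> 0 <= e' i.
  by move=> ge'; apply: (orb_ge0 ca la_lam lam_ge0 la_min hf i (fixed_orb_orb (fixed_of ge'))).
have [k] := ubnP `|(\sum_i e i)%R|%N; elim: k d e => // k IHk d e lt_k gd ge le_de.
have hd := fixed_of gd; have he := fixed_of ge.
have [w0|/not_all_ex_not[i /negP]] := classic (forall i, 0 <= wv e i).
  have e0 := orb_dominant ca la_lam lam_ge0 la_min hf (fixed_orb_orb he) w0.
  rewrite (@eq_wt _ _ _ _ _ la d e) => [|i].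
    exact/chain_in_refl/(fold_orb_orbit ca sg hs la_lam).
  by have := le_de i; have := ge0 d i gd; rewrite e0; lia.
rewrite -ltNge => wi; pose p := orbit_of s i.
have te : fold_value p e < 0.
  rewrite ltNge; apply/negP => te.
  by have := fold_value_ge0 ca hsg la_lam lam_ge0 he te (orbit_of_mem s i); rewrite leNgt wi.
have gt := fold_orb_move p ge.
have lt_t : (`|(\sum_j fold_move p e j)%R| < k)%N.
  have E : \sum_j fold_move p e j = \sum_j e j + fold_value p e *+ eps a p.
    rewrite (sum_orbits s) [in RHS](sum_orbits s).
    under eq_bigr do rewrite -/(orbsum _ _) (orbsum_fold_move ca hs).
    rewrite big_split; congr (_ + _).
    by rewrite /= (bigD1 p) //= eqxx big1 ?addr0 // => q /negPf->.
  have t_lt0 : fold_value p e *+ eps a p < 0 by rewrite pmulrn_llt0 ?eps_gt0.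
  have : 0 <= \sum_j fold_move p e j by apply: sumr_ge0 => j _; exact: (ge0 (fold_move p e) j gt).
  rewrite E; move: t_lt0 lt_k; move: (_ *+ _) (\sum_j e j) => X Y; clear; lia.
have [td|td] := lerP 0 (fold_value p d).
  have le_t := fold_move_lift ca hs hsg la_lam lam_ge0 la_min hd he le_de td (ltW te).
  apply: chain_in_trans (IHk _ _ lt_t gd gt le_t) _.
  rewrite -[fw e](fw_fold_moveK p); apply: simple_step => //.
  by rewrite (fold_value_fold_move ca hs) oppr_gt0.
have le_t : forall j, fold_move p d j <= fold_move p e j.
  by apply: (fold_move_mono ca hs hsg la_lam lam_ge0 la_min) => //; left; apply: ltW.
have := low_mono p (fold_orb_move p gd) gt (IHk _ _ lt_t (fold_orb_move p gd) gt le_t).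
by rewrite !low_fold_move /low !ltW.
Qed.

Lemma strong_order_iso :
  let imft (F : {set P}) := exists2 nu, weyl_orbit rla nu & ft nu = F in
  poset_iso (weyl_orbit rla) (le_s rla) imft (fun F F' : {set P} => F \subset F') ft.
Proof.
have lift := orbit_fold_orb ca hs la_lam.
split=> [nu onu|||_ _ /lift[d gd ->] /lift[e ge ->]].
- by exists nu.
- exact: (ft_inj ca hs hsg la_lam hf hft).
- by move=> _ [nu onu <-]; exists nu.
rewrite (ft_fres hft (fixed_of gd)) (ft_fres hft (fixed_of ge)).
have od := fixed_orb_orb (fixed_of gd); have oe := fixed_orb_orb (fixed_of ge).
split=> [/(strong_le gd ge)|].
  by move/(filt_subP ca la_lam la_min hf od oe).
by move/(filt_subP ca la_lam la_min hf od oe)/(ge_strong gd ge).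
Qed.

End StrongOrder.

(** * The two isomorphisms *)

Theorem theorem1p1 (R : realType) (t : dynkin) (ht : dynkin_valid t)
  (g : lie_alg (complex R)) (hg : lie_simple g) (S : chevalley (@cartan_mx t) g)
  (s : {perm 'I_(rank t)}) (hs : diagram_aut (@cartan_mx t) s) (hs1 : s != 1%g)
  (sg : 'End(g)) (hsg : lifts_diagram_aut S s sg)
  (la : weight (datum S)) (hla : minuscule la)
  (m : 'I_(rank t)) (hm : la = fund_weight S m)
  (disp : Order.disp_t) (P : finPOrderType disp) (hP : minuscule_poset la P)
  (kappa : P -> 'I_(rank t)) (hkappa : dcomplete_coloring (@cartan_mx t) m kappa)
  (f : weight (datum S) -> {set P}) (hf : colored_iso la kappa f)
  (ft : weight (fold_datum S s sg) -> {set P})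
  (hft : forall w, weyl_fixed sg w -> ft (res s (w la)) = f (w la)) :
  let rla : weight (fold_datum S s sg) := res s la in
  let imft (F : {set P}) : Prop := exists2 nu, weyl_orbit rla nu & ft nu = F in
  poset_iso (weyl_orbit rla) (le_w rla)
    imft (fold_le (fold_color s kappa)) ft /\
  poset_iso (weyl_orbit rla) (le_s rla)
    imft (fun F F' : {set P} => F \subset F') ft.
Proof.
have ca := cartan_mx_like ht.
pose lam (i : 'I_(rank t)) : int := (i == m)%:R.
have la_lam i : ev la (ch S i) = (lam i)%:~R.
  by rewrite hm ev_form_of /lam; case: (i == m).
have lam_ge0 i : 0 <= lam i by rewrite ler0n.
split; first exact: (weak_order_iso ca hs hsg la_lam lam_ge0 hla hf hft).
exact: (strong_order_iso ca hs hsg la_lam lam_ge0 hla hf hft).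
Qed.
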